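(* There is a deterministic algorithm that, given a dataset $X\subseteq\ell_\infty^d$ of size $|X|=n$, a diameter bound $\Delta>0$ and a parameter $0<\rho<1$, runs in time $O(n^{1+\rho}\cdot\rho^{-1}d^2\log n)$ and outputs a collection $\mathcal{R}$ of axis-aligned rectangles in $\mathbb{R}^d$, with associated cluster collection $\mathcal{C}(\mathcal{R})=\{C(R):=X\cap R\}_{R\in\mathcal{R}}$, such that the following hold for $s=O(n^\rho\cdot\rho^{-1}\log n)$ and $\beta=O(\rho^{-1}\log\log d)$: - (Diameter) Each rectangle $R\in\mathcal{R}$ has width at most $\Delta$. - (Covering) For each $x\in X$ there is a rectangle $R\in\mathcal{R}$ such that $B_\infty(x,\frac{\Delta}{\beta})\subseteq R$. - (Sparsity) Each $x\in X$ is contained in at most $s$ rectangles from $\mathcal{R}$. In particular, the cluster collection $\mathcal{C}(\mathcal{R})$ forms a $(\beta,s,\Delta)$-neighborhood cover of $X$ (with the $\ell_\infty$ metric).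
   Context: $\ell_\infty^d$ is $\mathbb{R}^d$ with the norm $\|x\|_\infty=\max_i|x_i|$, and $B_\infty(x,r)=\{y\in\mathbb{R}^d:\|x-y\|_\infty\le r\}$ is the closed ball in the whole space $\mathbb{R}^d$. For a finite $X\subseteq\ell_\infty^d$, $B_X(x,r)=\{y\in X:\|x-y\|_\infty\le r\}$. An axis-aligned rectangle in $\mathbb{R}^d$ is a set $R=I_1\times\cdots\times I_d$ where each $I_i$ is an interval in $\mathbb{R}$ (of any of the forms $[a,b],(a,b],[a,b),(a,b)$). The width of $R$ is the length of the longest interval among $I_1,\dots,I_d$. A collection $\mathcal{C}$ of subsets of $X$ (called clusters) is a $(\beta,s,\Delta)$-neighborhood cover of $X$ if: (i) each $C\in\mathcal{C}$ has diameter at most $\Delta$; (ii) for each $x\in X$ there is $C\in\mathcal{C}$ with $B_X(x,\frac{\Delta}{\beta})\subseteq C$; (iii) each $x\in X$ is contained in at most $s$ clusters of $\mathcal{C}$. Constants in $O(\cdot)$ are universal. Running time counts unit-cost operations on real numbers. Logarithmic factors inside $O(\cdot)$ are read as at least $1$ (i.e. $n,d$ larger than a constant). *)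

(* Defs.v *)
From HB Require Import structures.
From mathcomp Require Import all_boot all_order all_algebra.
From mathcomp Require Import all_classical all_reals all_analysis.

Set Implicit Arguments.
Unset Strict Implicit.
Unset Printing Implicit Defensive.

Import Order.TTheory GRing.Theory Num.Theory.
Import numFieldNormedType.Exports.

Local Open Scope classical_set_scope.
Local Open Scope ring_scope.

(* The norm of 'rV[R]_d in MathComp-Analysis is the maximum of the absolute
   values of the entries, so 'rV[R]_d is the space l_infty^d.               *)

(* Logarithms inside O(.), read as at least 1; lg (lg d) is log log d. *)
Definition lg {R : realType} (x : R) : R := Num.max 1 (ln x).

(** * Axis-aligned rectangles *)

(* The i-th side is the interval from rlo i to rhi i; rloc i (resp. rhic i)
   tells whether the left (resp. right) endpoint belongs to it.             *)
Record rectangle (R : realType) (d : nat) := Rectangle {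
  rlo : 'I_d -> R;
  rhi : 'I_d -> R;
  rloc : 'I_d -> bool;
  rhic : 'I_d -> bool }.

Section Rectangles.
Context {R : realType} {d : nat}.
Implicit Type Q : rectangle R d.

(* As a right bound, BSide true b excludes b and BSide false b includes it. *)
Definition rside Q (i : 'I_d) : interval R :=
  Interval (BSide (rloc Q i) (rlo Q i)) (BSide (~~ rhic Q i) (rhi Q i)).

Definition rect_set Q : set 'rV[R]_d :=
  [set x | forall i, x ord0 i \in rside Q i].

(* A side with rhi Q i < rlo Q i is the empty interval, of length 0. *)
Definition width Q : R := \big[Num.max/0]_(i < d) (rhi Q i - rlo Q i).

End Rectangles.

(** * Neighborhood covers *)

Section Covers.
Context {R : realType} {V : normedModType R}.

Definition diam (A : set V) : \bar R :=
  ereal_sup [set (`|x - y|)%:E | x in A & y in A].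

Definition ball_in (X : set V) (x : V) (r : R) : set V :=
  X `&` closed_ball_ Num.norm x r.

(* The collection is a finite indexed family: clusters are counted with
   multiplicity.                                                            *)
Definition neighborhood_cover (X : set V) (beta s Delta : R)
    (I : finType) (C : I -> set V) : Prop :=
  [/\ forall i, C i `<=` X,
      forall i, (diam (C i) <= Delta%:E)%E,
      forall x, X x -> exists i, ball_in X x (Delta / beta) `<=` C i &
      forall x, X x -> (#|[pred i | x \in C i]|)%:R <= s].

End Covers.

(** * Deterministic real RAM

   While programs over two memories, one of natural numbers and one of real
   numbers.  Each memory consists of arrays of unbounded length; a program
   names finitely many of them, by constants, and computes indices into them.
   There is no operation from reals to integers (no floor) and no integer
   division; a comparison is the only way a real can influence an index.    *)

Inductive iexp :=
| INum of nat
| ILoad of nat & iexp  (* ILoad a e: cell e of natural-number array a *)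
| IAdd of iexp & iexp
| ISub of iexp & iexp  (* truncated *)
| IMul of iexp & iexp.

Inductive rexp :=
| ROfNat of iexp
| RLoad of nat & iexp  (* RLoad a e: cell e of real array a *)
| RAdd of rexp & rexp
| RSub of rexp & rexp
| RMul of rexp & rexp
| RDiv of rexp & rexp. (* x / 0 = 0 *)

Inductive bexp :=
| BILe of iexp & iexp
| BRLe of rexp & rexp
| BNot of bexp
| BAnd of bexp & bexp.

Inductive cmd :=
| Skip
| IStore of nat & iexp & iexp  (* IStore a e v: cell e of array a := v *)
| RStore of nat & iexp & rexp
| Seq of cmd & cmd
| If of bexp & cmd & cmd
| While of bexp & cmd.

Section RealRAM.
Context {R : realType}.

Record state := State {
  imem : nat -> nat -> nat;
  rmem : nat -> nat -> R }.

Definition upd {T : Type} (m : nat -> nat -> T) (a k : nat) (v : T) :=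
  fun (a' k' : nat) => if (a' == a) && (k' == k) then v else m a' k'.

Fixpoint ieval (st : state) (e : iexp) : nat :=
  match e with
  | INum k => k
  | ILoad a e1 => imem st a (ieval st e1)
  | IAdd e1 e2 => (ieval st e1 + ieval st e2)%N
  | ISub e1 e2 => (ieval st e1 - ieval st e2)%N
  | IMul e1 e2 => (ieval st e1 * ieval st e2)%N
  end.

Fixpoint reval (st : state) (e : rexp) : R :=
  match e with
  | ROfNat e1 => (ieval st e1)%:R
  | RLoad a e1 => rmem st a (ieval st e1)
  | RAdd e1 e2 => reval st e1 + reval st e2
  | RSub e1 e2 => reval st e1 - reval st e2
  | RMul e1 e2 => reval st e1 * reval st e2
  | RDiv e1 e2 => reval st e1 / reval st e2
  end.

Fixpoint beval (st : state) (b : bexp) : bool :=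
  match b with
  | BILe e1 e2 => (ieval st e1 <= ieval st e2)%N
  | BRLe e1 e2 => reval st e1 <= reval st e2
  | BNot b1 => ~~ beval st b1
  | BAnd b1 b2 => beval st b1 && beval st b2
  end.

(* Unit cost: every node of an expression costs 1 per evaluation. *)
Fixpoint icost (e : iexp) : nat :=
  match e with
  | INum _ => 1
  | ILoad _ e1 => (icost e1).+1
  | IAdd e1 e2 | ISub e1 e2 | IMul e1 e2 => (icost e1 + icost e2).+1
  end.

Fixpoint rcost (e : rexp) : nat :=
  match e with
  | ROfNat e1 | RLoad _ e1 => (icost e1).+1
  | RAdd e1 e2 | RSub e1 e2 | RMul e1 e2 | RDiv e1 e2 =>
      (rcost e1 + rcost e2).+1
  end.

Fixpoint bcost (b : bexp) : nat :=
  match b with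
  | BILe e1 e2 => (icost e1 + icost e2).+1
  | BRLe e1 e2 => (rcost e1 + rcost e2).+1
  | BNot b1 => (bcost b1).+1
  | BAnd b1 b2 => (bcost b1 + bcost b2).+1
  end.

(* exec c st t st': started in st, c halts in st' after t steps. *)
Inductive exec : cmd -> state -> nat -> state -> Prop :=
| ExecSkip st : exec Skip st 1 st
| ExecIStore a e v st :
    exec (IStore a e v) st (icost e + icost v).+1
      (State (upd (imem st) a (ieval st e) (ieval st v)) (rmem st))
| ExecRStore a e v st :
    exec (RStore a e v) st (icost e + rcost v).+1
      (State (imem st) (upd (rmem st) a (ieval st e) (reval st v)))
| ExecSeq c1 c2 st1 st2 st3 t1 t2 :
    exec c1 st1 t1 st2 -> exec c2 st2 t2 st3 ->
    exec (Seq c1 c2) st1 (t1 + t2).+1 st3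
| ExecIfT b c1 c2 st st' t :
    beval st b -> exec c1 st t st' ->
    exec (If b c1 c2) st (bcost b + t).+1 st'
| ExecIfF b c1 c2 st st' t :
    ~~ beval st b -> exec c2 st t st' ->
    exec (If b c1 c2) st (bcost b + t).+1 st'
| ExecWhileF b c st :
    ~~ beval st b -> exec (While b c) st (bcost b).+1 st
| ExecWhileT b c st1 st2 st3 t1 t2 :
    beval st1 b -> exec c st1 t1 st2 -> exec (While b c) st2 t2 st3 ->
    exec (While b c) st1 (bcost b + t1 + t2).+1 st3.

Lemma exec_det c st t1 st1 t2 st2 :
  exec c st t1 st1 -> exec c st t2 st2 -> t1 = t2 /\ st1 = st2.
Proof.
move=> h; elim: h t2 st2 => {c st t1 st1}.
- by move=> st t2 st2 h; inversion h.
- by move=> a e v st t2 st2 h; inversion h.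
- by move=> a e v st t2 st2 h; inversion h.
- move=> c1 c2 s1 s2 s3 u1 u2 _ ih1 _ ih2 t2 st2 h.
  inversion h as [| | |? ? ? s2' ? v1 v2 h1 h2| | | |]; subst.
  by have [? ?] := ih1 _ _ h1; subst; have [? ?] := ih2 _ _ h2; subst.
- move=> b c1 c2 s s' t hb _ ih t2 st2 h.
  inversion h as [| | | |? ? ? ? ? ? h0 h1|? ? ? ? ? ? h0 h1| |]; subst.
    by have [-> ->] := ih _ _ h1.
  by rewrite hb in h0.
- move=> b c1 c2 s s' t hb _ ih t2 st2 h.
  inversion h as [| | | |? ? ? ? ? ? h0 h1|? ? ? ? ? ? h0 h1| |]; subst.
    by rewrite h0 in hb.
  by have [-> ->] := ih _ _ h1.
- move=> b c s hb t2 st2 h.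
  inversion h as [| | | | | |? ? ? h0|? ? ? ? ? ? ? h0 h1 h2]; subst => //.
  by rewrite h0 in hb.
- move=> b c s1 s2 s3 u1 u2 hb _ ih1 _ ih2 t2 st2 h.
  inversion h as [| | | | | |? ? ? h0|? ? ? ? ? ? ? h0 h1 h2]; subst.
    by rewrite hb in h0.
  by have [? ?] := ih1 _ _ h1; subst; have [? ?] := ih2 _ _ h2; subst.
Qed.

(** Input and output conventions

   Input:  natural-number array 0 = n, d; real array 0 = the points, point j
           occupying cells j * d, ..., j * d + d - 1; real array 1 = Delta,
           rho.  All other cells are 0.
   Output: cell 0 of natural-number array 1 = the number of rectangles; for
           the i-th side of rectangle k, cell k * d + i of real arrays 2 and
           3 = its endpoints, and cell k * d + i of natural-number arrays 2
           and 3 is nonzero iff the left, resp. right, endpoint is included. *)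

Definition input (n d : nat) (X : 'I_n -> 'rV[R]_d) (Delta rho : R) : state :=
  State
    (fun a k => match a, k with
                | 0, 0 => n
                | 0, 1 => d
                | _, _ => 0
                end%N)
    (fun a k => match a, k with
                | 0%N, _ =>
                    match insub (k %/ d)%N, insub (k %% d)%N with
                    | Some j, Some i => X j ord0 i
                    | _, _ => 0
                    end
                | 1%N, 0%N => Delta
                | 1%N, 1%N => rho
                | _, _ => 0
                end).

Definition output_size (st : state) : nat := imem st 1 0.

Definition output (d : nat) (st : state) (k : 'I_(output_size st)) :
    rectangle R d :=
  Rectangle (fun i : 'I_d => rmem st 2 (k * d + i)%N)
            (fun i : 'I_d => rmem st 3 (k * d + i)%N)
            (fun i : 'I_d => imem st 2 (k * d + i)%N != 0%N)
            (fun i : 'I_d => imem st 3 (k * d + i)%N != 0%N).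

End RealRAM.

Arguments state : clear implicits.
Arguments output {R} d st k.

(* Main.v *)
(* Write y_e for the 2d signed coordinates, u = 1 + rho / 2, and
   let w be of order Delta * rho / log log d. Consider m points and start, in a
   direction e, from the m/(4d)-quantile H of y_e. Walk down from H in steps of
   w, and let B and C be the numbers of points with y_e >= t and y_e > t - w at
   the current threshold t. If C <= m / 2 and C <= B * u^log2(m / B), cutting
   along the slab ]t - w, t[ loses only C - B points and does not decrease the
   sum of the (cell size)^(1 - rho). A failed test multiplies log(m / B) by at
   most 1 - rho / 10, so after O(rho^-1 log log d) failures more than half of
   the points lie above t - w. If this happens in both orientations of every
   coordinate, the box {y_e <= H_e + w / 3 for all e} has sides at most Delta
   and contains, w / 3 deep, at least half of the m points.

   A round starts with the uncovered points in one cell and refines the cells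
   level by level: it cuts a cell along a good slab if there is one, and
   otherwise emits the box and covers its points. A level shrinks every cell by
   1 - 1/(4d), so there are O(d log n) levels, and the potential above shows
   that a round with m points covers at least m^(1 - rho) of them; hence
   m^rho / rho decreases by 1 and there are at most n^rho / rho rounds. During a
   round every point of X lies in at most one cell at a time, and each box
   around it halves this cell, so it meets at most log2 n + 1 boxes.

   Sorting the points along every direction once makes a level cost O(nd): the
   walks of all cells are interleaved in one scan of each sorted order. *)
Require Import Defs.
From HB Require Import structures.
From mathcomp Require Import all_boot all_order all_algebra.
From mathcomp Require Import all_classical all_reals all_analysis.
From mathcomp Require Import zify ring lra.

Set Implicit Arguments.
Unset Strict Implicit.
Unset Printing Implicit Defensive.

Import Order.TTheory GRing.Theory Num.Theory.
Import numFieldNormedType.Exports.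

Local Open Scope classical_set_scope.
Local Open Scope ring_scope.

(** * Reasoning about programs *)

(** The machine has no powers, logarithms or rounding, so the exponent in the test is made an
    integer through truncated logarithms, and the powers of u are tabulated beforehand. The choice u
    = 1 + rho / 2 meets two opposite demands: u <= 2^rho, so that an accepted cut satisfies C <=
    B^(1 - rho) m^rho, which is exactly what the potential requires; and ln u >= rho / 3, so that a
    rejected cut contracts log(m / B) by the stated factor.

    The obstacle to sparsity is a point that has left all cells, inside a slab or a box: later boxes
    are enlarged by w / 3 and might still contain it. Each point j therefore keeps a location
    [loc j], which follows the cuts as if every slab were split at its middle. Since w / 2 > w / 3,
    the box of a cell other than [loc j] never reaches j, and each box of the cell at [loc j] halves
    that cell. *)

Section Programs.
Context {R : realType}.
Implicit Types (s : state R) (c : cmd).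
Local Open Scope nat_scope.

Fixpoint imods c : seq nat :=
  match c with
  | Skip | RStore _ _ _ => [::]
  | IStore a _ _ => [:: a]
  | Seq c1 c2 | If _ c1 c2 => imods c1 ++ imods c2
  | While _ c1 => imods c1
  end.

Fixpoint rmods c : seq nat :=
  match c with
  | Skip | IStore _ _ _ => [::]
  | RStore a _ _ => [:: a]
  | Seq c1 c2 | If _ c1 c2 => rmods c1 ++ rmods c2
  | While _ c1 => rmods c1
  end.

Definition frame c s s' : Prop :=
  (forall a, a \notin imods c -> imem s' a = imem s a) /\
  (forall a, a \notin rmods c -> rmem s' a = rmem s a).


Lemma frame_sub c c' s1 s2 :
  {subset imods c <= imods c'} -> {subset rmods c <= rmods c'} ->
  frame c s1 s2 -> frame c' s1 s2.
Proof.
move=> si sr [hi hr]; split=> a ha.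
  by apply: hi; apply: contra ha; apply: si.
by apply: hr; apply: contra ha; apply: sr.
Qed.

Lemma frame_trans c s1 s2 s3 : frame c s1 s2 -> frame c s2 s3 -> frame c s1 s3.
Proof.
move=> [i1 r1] [i2 r2]; split=> a ha; first by rewrite i2 ?i1.
by rewrite r2 ?r1.
Qed.

Lemma upd_other (T : Type) (m : nat -> nat -> T) a k v a' :
  a' != a -> upd m a k v a' = m a'.
Proof. by move=> /negbTE ne; apply/funext => k'; rewrite /upd ne. Qed.

Lemma exec_frame c s t s' : exec c s t s' -> frame c s s'.
Proof.
elim=> {c s t s'}.
- by [].
- move=> a e v s; split=> //= b; rewrite inE => ?.
  exact: upd_other.
- move=> a e v s; split=> //= b; rewrite inE => ?.
  exact: upd_other.
- move=> c1 c2 s1 s2 s3 t1 t2 _ f1 _ f2.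
  apply: (@frame_trans _ _ s2).
    by apply: frame_sub f1 => a /= ha; rewrite mem_cat ha.
  by apply: frame_sub f2 => a /= ha; rewrite mem_cat ha orbT.
- move=> b c1 c2 s s' t _ _ f1.
  by apply: frame_sub f1 => a /= ha; rewrite mem_cat ha.
- move=> b c1 c2 s s' t _ _ f1.
  by apply: frame_sub f1 => a /= ha; rewrite mem_cat ha orbT.
- by [].
- move=> b c s1 s2 s3 t1 t2 _ _ f1 _ f2.
  exact: (@frame_trans _ _ s2).
Qed.

Definition run c s (T : nat) (Q : state R -> Prop) : Prop :=
  exists t s', [/\ exec c s t s', t <= T & Q s'].

Lemma run_frame c s T Q :
  run c s T Q -> run c s T (fun s' => Q s' /\ frame c s s').
Proof.
move=> [t [s' [h1 h2 h3]]]; exists t, s'; split=> //; split=> //.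
exact: exec_frame h1.
Qed.

Lemma run_weaken c s T T' (Q Q' : state R -> Prop) :
  run c s T Q -> T <= T' -> (forall s', Q s' -> Q' s') -> run c s T' Q'.
Proof.
move=> [t [s' [h1 h2 h3]]] hT hQ; exists t, s'; split=> //.
  exact: leq_trans hT.
exact: hQ.
Qed.

Lemma run_post c s T (Q Q' : state R -> Prop) :
  run c s T Q -> (forall s', frame c s s' -> Q s' -> Q' s') -> run c s T Q'.
Proof.
move=> /run_frame h hQ; apply: run_weaken h _ _ => // s' [hq hf].
exact: hQ.
Qed.

Lemma run_seq c1 c2 s T1 T2 Q :
  run c1 s T1 (fun s' => run c2 s' T2 Q) -> run (Seq c1 c2) s (T1 + T2).+1 Q.
Proof.
move=> [t1 [s1 [h1 le1 [t2 [s2 [h2 le2 hQ]]]]]].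
exists (t1 + t2).+1, s2; split=> //; first exact: ExecSeq h1 h2.
by rewrite ltnS leq_add.
Qed.

Lemma run_if b c1 c2 s T Q :
  (beval s b -> run c1 s T Q) -> (~~ beval s b -> run c2 s T Q) ->
  run (If b c1 c2) s (bcost b + T).+1 Q.
Proof.
move=> h1 h2; case: (boolP (beval s b)) => hb.
  have [t [s' [h le hQ]]] := h1 hb; exists (bcost b + t).+1, s'.
  by split=> //; [exact: ExecIfT | rewrite ltnS leq_add2l].
have [t [s' [h le hQ]]] := h2 hb; exists (bcost b + t).+1, s'.
by split=> //; [exact: ExecIfF | rewrite ltnS leq_add2l].
Qed.

Fixpoint loopfree c : bool :=
  match c with
  | Skip | IStore _ _ _ | RStore _ _ _ => true
  | Seq c1 c2 | If _ c1 c2 => loopfree c1 && loopfree c2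
  | While _ _ => false
  end.

Fixpoint step c s : state R :=
  match c with
  | Skip | While _ _ => s
  | IStore a e v => State (upd (imem s) a (ieval s e) (ieval s v)) (rmem s)
  | RStore a e v => State (imem s) (upd (rmem s) a (ieval s e) (reval s v))
  | Seq c1 c2 => step c2 (step c1 s)
  | If b c1 c2 => if beval s b then step c1 s else step c2 s
  end.

Fixpoint cost c : nat :=
  match c with
  | Skip | While _ _ => 1
  | IStore _ e v => (icost e + icost v).+1
  | RStore _ e v => (icost e + rcost v).+1
  | Seq c1 c2 => (cost c1 + cost c2).+1
  | If b c1 c2 => (bcost b + maxn (cost c1) (cost c2)).+1
  end.

(** Loop-free code is run by evaluation: the goal becomes a statement about [step c s], which [/=]
    unfolds into explicit memory updates. A branch is charged its dearer side. *)
Lemma run_step c s (Q : state R -> Prop) :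
  loopfree c -> Q (step c s) -> run c s (cost c) Q.
Proof.
elim: c s Q => [|a e v|a e v|c1 ih1 c2 ih2|b c1 ih1 c2 ih2|//] s Q /=.
- by move=> _ hQ; exists 1, s; split=> //; exact: ExecSkip.
- by move=> _ hQ; eexists _, _; split; [exact: ExecIStore| |].
- by move=> _ hQ; eexists _, _; split; [exact: ExecRStore| |].
- by move=> /andP[l1 l2] hQ; apply/run_seq/ih1 => //; exact: ih2.
- move=> /andP[l1 l2] hQ; apply: run_if => hb.
    rewrite hb in hQ; apply: run_weaken (ih1 _ _ l1 hQ) _ _ => //.
    exact: leq_maxl.
  rewrite (negbTE hb) in hQ; apply: run_weaken (ih2 _ _ l2 hQ) _ _ => //.
  exact: leq_maxr.
Qed.

(* The ghost value g carries whatever the amortised cost V depends on. *)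
Lemma run_while (G : Type) (I : G -> state R -> Prop) (V : G -> nat) b c g0 s0 :
  I g0 s0 ->
  (forall g s, I g s -> beval s b -> exists T,
     run c s T (fun s' =>
       exists g', I g' s' /\ (bcost b + T).+1 + V g' <= V g)) ->
  run (While b c) s0 (V g0 + (bcost b).+1)
    (fun s => ~~ beval s b /\ exists g, I g s).
Proof.
move=> hI hstep; have [N leN] := ubnP (V g0).
elim: N g0 s0 hI leN => // N ih g0 s0 hI leN.
case: (boolP (beval s0 b)) => hb; last first.
  exists (bcost b).+1, s0; split; [exact: ExecWhileF|exact: leq_addl|].
  by split=> //; exists g0.
have [T [t [s1 [h1 le1 [g1 [hI1 hV]]]]]] := hstep _ _ hI hb.
have [|t' [s2 [h2 le2 hQ]]] := ih g1 s1 hI1; first by lia.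
exists (bcost b + t + t').+1, s2; split=> //; first exact: ExecWhileT h1 h2.
by lia.
Qed.

Definition ivar (x : nat) : iexp := ILoad x (INum 0).
Definition iset (x : nat) (e : iexp) : cmd := IStore x (INum 0) e.

Definition For (x : nat) (e : iexp) (c : cmd) : cmd :=
  Seq (iset x (INum 0))
    (While (BNot (BILe e (ivar x)))
       (Seq c (iset x (IAdd (ivar x) (INum 1))))).

Definition setx s x i : state R := State (upd (imem s) x 0 i) (rmem s).

(** Besides the body and the evaluation of [e], a turn costs 12 units for the rest of the guard, the
    increment and the sequencing. *)
Definition forcost (e : iexp) (N T : nat) : nat :=
  N * (T + icost e + 12) + icost e + 10.

(** The bound [e] is evaluated again before every turn, so it must keep the value [N] in every state
    the loop can reach; the frame describes those states. [I i] speaks of states whose counter is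
    already [i], hence the [setx]. *)
Lemma run_for (I : nat -> state R -> Prop) x e c N T s0 :
  (forall s, frame (For x e c) s0 s -> ieval s e = N) ->
  x \notin imods c ->
  I 0 (setx s0 x 0) ->
  (forall i s, i < N -> frame (For x e c) s0 s -> imem s x 0 = i -> I i s ->
     run c s T (fun s' => I i.+1 (setx s' x i.+1))) ->
  run (For x e c) s0 (forcost e N T) (I N).
Proof.
move=> he hx hI0 hstep.
pose J (i : nat) s :=
  [/\ i <= N, frame (For x e c) s0 s, imem s x 0 = i & I i s].
pose V i := (N - i) * (T + icost e + 12).
have fr0 : frame (For x e c) s0 (setx s0 x 0).
  by split=> //= a; rewrite inE negb_or => /andP[? _]; apply: upd_other.
apply: (@run_weaken _ _ ((cost (iset x (INum 0)) +
   (V 0 + (bcost (BNot (BILe e (ivar x)))).+1)).+1) _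
   (fun s => ~~ beval s (BNot (BILe e (ivar x))) /\ exists i, J i s)).
- apply: run_seq; apply: run_step => //=.
  apply: (@run_while nat J V).
    by split=> //=; rewrite /upd !eqxx.
  move=> i s [leN fr hi hI] /=; rewrite (he s fr) hi -ltnNge => ltN.
  exists (T + 6).+1; apply: run_seq.
  apply: run_post (hstep i s ltN fr hi hI) _ => s1 fr1 hI1.
  have hx1 : imem s1 x 0 = i by rewrite fr1.1 // hi.
  apply: (@run_weaken _ _ (cost (iset x (IAdd (ivar x) (INum 1))))).
  + apply: (@run_step _ _ (fun s' => J i.+1 s')) => //=; rewrite hx1 addn1.
    split=> //=; last by rewrite /upd !eqxx.
    apply: (@frame_trans _ _ s) => //; split=> a /=.
      rewrite inE mem_cat mem_seq1 => /norP [ax /norP[hc _]].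
      by rewrite upd_other // fr1.1.
    by rewrite cats0 => ?; rewrite fr1.2.
  + by [].
  + by move=> s' hJ; exists i.+1; split=> //; rewrite /V /=; nia.
- by rewrite /V /forcost /=; nia.
- move=> s [/=]; rewrite negbK => hb [i [leN fr hi hI]].
  rewrite (he s fr) hi in hb.
  by have <- : i = N by apply/eqP; rewrite eqn_leq leN hb.
Qed.

End Programs.

(** * Real inequalities *)

Section RealInequalities.
Context {R : realType}.
Implicit Types (x y z rho m B C : R).

Lemma ln_le_sub1 x : 0 < x -> ln x <= x - 1.
Proof.
move=> x0; have -> : ln x = ln (1 + (x - 1)) by congr ln; ring.
by apply: le_ln1Dx; lra.
Qed.

Lemma sub1V_le_ln x : 0 < x -> 1 - x^-1 <= ln x.
Proof.
move=> x0; have := @ln_le_sub1 x^-1; rewrite lnV ?posrE // invr_gt0.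
by move=> /(_ x0); lra.
Qed.

Lemma half_le_ln2 : 2^-1 <= ln 2 :> R.
Proof. by have := @sub1V_le_ln 2 ltac:(lra); lra. Qed.

Lemma ln2_le1 : ln 2 <= 1 :> R.
Proof. by have := @ln_le_sub1 2 ltac:(lra); lra. Qed.

Lemma powR_split x rho : 0 <= x -> 0 < rho < 1 -> x `^ (1 - rho) * x `^ rho = x.
Proof.
move=> x0 /andP[r0 r1]; rewrite -powRD; last by apply/implyP => /eqP; rewrite subrK; lra.
by rewrite subrK powRr1.
Qed.

Lemma le_powRM x m rho : 0 < rho < 1 -> 0 <= x <= m ->
  x <= x `^ (1 - rho) * m `^ rho.
Proof.
move=> hr /andP[x0 xm]; rewrite -{1}(powR_split x0 hr).
apply: ler_wpM2l; first exact: powR_ge0.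
by apply: ge0_ler_powR => //; rewrite ?nnegrE //; lra.
Qed.

(** Multiplied by [m ^ rho], the left side is [m]; on the right the first term is at least [m - C]
    by [le_powRM] and the second at least [C] by hypothesis. *)
Lemma powR_cut rho m B C : 0 < rho < 1 -> 0 < m -> 0 <= C <= m ->
  C <= B `^ (1 - rho) * m `^ rho ->
  m `^ (1 - rho) <= (m - C) `^ (1 - rho) + B `^ (1 - rho).
Proof.
move=> hr m0 hC hB.
have p0 : 0 < m `^ rho by exact: powR_gt0.
rewrite -(ler_pM2r p0) powR_split ?(ltW m0) //.
rewrite mulrDl.
have := @le_powRM (m - C) m rho hr ltac:(lra).
by lra.
Qed.

(** Removing a box of [a] points lowers the potential by at most [a]: after multiplication by
    [(a + b) ^ rho >= 1] the two terms on the right dominate [a] and [b]. *)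
Lemma powR_box rho (a b : nat) : 0 < rho < 1 ->
  (a + b)%:R `^ (1 - rho) <= a%:R + b%:R `^ (1 - rho) :> R.
Proof.
move=> hr; case: (posnP (a + b)) => [|ab0].
  by move=> /eqP; rewrite addn_eq0 => /andP[/eqP -> /eqP ->]; rewrite add0r.
have p0 : 0 < (a + b)%:R `^ rho :> R by apply: powR_gt0; rewrite ltr0n.
rewrite -(ler_pM2r p0) powR_split ?ler0n // mulrDl.
have h1 : 1 <= (a + b)%:R `^ rho :> R.
  have := @ler_powR R (a + b)%:R _ 0 rho; rewrite powRr0; apply; last by lra.
  by rewrite ler1n.
have h2 := @le_powRM b%:R (a + b)%:R rho hr.
have h3 : (b%:R : R) <= b%:R `^ (1 - rho) * (a + b)%:R `^ rho.
  by apply: h2; rewrite ler0n ler_nat leq_addl.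
have h4 : (a%:R : R) <= a%:R * (a + b)%:R `^ rho by rewrite ler_peMr.
by rewrite natrD in h1 h3 h4 *; lra.
Qed.

(** Bernoulli's inequality for real exponents. With [z = 1 + rho * (x - 1)], add [ln t <= t - 1] at
    [t = x / z] and at [t = 1 / z] with weights [rho] and [1 - rho]: the weighted mean of the two
    arguments is 1. *)
Lemma powR_bernoulli rho x : 0 < rho < 1 -> 0 <= x ->
  x `^ rho <= 1 + rho * (x - 1).
Proof.
move=> hr; rewrite le_eqVlt => /orP[/eqP <-|x0].
  by rewrite powR0; [lra|rewrite gt_eqF//; lra].
have z0 : 0 < 1 + rho * (x - 1) by nra.
set z := 1 + _ in z0 *.
rewrite -ler_ln ?posrE ?powR_gt0 // ln_powR.
have h1 := @ln_le_sub1 (x / z) (divr_gt0 x0 z0).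
have h2 := @ln_le_sub1 z^-1.
rewrite invr_gt0 lnV ?posrE // in h2.
rewrite ln_div ?posrE // in h1.
have {}h2 := h2 z0.
have e : rho * (x / z) + (1 - rho) * z^-1 = 1.
  by rewrite -/z /z; field; rewrite gt_eqF.
by nra.
Qed.

(** One round with [U] uncovered points, [c] of which it covers. For [x = (U - c) / U], Bernoulli
    gives [x ^ rho <= 1 - rho * (1 - x)], and [U ^ rho * (1 - x) >= 1] because [c = U * (1 - x)] is
    at least [U ^ (1 - rho)]. *)
Lemma powR_round rho (U c : nat) : 0 < rho < 1 -> (0 < U)%N -> (c <= U)%N ->
  U%:R `^ (1 - rho) <= c%:R :> R ->
  (U - c)%:R `^ rho / rho + 1 <= U%:R `^ rho / rho :> R.
Proof.
move=> hr U0 cU hc.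
have u0 : 0 < U%:R :> R by rewrite ltr0n.
have p0 : 0 < U%:R `^ rho :> R by exact: powR_gt0.
have q0 : 0 < U%:R `^ (1 - rho) :> R by exact: powR_gt0.
have r0 : 0 < rho by lra.
suff h : (U - c)%:R `^ rho + rho <= U%:R `^ rho :> R.
  by rewrite -(ler_pM2r r0) mulrDl !divfK ?gt_eqF // mul1r.
pose x : R := (U - c)%:R / U%:R.
have x0 : 0 <= x by rewrite divr_ge0 ?ler0n.
have e : (U - c)%:R = U%:R * x :> R by rewrite /x mulrC divfK // gt_eqF.
rewrite e powRM ?ler0n //.
have h1 := powR_bernoulli hr x0.
have h2 : c%:R = U%:R * (1 - x) :> R.
  by rewrite mulrBr -e mulr1 natrB //; ring.
have h3 : 1 <= U%:R `^ rho * (1 - x).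
  rewrite -(ler_pM2l q0) mulr1 mulrA powR_split ?ler0n //.
  by rewrite -h2.
by nra.
Qed.

End RealInequalities.

(** * The separator test *)

Section SeparatorTest.
Context {R : realType}.
Variable rho : R.
Hypothesis hrho : 0 < rho < 1.

Let rho_gt0 : 0 < rho. Proof. by case/andP: hrho. Qed.
Let rho_lt1 : rho < 1. Proof. by case/andP: hrho. Qed.

Definition growth : R := 1 + rho / 2.

Definition gpow (k : nat) : R := growth ^+ trunc_log 2 k.

(** A division-free test of [C <= B * growth ^ L], for [L = 1] or for
    [L = trunc_log 2 m - trunc_log 2 B - 1]. Both exponents satisfy [2 ^ L <= m / B], the first
    because the test matters only when [2 * C <= m]. *)
Definition good_ratio (B C m : nat) : bool :=
  (C%:R <= B%:R * growth) || (C%:R * gpow B * growth <= B%:R * gpow m).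

Lemma growth_gt1 : 1 < growth. Proof. by have := rho_gt0; rewrite /growth; lra. Qed.

Lemma growth_gt0 : 0 < growth. Proof. by have := growth_gt1; lra. Qed.

(** The half in [growth] reflects [ln 2 >= 1/2]: [1 + rho / 2 <= exp (rho / 2) <= exp (rho * ln
    2)]. *)
Lemma growth_le : growth <= 2 `^ rho.
Proof.
apply: le_trans (expR_ge1Dx (rho / 2)) _.
rewrite /powR gt_eqF // ler_expR.
by rewrite ler_pM2l ?half_le_ln2.
Qed.

Lemma growthX_le L (x : R) : 2 ^+ L <= x -> growth ^+ L <= x `^ rho.
Proof.
move=> hx; apply: le_trans (_ : (2 `^ rho) ^+ L <= _).
  by apply: lerXn2r; rewrite ?nnegrE ?powR_ge0 ?growth_le // ltW ?growth_gt0.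
rewrite -powR_mulrn ?powR_ge0 // powRAC powR_mulrn //.
have x0 : 0 <= x by apply: le_trans hx; rewrite exprn_ge0.
by apply: ge0_ler_powR; rewrite ?nnegrE ?exprn_ge0 // ltW.
Qed.

Lemma trunc_log2_le (k : nat) : (0 < k)%N -> 2 ^+ trunc_log 2 k <= k%:R :> R.
Proof. by move=> k0; rewrite -natrX ler_nat trunc_logP. Qed.

Lemma trunc_log2_gt (k : nat) : k%:R < 2 ^+ (trunc_log 2 k).+1 :> R.
Proof. by rewrite -natrX ltr_nat trunc_log_ltn. Qed.

Lemma good_ratio_le B C m : (0 < B <= C)%N -> (C.*2 <= m)%N ->
  good_ratio B C m -> C%:R <= B%:R `^ (1 - rho) * m%:R `^ rho :> R.
Proof.
move=> /andP[B0 BC] Cm hg.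
have B0R : 0 < B%:R :> R by rewrite ltr0n.
pose x : R := m%:R / B%:R.
have em : m%:R = B%:R * x :> R by rewrite /x mulrC divfK // gt_eqF.
have x2 : 2 <= x.
  rewrite /x ler_pdivlMr // -natrM ler_nat; lia.
rewrite em powRM ?ler0n //; last by apply: le_trans x2.
rewrite mulrA powR_split ?ler0n //.
suff [L [hL hC]] : exists L, 2 ^+ L <= x /\ C%:R <= B%:R * growth ^+ L.
  by apply: le_trans hC _; rewrite ler_pM2l // growthX_le.
case/orP: hg => hg; first by exists 1%N; rewrite !expr1.
have lem : (trunc_log 2 B <= trunc_log 2 m)%N.
  by apply: leq_trunc_log; lia.
have g0 := growth_gt0; have g1 := growth_gt1.
have gB : 0 < gpow B by rewrite exprn_gt0.
have CB : B%:R <= C%:R :> R by rewrite ler_nat.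
(* With equal logarithms the second alternative would read [C * growth <= B], against [B <= C]. *)
case: (ltngtP (trunc_log 2 B) (trunc_log 2 m)) lem => // [lt|e] _; last first.
  rewrite /gpow e in hg gB; have : C%:R * growth <= B%:R.
    by rewrite -(ler_pM2r gB) mulrAC.
  by nra.
pose L := (trunc_log 2 m - trunc_log 2 B).-1.
have eL : trunc_log 2 m = (L + trunc_log 2 B).+1 by rewrite /L; lia.
exists L; split.
  rewrite /x ler_pdivlMr //.
  apply: le_trans (_ : 2 ^+ L * 2 ^+ (trunc_log 2 B).+1 <= _).
    by rewrite ler_pM2l ?exprn_gt0 // ltW // trunc_log2_gt.
  rewrite -exprD addnS -eL trunc_log2_le //; lia.
rewrite -(ler_pM2r g0) -(ler_pM2r gB).
have -> : B%:R * growth ^+ L * growth * gpow B = B%:R * gpow m.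
  by rewrite /gpow eL exprS exprD; ring.
by rewrite mulrAC.
Qed.

(** For [u = growth], [ln u >= 1 - 1 / u = rho / (2 * u)], and [u <= 3/2]. *)
Lemma ln_growth_ge : rho / 3 <= ln growth.
Proof.
have h := sub1V_le_ln growth_gt0; apply: le_trans h.
rewrite -(ler_pM2r growth_gt0) mulrBl mul1r mulVf ?gt_eqF ?growth_gt0 //.
by have := rho_gt0; have := rho_lt1; rewrite /growth; nra.
Qed.

(* With lambda = ln (m/B) / ln 2, the exponent L of the growth factor in the
   failed test is at least lambda / 3. *)
Lemma good_ratio_fail B C m : (0 < B <= C)%N -> (B <= m)%N ->
  ~~ good_ratio B C m ->
  ln (m%:R / C%:R) <= (1 - rho / 10) * ln (m%:R / B%:R) :> R.
Proof.
move=> /andP[B0 BC] Bm; rewrite /good_ratio negb_or -!ltNge => /andP[h1 h2].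
have B0R : 0 < B%:R :> R by rewrite ltr0n.
have C0R : 0 < C%:R :> R by rewrite ltr0n; lia.
have m0R : 0 < m%:R :> R by rewrite ltr0n; lia.
have g0 := growth_gt0.
have gB : 0 < gpow B by rewrite exprn_gt0.
have gm : 0 < gpow m by rewrite exprn_gt0.
rewrite !ln_div ?posrE //.
set lm := ln m%:R; set lB := ln B%:R; set lC := ln C%:R.
have lg0 := ln_growth_ge; set gam := ln growth in lg0.
pose a := trunc_log 2 m; pose b := trunc_log 2 B.
have hm : lm <= (a%:R + 1) * ln 2.
  rewrite natr1 mulrC mulr_natr -lnXn //.
  by rewrite ler_ln ?posrE ?exprn_gt0 // ltW // trunc_log2_gt.
have hB : b%:R * ln 2 <= lB.
  rewrite mulrC mulr_natr -lnXn //.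
  by rewrite ler_ln ?posrE ?exprn_gt0 // trunc_log2_le.
have e1 : lB + gam <= lC.
  rewrite -lnM ?posrE // ler_ln ?posrE ?mulr_gt0 // ltW //.
have e2 : lB + a%:R * gam <= lC + b%:R * gam + gam.
  have ga : ln (gpow m) = a%:R * gam by rewrite /gpow lnXn // mulr_natl.
  have gb : ln (gpow B) = b%:R * gam by rewrite /gpow lnXn // mulr_natl.
  rewrite -ga -gb -!lnM ?posrE ?mulr_gt0 //.
  by rewrite ler_ln ?posrE ?mulr_gt0 // ltW.
have l2 := @ln2_le1 R; have l2' := @half_le_ln2 R.
have h3 : lm - lB <= (a%:R - b%:R + 1) * ln 2 by lra.
have hlm : 0 <= lm - lB.
  by rewrite subr_ge0 /lm /lB ler_ln ?posrE // ler_nat.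
suff : (lm - lB) * (rho / 10) <= lC - lB by lra.
clearbody lm lB lC gam a b.
have r0 := rho_gt0.
(* If [a <= b + 1], then [lm - lB <= 2], and the first failed alternative gives
   [lC - lB >= rho / 3]. Otherwise the second gives [lC - lB >= (a - b - 1) * rho / 3], while
   [lm - lB <= a - b + 1 <= 3 * (a - b - 1)]. Both leave room for the factor [rho / 10]. *)
case: (leqP a b.+1) => hab.
  have habR : a%:R <= b%:R + 1 :> R by rewrite natr1 ler_nat.
  have p1 : 0 <= (1 + b%:R - a%:R) * ln 2 :> R by apply: mulr_ge0; lra.
  have p2 : 0 <= (2 - (lm - lB)) * rho by apply: mulr_ge0; lra.
  by lra.
have habR : b%:R + 2 <= a%:R :> R by rewrite -natrD ler_nat addn2.
have p1 : 0 <= (a%:R - b%:R + 1) * (1 - ln 2) :> R by apply: mulr_ge0; lra.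
have p2 : 0 <= (3 * (a%:R - b%:R - 1) - (lm - lB)) * rho.
  by apply: mulr_ge0; lra.
have p3 : 0 <= (a%:R - b%:R - 1) * (gam - rho / 3) by apply: mulr_ge0; lra.
have p4 : 0 <= (a%:R - b%:R - 1) * rho by apply: mulr_ge0; lra.
by lra.
Qed.

End SeparatorTest.

(** * Scanning one direction *)

Section Walk.
Context {R : realType}.
Variables (rho : R) (d a b : nat).
Hypothesis rho_gt0 : 0 < rho.
Hypothesis rho_lt1 : rho < 1.
Hypothesis d_gt0 : (0 < d)%N.
Hypothesis le_4d : (4 * d <= 2 ^ a)%N.
Hypothesis le_a : (a <= 2 ^ b)%N.

Let d4_gt0 : 0 < (4 * d)%:R :> R. Proof. by rewrite ltr0n muln_gt0. Qed.

(** State of a walk after [j] failed tests. Once a test has failed, the last clause keeps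
    [ln (m / B) >= ln 2]; against the geometric decay in the second clause this bounds [j]. *)
Definition walk_bound (j B m : nat) : Prop :=
  [/\ (0 < B <= m)%N,
      ln (m%:R / B%:R) <= (1 - rho / 10) ^+ j * ln (4 * d)%:R &
      (0 < j)%N -> (B.*2 <= m)%N].

Lemma walk_bound0 B m : (0 < B <= m)%N -> (m <= 4 * d * B)%N ->
  walk_bound 0 B m.
Proof.
move=> Bm hm; split=> //; rewrite expr0 mul1r.
have B0 : 0 < B%:R :> R by rewrite ltr0n; case/andP: Bm.
have m0 : 0 < m%:R :> R by rewrite ltr0n; case/andP: Bm; exact: leq_trans.
rewrite ler_ln ?posrE ?divr_gt0 //.
by rewrite ler_pdivrMr // -natrM ler_nat.
Qed.

Lemma walk_boundS j B C m : walk_bound j B m -> (B <= C)%N ->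
  (C.*2 <= m)%N -> ~~ good_ratio rho B C m -> walk_bound j.+1 C m.
Proof.
move=> [/andP[B0 Bm] hl _] BC Cm hg; split=> //.
  apply/andP; split; first exact: leq_trans BC.
  by apply: leq_trans Cm; rewrite -addnn leq_addr.
have hrho : 0 < rho < 1 by apply/andP.
apply: le_trans (good_ratio_fail hrho _ Bm hg) _; first by rewrite B0.
rewrite exprS -mulrA ler_pM2l //.
by have := rho_lt1; lra.
Qed.

(** From [ln 2 <= ln (m / B) <= exp (- j * rho / 10) * a * ln 2] follows
    [exp (j * rho / 10) <= a <= 2 ^ b], and [ln 2 <= 1]. *)
Lemma walk_bound_steps j B m : walk_bound j B m -> j%:R * rho <= 10 * b%:R.
Proof.
move=> [/andP[B0 Bm] hl]; case: (posnP j) => [-> _|j0 /(_ isT) hB].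
  by rewrite mul0r mulr_ge0.
have B0R : 0 < B%:R :> R by rewrite ltr0n.
have m0R : 0 < m%:R :> R by rewrite ltr0n; exact: leq_trans Bm.
have h1 : ln 2 <= ln (m%:R / B%:R) :> R.
  rewrite ler_ln ?posrE ?divr_gt0 // ler_pdivlMr // -natrM ler_nat; lia.
have h2 : ln (4 * d)%:R <= a%:R * ln 2 :> R.
  rewrite mulr_natl -lnXn // ler_ln ?posrE ?exprn_gt0 //.
  by rewrite -natrX ler_nat.
have h3 : (1 - rho / 10) ^+ j <= expR (- (j%:R * rho / 10)).
  have -> : - (j%:R * rho / 10) = (- (rho / 10)) * j%:R by ring.
  rewrite expRM_natr; apply: lerXn2r; rewrite ?nnegrE ?expR_ge0 //.
    by have := rho_lt1; lra.
  exact: expR_ge1Dx.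
have l2 : 0 < ln 2 :> R by have := @half_le_ln2 R; lra.
have h4 : ln 2 <= expR (- (j%:R * rho / 10)) * (a%:R * ln 2).
  apply: le_trans h1 (le_trans hl _).
  apply: le_trans (_ : expR (- (j%:R * rho / 10)) * ln (4 * d)%:R <= _).
    by apply: ler_wpM2r h3; apply: ln_ge0; rewrite ler1n -(ltr0n R).
  by rewrite ler_pM2l ?expR_gt0.
have h5 : expR (j%:R * rho / 10) <= a%:R.
  rewrite -(ler_pM2r l2) -(ler_pM2l (expR_gt0 (- (j%:R * rho / 10)))) mulrA.
  by rewrite -expRD addNr expR0 mul1r.
have h6 : j%:R * rho / 10 <= b%:R * ln 2.
  rewrite -ler_expR [X in _ <= expR X]mulrC expRM_natr lnK ?posrE //.
  by apply: le_trans h5 _; rewrite -natrX ler_nat.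
have := @ln2_le1 R; have : 0 <= b%:R :> R by [].
by nra.
Qed.

End Walk.

Section Scan.
Context {R : realType}.
Variables (rho w : R) (n d a b : nat) (y : nat -> nat -> R) (cell : nat -> nat).
Hypothesis rho_gt0 : 0 < rho.
Hypothesis rho_lt1 : rho < 1.
Hypothesis w_gt0 : 0 < w.
Hypothesis d_gt0 : (0 < d)%N.
Hypothesis le_4d : (4 * d <= 2 ^ a)%N.
Hypothesis le_a : (a <= 2 ^ b)%N.
Local Open Scope nat_scope.

Definition cn (P : pred nat) : nat := count P (iota 0 n).

Definition csize (q : nat) : nat := cn (fun p => cell p == q).

Definition above (q e : nat) (t : R) : nat :=
  cn (fun p => (cell p == q) && (t < y e p)%R).

Definition atleast (q e : nat) (t : R) : nat :=
  cn (fun p => (cell p == q) && (t <= y e p)%R).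

(** The second and third clauses make every part of the cut cell smaller; the last one protects the
    potential. *)
Definition good_cut (q e : nat) (t : R) : Prop :=
  [/\ e < 2 * d, csize q <= 4 * d * atleast q e t,
      (above q e (t - w)).*2 <= csize q, 0 < atleast q e t &
      ((above q e (t - w)%R)%:R <=
        (atleast q e t)%:R `^ (1 - rho) * (csize q)%:R `^ rho)%R].

(** Since [h] is attained in the cell, a gap between the cell and an outside point becomes a gap
    between the side of the box and that point; see [box_loc]. *)
Definition quantile (q e : nat) (h : R) : Prop :=
  (exists p, [/\ p < n, cell p = q & y e p = h]) /\
  4 * d * above q e h < csize q.

Definition box_side (q e : nat) (h : R) : Prop :=
  quantile q e h /\
  exists j : nat, (j%:R * rho <= 10 * b%:R)%R /\
    csize q < (above q e (h - j.+1%:R * w)%R).*2.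

Variables (e : nat) (ord : seq nat).
Hypothesis e_lt : e < 2 * d.
Hypothesis ord_perm : perm_eq ord (iota 0 n).
Hypothesis ord_sorted : sorted (fun p p' => y e p' <= y e p)%R ord.

(** What is known of cell [q] after [r] points of the order. Phase 0 waits for the quantile, phase 1
    walks down from it, and in any other phase the direction is settled for this cell. In phase 1
    all scanned points of the cell lie above [THR - w], so [K] is the count C as soon as the scan
    meets a value at or below [THR - w]. [B] is only a lower bound for the count at or above [THR],
    since more points with value [THR] may follow. *)
Definition scan_inv (r q K PH B CF CD : nat) (THR CT : R) (Hq : nat -> R) :
    Prop :=
  let m := csize q in
  [/\ K = count (fun p => cell p == q) (take r ord),
      CF != 0 -> good_cut q CD CT,
      CF = 0 -> forall e', e' < e -> box_side q e' (Hq e')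
    & match PH with
      | 0 => 4 * d * K < m
      | 1 => quantile q e (Hq e) /\ exists j,
          [/\ THR = (Hq e - j%:R * w)%R, walk_bound rho d j B m,
              m <= 4 * d * B,
              B <= count (fun p => (cell p == q) && (THR <= y e p)%R)
                         (take r ord) &
              forall p, p \in take r ord -> cell p = q -> (THR - w < y e p)%R]
      | _ => CF != 0 \/ box_side q e (Hq e)
      end].

Lemma cn_ord P : cn P = count P ord.
Proof. by have /permP -> := ord_perm. Qed.

Lemma cn_split P r : cn P = count P (take r ord) + count P (drop r ord).
Proof. by rewrite cn_ord -count_cat cat_take_drop. Qed.

Lemma size_ord : size ord = n.
Proof. by rewrite (perm_size ord_perm) size_iota. Qed.

Lemma ord_before_after p p' r :
  p \in take r ord -> p' \in drop r ord -> (y e p' <= y e p)%R.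
Proof.
have tr : transitive (fun p p' => y e p' <= y e p)%R.
  by move=> p1 p2 p3 h1 h2; apply: le_trans h2 h1.
have := ord_sorted; rewrite (sorted_pairwise tr) -{1}(cat_take_drop r ord).
rewrite pairwise_cat => /and3P[/allrelP h _ _]; exact: h.
Qed.

Lemma ord_after p' r : r < n -> p' \in drop r ord ->
  (y e p' <= y e (nth 0 ord r))%R.
Proof.
move=> rn; rewrite (drop_nth 0) ?size_ord // inE => /orP[/eqP -> //|hp'].
apply: (@ord_before_after _ _ r.+1) => //.
by rewrite (take_nth 0) ?size_ord // mem_rcons inE eqxx.
Qed.

Section AtPoint.
Variables (r q : nat).
Hypothesis r_lt : r < n.
Let p0 := nth 0 ord r.
Let v := y e p0.

Lemma take_rS : take r.+1 ord = rcons (take r ord) p0.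
Proof. by rewrite (take_nth 0) ?size_ord. Qed.

(** The order is decreasing, so once the current value is at or below [t] no unscanned point exceeds
    [t]. *)
Lemma above_scanned (t : R) :
  (v <= t)%R ->
  (forall p, p \in take r ord -> cell p = q -> (t < y e p)%R) ->
  above q e t = count (fun p => cell p == q) (take r ord).
Proof.
move=> vt hp; rewrite /above (cn_split _ r).
rewrite [X in _ + X](_ : _ = 0) ?addn0; last first.
  apply/eqP; rewrite eqn0Ngt -has_count; apply/hasPn => p hp'.
  rewrite negb_and -leNgt orbC.
  by rewrite (le_trans (ord_after r_lt hp') vt).
apply: eq_in_count => p hp'; case: eqP => //= e'.
by rewrite hp.
Qed.

(** The scanned points all lie above [THR - w], so their number [K] can serve as [B] one step
    lower. *)
Lemma scan_fail K B CF CD THR CT Hq :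
  scan_inv r q K 1 B CF CD THR CT Hq ->
  K.*2 <= csize q -> ~~ good_ratio rho B K (csize q) ->
  scan_inv r q K 1 K CF CD (THR - w)%R CT Hq.
Proof.
move=> [hK h1 h2 [hq [j [eT hw hB hc hp]]]] hK2 hg.
have BK : B <= K.
  rewrite hK; apply: leq_trans hc _; apply: sub_count => p /=.
  by case/andP.
split=> //; split=> //; exists j.+1; split.
- by rewrite eT -natr1; ring.
- exact: (walk_boundS rho_gt0 rho_lt1 hw BK hK2 hg).
- by apply: leq_trans hB _; rewrite leq_mul2l BK orbT.
- rewrite {1}hK; apply: eq_leq; apply: eq_in_count => p hp'.
  by case: eqP => //= e'; rewrite ltW // hp.
- move=> p hp' e'; apply: lt_trans (hp p hp' e').
  by rewrite ltrBlDr ltrDl.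
Qed.

(** [B] may undercount the points at or above [THR]; the inequalities of [good_cut] only gain when
    the true count replaces it. *)
Lemma scan_cut K B CF CD THR CT Hq :
  scan_inv r q K 1 B CF CD THR CT Hq ->
  K.*2 <= csize q -> good_ratio rho B K (csize q) -> (v <= THR - w)%R ->
  scan_inv r q K 2 B 1 e THR THR Hq.
Proof.
move=> [hK h1 h2 [hq [j [eT hw hB hc hp]]]] hK2 hg hv.
split=> //; last by left.
move=> _.
have BK : B <= K.
  rewrite hK; apply: leq_trans hc _; apply: sub_count => p /=.
  by case/andP.
have eC : above q e (THR - w) = K by rewrite (above_scanned hv hp).
have Bal : B <= atleast q e THR.
  by apply: leq_trans hc _; rewrite /atleast (cn_split _ r) leq_addr.
have [/andP[B0 Bm] _ _] := hw.
have hrho : (0 < rho < 1)%R by apply/andP.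
split=> //.
- by apply: leq_trans hB _; rewrite leq_mul2l Bal orbT.
- by rewrite eC.
- exact: leq_trans Bal.
- rewrite eC; apply: le_trans (good_ratio_le hrho _ hK2 hg) _.
    by rewrite B0.
  apply: ler_wpM2r; first exact: powR_ge0.
  apply: ge0_ler_powR; rewrite ?nnegrE ?ler0n ?ler_nat //.
  by rewrite subr_ge0 ltW.
Qed.

Lemma scan_stop K B CF CD THR CT Hq :
  scan_inv r q K 1 B CF CD THR CT Hq ->
  csize q < K.*2 -> (v <= THR - w)%R ->
  scan_inv r q K 2 B CF CD THR CT Hq.
Proof.
move=> [hK h1 h2 [hq [j [eT hw hB hc hp]]]] hK2 hv.
split=> //; right; split=> //; exists j; split.
  exact: (walk_bound_steps rho_gt0 rho_lt1 d_gt0 le_4d le_a hw).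
rewrite (_ : (Hq e - _)%R = (THR - w)%R); last by rewrite eT -natr1; ring.
by rewrite (above_scanned hv hp) -hK.
Qed.

Lemma scan_next K PH B CF CD THR CT Hq :
  cell p0 = q -> scan_inv r q K PH B CF CD THR CT Hq ->
  (PH = 1 -> (THR - w < v)%R) -> (PH = 0 -> 4 * d * K.+1 < csize q) ->
  scan_inv r.+1 q K.+1 PH B CF CD THR CT Hq.
Proof.
move=> cp [hK h1 h2 h3] hv hK1; split=> //.
  by rewrite take_rS -cats1 count_cat /= cp eqxx -hK addn1.
case: PH h3 hv hK1 => [|[|PH]] // h3; first by move=> _; apply.
move=> /(_ erefl) hv _; have [hq [j [eT hw hB hc hp]]] := h3.
split=> //; exists j; split=> //.
  by rewrite take_rS -cats1 count_cat; apply: leq_trans hc (leq_addr _ _).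
move=> p; rewrite take_rS mem_rcons inE => /orP[/eqP -> //|]; exact: hp.
Qed.

(** The point that brings the cell to [m / (4d)] scanned points supplies the quantile: only earlier
    points can exceed it, and these were fewer than [m / (4d)]. *)
Lemma scan_first K B B' CF CD THR THR' CT Hq Hq' :
  cell p0 = q -> scan_inv r q K 0 B CF CD THR CT Hq ->
  csize q <= 4 * d * K.+1 -> B' = K.+1 -> THR' = v -> Hq' e = v ->
  (forall e', e' < e -> Hq' e' = Hq e') ->
  scan_inv r.+1 q K.+1 1 B' CF CD THR' CT Hq'.
Proof.
move=> cp [hK h1 h2 h3] hK1 -> -> hH hH'; split=> //.
- by rewrite take_rS -cats1 count_cat /= cp eqxx -hK addn1.
- by move=> cf e' le'; rewrite hH' //; apply: h2.
have p0n : p0 < n.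
  have : p0 \in ord by rewrite mem_nth ?size_ord.
  by rewrite (perm_mem ord_perm) mem_iota.
have all_ge p : p \in take r.+1 ord -> (v <= y e p)%R.
  rewrite take_rS mem_rcons inE => /orP[/eqP -> //|hp].
  apply: (@ord_before_after _ _ r) => //.
  by rewrite (drop_nth 0) ?size_ord // inE eqxx.
split.
  rewrite hH; split; first by exists p0.
  apply: leq_ltn_trans h3; rewrite leq_mul2l; apply/orP; right.
  rewrite /above (cn_split _ r) hK -[X in _ <= X]addn0; apply: leq_add.
    by apply: sub_count => p /= /andP[].
  rewrite leqn0 eqn0Ngt -has_count; apply/hasPn => p hp'.
  by rewrite negb_and -leNgt ord_after ?orbT.
exists 0; split=> //.
- by rewrite hH mul0r subr0.
- apply: walk_bound0 => //=.
  rewrite hK -[_.+1](_ : count (fun p => cell p == q) (take r.+1 ord) = _).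
    by rewrite /csize (cn_split _ r.+1) leq_addr.
  by rewrite take_rS -cats1 count_cat /= cp eqxx addn1.
- rewrite hK -[_.+1](_ : count (fun p => cell p == q) (take r.+1 ord) = _).
    apply: eq_leq; apply: eq_in_count => p hp'.
    by rewrite all_ge ?andbT.
  by rewrite take_rS -cats1 count_cat /= cp eqxx addn1.
- move=> p hp' _; apply: lt_le_trans (all_ge p hp').
  by rewrite ltrBlDr ltrDl.
Qed.

Lemma scan_other K PH B CF CD THR CT Hq :
  cell p0 <> q -> scan_inv r q K PH B CF CD THR CT Hq ->
  scan_inv r.+1 q K PH B CF CD THR CT Hq.
Proof.
move=> /eqP cp [hK h1 h2 h3].
have ec P : count (fun p => (cell p == q) && P p) (take r.+1 ord) =
            count (fun p => (cell p == q) && P p) (take r ord).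
  by rewrite take_rS -cats1 count_cat /= (negbTE cp) !addn0.
split=> //.
  by rewrite hK take_rS -cats1 count_cat /= (negbTE cp) !addn0.
case: PH h3 => [|[|PH]] // [hq [j [eT hw hB hc hp]]].
split=> //; exists j; split=> //; first by rewrite ec.
move=> p; rewrite take_rS mem_rcons inE => /orP[/eqP -> ce|]; last exact: hp.
by rewrite ce eqxx in cp.
Qed.

End AtPoint.

Lemma scan_start q CF CD B THR CT Hq : 0 < csize q ->
  (CF != 0 -> good_cut q CD CT) ->
  (CF = 0 -> forall e', e' < e -> box_side q e' (Hq e')) ->
  scan_inv 0 q 0 0 B CF CD THR CT Hq.
Proof. by move=> m0 h1 h2; split=> //; rewrite ?take0 ?muln0. Qed.

(** A walk stopped by the end of the order settles its direction too: all [m] points then lie above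
    [THR - w], hence more than half. Phase 0 is impossible at the end, where [K = m]. *)
Lemma scan_end q K PH B CF CD THR CT Hq : 0 < csize q ->
  scan_inv n q K PH B CF CD THR CT Hq ->
  CF = 0 -> forall e', e' < e.+1 -> box_side q e' (Hq e').
Proof.
move=> m0 [hK h1 h2 h3] cf e'; rewrite ltnS leq_eqVlt => /orP[/eqP ->|]; last first.
  exact: h2.
have en : take n ord = ord by rewrite take_oversize // size_ord.
have eK : K = csize q by rewrite hK en /csize cn_ord.
case: PH h3 => [|[|PH]].
- by rewrite eK; nia.
- move=> [hq [j [eT hw hB hc hp]]]; split=> //; exists j; split.
    exact: (walk_bound_steps rho_gt0 rho_lt1 d_gt0 le_4d le_a hw).
  suff -> : above q e (Hq e - j.+1%:R * w) = csize q by rewrite -addnn; lia.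
  rewrite /above /csize !cn_ord; apply: eq_in_count => p hp'.
  case: eqP => //= e''; apply: le_lt_trans (hp p _ e''); last by rewrite en.
  by rewrite eT -natr1 mulrDl mul1r opprD addrA.
- by rewrite cf => -[].
Qed.

Lemma scan_inv_quant r q K PH B CF CD THR CT Hq Hq' :
  (forall e', e' <= e -> Hq' e' = Hq e') ->
  scan_inv r q K PH B CF CD THR CT Hq -> scan_inv r q K PH B CF CD THR CT Hq'.
Proof.
move=> eH [h1 h2 h3 h4]; split=> //.
  by move=> cf e' le'; rewrite eH; [exact: h3|exact: ltnW].
by case: PH h4 => [|[|PH]] //; rewrite eH.
Qed.

End Scan.

(** * One level of the refinement *)

Section Counting.
Variable n : nat.
Implicit Types P Q : pred nat.
Local Open Scope nat_scope.

Lemma cn_eq P Q : (forall p, p < n -> P p = Q p) -> cn n P = cn n Q.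
Proof.
by move=> h; apply: eq_in_count => p; rewrite mem_iota => /andP[_]; apply: h.
Qed.

Lemma cn_le P Q : (forall p, p < n -> P p -> Q p) -> cn n P <= cn n Q.
Proof.
move=> h; rewrite /cn -!size_filter; apply: uniq_leq_size.
  by rewrite filter_uniq // iota_uniq.
move=> p; rewrite !mem_filter mem_iota add0n => /andP[hp hn].
by rewrite h // mem_iota.
Qed.

Lemma cnD P Q1 Q2 :
  (forall p, p < n -> P p = Q1 p || Q2 p) ->
  (forall p, p < n -> Q1 p -> ~~ Q2 p) ->
  cn n P = cn n Q1 + cn n Q2.
Proof.
move=> h1 h2; rewrite (cn_eq h1) /cn -(count_predUI Q1 Q2).
rewrite [X in _ = _ + X](_ : _ = 0) ?addn0 //.
apply/eqP; rewrite eqn0Ngt -has_count; apply/hasPn => p.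
rewrite mem_iota => /andP[_ hp] /=; apply/negP => /andP[q1 q2].
by have := h2 p hp q1; rewrite q2.
Qed.

Lemma cn_gt0P P : reflect (exists2 p, p < n & P p) (0 < cn n P).
Proof.
rewrite /cn -has_count; apply: (iffP hasP) => -[p hp hP]; exists p => //.
  by move: hp; rewrite mem_iota.
by rewrite mem_iota.
Qed.

Lemma cn_meet P Q1 Q2 : (forall p, p < n -> Q1 p -> P p) ->
  (forall p, p < n -> Q2 p -> P p) ->
  cn n P < (cn n Q1).*2 -> cn n P < (cn n Q2).*2 ->
  exists p, [/\ p < n, Q1 p & Q2 p].
Proof.
move=> h1 h2 c1 c2.
suff : 0 < cn n (predI Q1 Q2) by case/cn_gt0P => p hp /andP[]; exists p.
have := count_predUI Q1 Q2 (iota 0 n); rewrite -!/(cn n _).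
have : cn n (predU Q1 Q2) <= cn n P.
  by apply: cn_le => p hp /= /orP[]; [exact: h1|exact: h2].
by rewrite /cn in c1 c2 *; lia.
Qed.

Lemma cn0 P : (forall p, p < n -> P p = false) -> cn n P = 0.
Proof.
by move=> h; apply/eqP; rewrite eqn0Ngt; apply/cn_gt0P => -[p /h ->].
Qed.

Lemma cn_leq P : cn n P <= n.
Proof. by rewrite -[X in _ <= X](size_iota 0 n) count_size. Qed.

Lemma sum_cn (c : nat -> nat) K P :
  \sum_(q < K) cn n (fun p => (c p == q) && P p) =
  cn n (fun p => (c p < K) && P p).
Proof.
elim: K => [|K ih]; first by rewrite big_ord0 /cn count_pred0.
rewrite big_ord_recr /= ih; apply/esym/cnD => p _.
  by rewrite ltnS leq_eqVlt; case: eqP; case: ltnP; case: (P p).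
by move=> /andP[h _]; case: eqP => // e; move: h; rewrite e ltnn.
Qed.

End Counting.

Section Level.
Context {R : realType}.
Variables (rho w Delta : R) (n d b : nat) (y : nat -> nat -> R).
Variables (cell : nat -> nat) (Q Q' : nat).
Variables (CF CD NEW : nat -> nat) (CT : nat -> R) (H : nat -> nat -> R).
Local Open Scope nat_scope.

Definition inbox (q p : nat) : bool :=
  all (fun e => y e p <= H q e)%R (iota 0 (2 * d)).

(** The value [n] marks a point that belongs to no cell. A point of a slab is dropped only for the
    rest of the round, a point of a box for good. *)
Definition newcell (p : nat) : nat :=
  let q := cell p in
  if n <= q then q else
  if CF q != 0 then
    if (CT q <= y (CD q) p)%R then NEW q
    else if (y (CD q) p <= CT q - w)%R then q else n
  else if inbox q p then n else q.

Definition opp_dir (e : nat) : nat := if e < d then d + e else e - d.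

(** The upper part of a cut cell gets a fresh number in [[Q, Q'[], the lower part keeps the old one.
    [K] is the number of cells treated so far; [new_sum] lets a sum over the new cells be compared
    term by term with a sum over their parents. *)
Record new_ids (K : nat) : Prop := NewIds {
  new_le : Q <= Q';
  new_bounds : forall q, q < K -> CF q != 0 -> Q <= NEW q < Q';
  new_incr : forall q1 q2, q1 < q2 -> q2 < K -> CF q1 != 0 -> CF q2 != 0 ->
    NEW q1 < NEW q2;
  new_surj : forall q, q < Q' ->
    q < Q \/ exists q0, [/\ q0 < K, CF q0 != 0 & q = NEW q0];
  new_sum : forall f : nat -> R,
    (\sum_(q < Q') f q =
     \sum_(q < Q) f q + \sum_(q < K | CF q != 0%N) f (NEW q))%R }.

Hypothesis rho_gt0 : (0 < rho)%R.
Hypothesis rho_lt1 : (rho < 1)%R.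
Hypothesis w_gt0 : (0 < w)%R.
Hypothesis d_gt0 : 0 < d.
Hypothesis y_opp : forall e p, e < 2 * d -> y (opp_dir e) p = (- y e p)%R.
Hypothesis leQ : Q <= n.
Hypothesis leQ' : Q' <= n.
Hypothesis cellQ : forall p, p < n -> cell p < Q \/ cell p = n.
Hypothesis cuts : forall q, q < Q -> CF q != 0 ->
  good_cut rho w n d y cell q (CD q) (CT q).
Hypothesis boxes : forall q, q < Q -> 0 < csize n cell q -> CF q = 0 ->
  forall e, e < 2 * d -> box_side rho w n d b y cell q e (H q e).
Hypothesis ids : new_ids Q.

Local Notation m := (csize n cell).
Local Notation m' := (csize n newcell).
Local Notation boxed q := (cn n (fun p => (cell p == q) && inbox q p)).

Lemma opp_dir_lt e : e < 2 * d -> opp_dir e < 2 * d.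
Proof. by rewrite /opp_dir; case: ifP; lia. Qed.

Lemma new_gt q : q < Q -> CF q != 0 -> Q <= NEW q.
Proof. by move=> hq hc; have /andP[] := new_bounds ids hq hc. Qed.

Lemma new_lt q : q < Q -> CF q != 0 -> NEW q < n.
Proof.
move=> hq hc; have /andP[_ h] := new_bounds ids hq hc; exact: leq_trans leQ'.
Qed.

Lemma new_inj q1 q2 : q1 < Q -> q2 < Q -> CF q1 != 0 -> CF q2 != 0 ->
  NEW q1 = NEW q2 -> q1 = q2.
Proof.
move=> h1 h2 c1 c2 e; case: (ltngtP q1 q2) => // lt.
  by have := new_incr ids lt h2 c1 c2; rewrite e ltnn.
by have := new_incr ids lt h1 c2 c1; rewrite e ltnn.
Qed.

Lemma newcell_old p q : p < n -> q < Q ->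
  (newcell p == q) = (cell p == q) &&
    (if CF q != 0 then (y (CD q) p <= CT q - w)%R else ~~ inbox q p).
Proof.
move=> hp hq; rewrite /newcell; have [lt|->] := cellQ hp; last first.
  by rewrite leqnn; case: eqP => // e; move: hq; rewrite -e ltnNge leQ.
have qn : q < n by exact: leq_trans leQ.
have nq : (n == q) = false by apply/eqP => e; move: qn; rewrite e ltnn.
rewrite (leqNgt n) (leq_trans lt leQ) /=.
case: (eqVneq (cell p) q) => [->|ne].
  case: ifP => cf; last by case: inbox; rewrite ?eqxx ?nq.
  case: ifP => h1.
    have /eqP : NEW q <> q by move=> e; have := new_gt hq cf; rewrite e leqNgt hq.
    move=> /negbTE ->; apply/esym/negbTE; rewrite -ltNge.
    by apply: lt_le_trans h1; rewrite ltrBlDr ltrDl.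
  by case: ifP => _; rewrite ?eqxx ?nq.
rewrite /=; case: ifP => cf.
  case: ifP => _.
    by apply/eqP => e; have := new_gt lt cf; rewrite e leqNgt hq.
  by case: ifP => _; rewrite ?nq // (negbTE ne).
by case: ifP => _; rewrite ?nq // (negbTE ne).
Qed.

Lemma newcell_new p q : p < n -> q < Q -> CF q != 0 ->
  (newcell p == NEW q) = (cell p == q) && (CT q <= y (CD q) p)%R.
Proof.
move=> hp hq cq; rewrite /newcell; have [lt|e] := cellQ hp; last first.
  rewrite e leqnn; have := new_lt hq cq; rewrite ltn_neqAle eq_sym => /andP[/negbTE -> _].
  by case: eqP => // e'; move: hq; rewrite -e' ltnNge leQ.
have nN : (n == NEW q) = false.
  by have := new_lt hq cq; rewrite ltn_neqAle eq_sym => /andP[/negbTE -> _].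
have oN : (cell p == NEW q) = false.
  by apply/eqP => e; have := new_gt hq cq; rewrite -e leqNgt lt.
rewrite (leqNgt n) (leq_trans lt leQ) /=.
case: (eqVneq (cell p) q) => [e|ne] /=.
  rewrite e in oN *; rewrite cq; case: ifP => _; first by rewrite eqxx.
  by case: ifP => _; rewrite ?nN ?oN.
case: ifP => cf.
  case: ifP => _; last by case: ifP; rewrite ?nN ?oN.
  by apply/eqP => e; move/eqP: ne; apply; exact: new_inj e.
by case: ifP => _; rewrite ?nN ?oN.
Qed.

Lemma newcell_range p : p < n -> newcell p < Q' \/ newcell p = n.
Proof.
move=> hp; rewrite /newcell; have [lt|->] := cellQ hp; last first.
  by rewrite leqnn; right.
have QQ' := new_le ids.
rewrite (leqNgt n) (leq_trans lt leQ) /=.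
have lt' : cell p < Q' by exact: leq_trans QQ'.
case: ifP => cf; last by case: ifP; [right|left].
case: ifP => _; last by case: ifP; [left|right].
by left; have /andP[] := new_bounds ids lt cf.
Qed.

Definition parent_dec q : q < Q' ->
  {q0 | q0 < Q & q = q0 \/ (CF q0 != 0 /\ q = NEW q0)}.
Proof.
move=> hq; apply: cid2; have [lt|[q0 [h1 h2 h3]]] := new_surj ids hq.
  by exists q => //; left.
by exists q0 => //; right.
Qed.

Lemma newcell_sub p q : p < n -> q < Q' -> newcell p = q ->
  exists q0, [/\ q0 < Q, cell p = q0 & q = q0 \/ (CF q0 != 0 /\ q = NEW q0)].
Proof.
move=> hp hq e; have [q0 h0 h1] := parent_dec hq; exists q0; split=> //.
case: h1 => [e0|[c0 e0]].
  by move/eqP: e; rewrite e0 newcell_old // => /andP[/eqP].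
by move/eqP: e; rewrite e0 newcell_new // => /andP[/eqP].
Qed.

Lemma size_cut_old q : q < Q -> CF q != 0 ->
  m' q + above n y cell q (CD q) (CT q - w) = m q.
Proof.
move=> hq cq; apply/esym/cnD => p hp; rewrite newcell_old // cq.
  by rewrite -andb_orr leNgt orNb andbT.
by move=> /andP[-> h]; rewrite /= -leNgt.
Qed.

Lemma size_cut_new q : q < Q -> CF q != 0 ->
  m' (NEW q) = atleast n y cell q (CD q) (CT q).
Proof. by move=> hq cq; apply: cn_eq => p hp; rewrite newcell_new. Qed.

Lemma size_box q : q < Q -> CF q = 0 -> m' q + boxed q = m q.
Proof.
move=> hq cq; apply/esym/cnD => p hp; rewrite newcell_old // cq.
  by rewrite -andb_orr orNb andbT.
by move=> /andP[-> h].
Qed.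

Lemma atleast_le_above q e t :
  atleast n y cell q e t <= above n y cell q e (t - w).
Proof.
apply: cn_le => p _ /andP[-> h] /=; apply: lt_le_trans h.
by rewrite ltrBlDr ltrDl.
Qed.

(* Each of the 2d sides leaves out fewer than m / (4d) points. *)
Lemma size_boxed q : q < Q -> 0 < m q -> CF q = 0 -> m q <= (boxed q).*2.
Proof.
move=> hq m0 cq.
have hb := boxes hq m0 cq.
suff : forall K, K <= 2 * d -> 
    4 * d * cn n (fun p => (cell p == q) &&
      ~~ all (fun e => (y e p <= H q e)%R) (iota 0 K)) <= K * m q.
  move=> /(_ _ (leqnn _)); rewrite -[(2 * d) * _]mulnA.
  have -> : 4 * d = 2 * (d * 2) by lia.
  rewrite -!mulnA leq_pmul2l // leq_pmul2l // => h.
  pose X := cn n (fun p => (cell p == q) && ~~ inbox q p).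
  suff e : boxed q + X = m q.
    by rewrite -e -addnn leq_add2l -(leq_add2r X) addnn -mul2n e.
  apply/esym/cnD => p hp; first by rewrite -andb_orr orbN andbT.
  by move=> /andP[-> ->].
elim=> [|K ih] hK.
  by rewrite cn0 ?muln0 // => p _; rewrite /= andbF.
have {}ih := ih (ltnW hK); have [[_ h1] _] := hb K hK.
apply: leq_trans (_ : 4 * d * (cn n (fun p => (cell p == q) &&
      ~~ all (fun e => (y e p <= H q e)%R) (iota 0 K)) +
      above n y cell q K (H q K)) <= _); last first.
  by rewrite mulnDr mulSn addnC leq_add // ltnW.
rewrite leq_mul2l; apply/orP; right.
rewrite -addn1 iotaD add0n /= /cn -count_predUI.
apply: leq_trans (leq_addr _ _); apply: sub_count => p /=.
by rewrite all_cat negb_and /= andbT -ltNge -andb_orr.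
Qed.

Lemma size_box_half q : q < Q -> 0 < m q -> CF q = 0 -> (m' q).*2 <= m q.
Proof.
move=> hq m0 cq; have := size_boxed hq m0 cq.
by rewrite -(size_box hq cq) -!addnn leq_add2r leq_add2l.
Qed.

(** Only the lower part of a cut can be large: it misses at least [B >= m / (4d)] points. An upper
    part has at most [C <= m / 2] points, a box leaves at most [m / 2], and [1/2 <= 1 - 1/(4d)]. *)
Lemma size_new_le (M : R) : (forall q, q < Q -> ((m q)%:R <= M)%R) -> (0 <= M)%R ->
  forall q, q < Q' -> ((m' q)%:R <= (1 - (4 * d)%:R^-1) * M)%R.
Proof.
move=> hM M0 q hq.
have d0 : (0 < (4 * d)%:R :> R)%R by rewrite ltr0n; lia.
have d4 : (4 <= (4 * d)%:R :> R)%R by rewrite ler_nat; lia.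
have half : (2^-1 <= 1 - (4 * d)%:R^-1 :> R)%R.
  have : ((4 * d)%:R^-1 <= 4^-1 :> R)%R by rewrite lef_pV2 ?posrE.
  by lra.
have fin q0 (x : nat) : q0 < Q -> x.*2 <= m q0 ->
    (x%:R <= (1 - (4 * d)%:R^-1) * M)%R.
  move=> h0 hx; apply: le_trans (_ : (2^-1 * M <= _)%R); last first.
    by apply: ler_wpM2r.
  have := hM q0 h0; have : ((x.*2)%:R <= (m q0)%:R :> R)%R by rewrite ler_nat.
  by rewrite -muln2 natrM; lra.
have [q0 h0 [->|[c0 ->]]] := parent_dec hq; last first.
  apply: (fin q0) => //; rewrite size_cut_new //.
  have [_ _ h _ _] := cuts h0 c0; apply: leq_trans h.
  by rewrite leq_double atleast_le_above.
case: (posnP (m q0)) => [e0|m0].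
  apply: (fin q0) => //; rewrite e0 leqn0 double_eq0 -leqn0 -e0.
  by apply: cn_le => p hp; rewrite newcell_old // => /andP[].
case: (eqVneq (CF q0) 0) => [c0|c0]; first by apply: (fin q0) => //; exact: size_box_half.
have [_ hB _ _ _] := cuts h0 c0.
have hs := size_cut_old h0 c0.
have hA := atleast_le_above q0 (CD q0) (CT q0).
apply: le_trans (_ : ((1 - (4 * d)%:R^-1) * (m q0)%:R <= _)%R); last first.
  by apply: ler_wpM2l; [lra|exact: hM].
have hBR : ((m q0)%:R <= (4 * d)%:R * (atleast n y cell q0 (CD q0) (CT q0))%:R :> R)%R.
  by rewrite -natrM ler_nat.
have hsR : ((m' q0)%:R + (atleast n y cell q0 (CD q0) (CT q0))%:R <= (m q0)%:R :> R)%R.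
  by rewrite -natrD ler_nat -hs leq_add2l.
have : ((4 * d)%:R^-1 * (m q0)%:R <= (atleast n y cell q0 (CD q0) (CT q0))%:R :> R)%R.
  by rewrite mulrC ler_pdivrMr // mulrC.
by lra.
Qed.

Lemma sum_new (f : nat -> R) :
  (\sum_(q < Q') f q =
   \sum_(q < Q) (f q + (if CF q != 0%N then f (NEW q) else 0)))%R.
Proof. by rewrite (new_sum ids) [X in (_ + X)%R]big_mkcond -big_split. Qed.

(** Cells can become empty, so each is charged the maximum of its size and 1; a cut cell has at
    least 2 points, enough to pay for both parts. Cell numbers thus stay below [n], the mark of a
    dropped point. This bound later discharges [leQ'], which is cleared for that reason. *)
Lemma new_le_n : (\sum_(q < Q) (maxn (m q) 1)%:R <= n%:R :> R)%R -> Q' <= n.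
Proof.
clear leQ'; move=> h; rewrite -(ler_nat R); apply: le_trans h.
have := sum_new (fun=> 1%R); rewrite sumr_const card_ord => ->.
apply: ler_sum => -[q hq] _ /=; case: ifP => cq; last first.
  by rewrite addr0 ler1n leq_max orbT.
have [_ _ hC B0 _] := cuts hq cq.
have := atleast_le_above q (CD q) (CT q).
by rewrite -(natrD _ 1 1) ler_nat; lia.
Qed.

Lemma sum_max_new :
  (\sum_(q < Q') (maxn (m' q) 1)%:R <= \sum_(q < Q) (maxn (m q) 1)%:R :> R)%R.
Proof.
rewrite (sum_new (fun q => (maxn (m' q) 1)%:R%R)); apply: ler_sum => -[q hq] _ /=.
case: ifP => cq.
  rewrite -natrD ler_nat size_cut_new //.
  have [_ hm hC B0 _] := cuts hq cq.
  have := size_cut_old hq cq; have := atleast_le_above q (CD q) (CT q).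
  by lia.
rewrite addr0 ler_nat; have /eqP cq0 : CF q == 0 by apply/negbFE.
by rewrite -(size_box hq cq0) geq_max !leq_max leq_addr orbT.
Qed.

Lemma sum_boxed :
  (\sum_(q < Q | CF q == 0%N) (boxed q)%:R =
   (cn n (fun p => [&& cell p < Q, CF (cell p) == 0 & inbox (cell p) p])%N)%:R
   :> R)%R.
Proof.
rewrite -(sum_cn n cell) natr_sum [LHS]big_mkcond /=; apply: eq_bigr => -[q hq] _ /=.
case: ifP => cq.
  by congr _%:R%R; apply: cn_eq => p _; case: eqP => //= ->; rewrite cq.
by rewrite cn0 // => p _ /=; case: eqP => //= ->; rewrite cq.
Qed.

(** Cell by cell: a cut does not lower the potential ([powR_cut]), and a box lowers it by at most
    the number of points boxed ([powR_box]). *)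
Lemma potential_new :
  (\sum_(q < Q) (m q)%:R `^ (1 - rho) <=
   \sum_(q < Q | CF q == 0%N) (boxed q)%:R +
   \sum_(q < Q') (m' q)%:R `^ (1 - rho))%R.
Proof.
have hrho : (0 < rho < 1)%R by apply/andP.
rewrite (sum_new (fun q => (m' q)%:R `^ (1 - rho))%R).
rewrite [X in (_ <= X + _)%R]big_mkcond -big_split; apply: ler_sum => -[q hq] _ /=.
case: (eqVneq (CF q) 0) => [cq|cq] /=.
  by rewrite addr0 -(size_box hq cq) addnC; apply: powR_box.
rewrite add0r size_cut_new //; have [_ hm hC B0 hr] := cuts hq cq.
have hs := size_cut_old hq cq.
have -> : ((m' q)%:R = (m q)%:R - (above n y cell q (CD q) (CT q - w)%R)%:R :> R)%R.
  by rewrite -hs natrD addrK.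
apply: powR_cut => //.
  rewrite ltr0n; apply: leq_trans B0 _; apply: cn_le => p _.
  by case/andP.
by rewrite ler0n ler_nat -hs leq_addl.
Qed.

(** In each of the two orientations more than half of the cell lies above the quantile minus
    [(j + 1) * w]. Some point does so in both, hence the two quantiles add up to less than
    [(j1 + j2 + 2) * w]. Times [rho] this is at most [20 * b * w + 2 * w]; the two margins [w / 3]
    add less than [w], and [20 + 2 + 1 = 23] is the constant in the choice of [w]. *)
Lemma box_width q i : q < Q -> 0 < m q -> CF q = 0 -> i < d ->
  (w * (23 * b%:R) = Delta * rho)%R -> 0 < b ->
  (H q i + H q (d + i) + w / 3 + w / 3 <= Delta)%R.
Proof.
move=> hq m0 cq hi ew b0.
have hi1 : i < 2 * d by lia.
have hi2 : d + i < 2 * d by lia.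
have [_ [j1 [hj1 c1]]] := boxes hq m0 cq hi1.
have [_ [j2 [hj2 c2]]] := boxes hq m0 cq hi2.
have [||p [pn /andP[_ h1] /andP[_ h2]]] := cn_meet _ _ c1 c2.
- by move=> p _ /andP[].
- by move=> p _ /andP[].
have e : y (d + i) p = (- y i p)%R.
  by rewrite -y_opp /opp_dir ?hi.
rewrite e -natr1 in h2; rewrite -natr1 in h1.
rewrite -(ler_pM2r rho_gt0) -ew.
have p1 : (0 <= (10 * b%:R - j1%:R * rho) * w)%R.
  by apply: mulr_ge0; [rewrite subr_ge0|exact: ltW].
have p2 : (0 <= (10 * b%:R - j2%:R * rho) * w)%R.
  by apply: mulr_ge0; [rewrite subr_ge0|exact: ltW].
have p3 : (0 <= ((j1%:R + 1) * w + (j2%:R + 1) * w - H q i - H q (d + i)%N) * rho)%R.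
  by apply: mulr_ge0; [lra|exact: ltW].
have b1 : (1 <= b%:R :> R)%R by rewrite ler1n.
have p4 : (0 <= w * (1 - rho))%R by apply: mulr_ge0; rewrite ?subr_ge0 ltW.
have p5 : (0 <= w * (b%:R - 1))%R by apply: mulr_ge0; rewrite ?subr_ge0 // ltW.
by have := w_gt0; lra.
Qed.

(* A point whose cell is loc j is kept away from every other cell q by some
   direction; for points dropped earlier, loc still records where they lie. *)
Definition kept_apart (c : nat -> nat) (K : nat) (loc : nat -> nat) : Prop :=
  forall j q, j < n -> q < K -> q <> loc j ->
    exists e, e < 2 * d /\
      forall p, p < n -> c p = q -> (y e p + w / 3 < y e j)%R.

Variable loc : nat -> nat.
Hypothesis loc_lt : forall j, j < n -> loc j < Q.
Hypothesis loc_sep : kept_apart cell Q loc.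

(** Every point, dropped or not, is assigned to a side of the middle [t - w / 2] of the slab. Both
    parts of the cell stay [w / 2] away from the middle, more than the [w / 3] by which boxes are
    enlarged. *)
Definition newloc (j : nat) : nat :=
  let q := loc j in
  if (CF q != 0) && (CT q - w / 2 < y (CD q) j)%R then NEW q else q.

Lemma newloc_lt j : j < n -> newloc j < Q'.
Proof.
move=> hj; have hl := loc_lt hj; rewrite /newloc; case: ifP => [/andP[c _]|_].
  by have /andP[] := new_bounds ids hl c.
exact: leq_trans (new_le ids).
Qed.

(** Cells with another parent inherit the separation. The sibling part is separated by the direction
    of the cut or, when [j] is on the lower side, by the opposite direction. *)
Lemma newloc_sep : kept_apart newcell Q' newloc.
Proof.
move=> j q hj hq ne; have hl := loc_lt hj.
have [q0 h0 hq0] := parent_dec hq.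
have sub p : p < n -> newcell p = q -> cell p = q0.
  move=> hp /eqP; case: hq0 => [->|[c0 ->]].
    by rewrite newcell_old // => /andP[/eqP].
  by rewrite newcell_new // => /andP[/eqP].
case: (eqVneq q0 (loc j)) => [e0|/eqP ne0]; last first.
  have [e [he h]] := loc_sep hj h0 ne0; exists e; split=> // p hp hc.
  by apply: h => //; apply: sub.
rewrite e0 in hq0; rewrite /newloc in ne.
case: (eqVneq (CF (loc j)) 0) => [c0|c0].
  by rewrite c0 /= in ne; case: hq0 => [//|[]]; rewrite c0.
have [hd _ _ _ _] := cuts hl c0.
rewrite c0 /= in ne; case: ifP ne => hlt ne.
  case: hq0 => [eq|[_ //]]; exists (CD (loc j)); split=> // p hp /eqP.
  rewrite eq newcell_old // c0 => /andP[_ h].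
  by have := w_gt0; lra.
case: hq0 => [//|[_ eq]]; exists (opp_dir (CD (loc j))).
split; first exact: opp_dir_lt.
move=> p hp /eqP; rewrite eq newcell_new // => /andP[_ h].
rewrite !y_opp //; move/negbT: hlt; rewrite -leNgt => hlt.
by have := w_gt0; lra.
Qed.

Lemma size_newloc j : j < n -> m' (newloc j) <= m (loc j).
Proof.
move=> hj; have hl := loc_lt hj; rewrite /newloc; case: ifP => [/andP[c _]|_].
  by apply: cn_le => p hp; rewrite newcell_new // => /andP[].
by apply: cn_le => p hp; rewrite newcell_old // => /andP[].
Qed.

Lemma size_newloc_box j : j < n -> 0 < m (loc j) -> CF (loc j) = 0 ->
  (m' (newloc j)).*2 <= m (loc j).
Proof.
move=> hj m0 c0; rewrite /newloc c0 /=; apply: size_box_half => //; exact: loc_lt.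
Qed.

(** If [q] were another cell, then in the direction separating it from [j] its quantile is the
    coordinate of one of its points, so [j] lies more than [w / 3] beyond, outside the enlarged
    box. *)
Lemma box_loc j q : j < n -> q < Q -> 0 < m q -> CF q = 0 ->
  (forall e, e < 2 * d -> (y e j <= H q e + w / 3)%R) -> q = loc j.
Proof.
move=> hj hq m0 c0 hb; apply/eqP/negP => /negP/eqP ne.
have [e [he h]] := loc_sep hj hq ne.
have [[[p [hp cp yp]] _] _] := boxes hq m0 c0 he.
by have := h p hp cp; have := hb e he; rewrite yp; lra.
Qed.

End Level.

(** * The program *)

Section Costs.
Local Open Scope nat_scope.

Lemma forcost_le e N T X : N <= X -> 0 < X ->
  forcost e N T <= (T + (icost e).*2 + 22) * X.
Proof.
move=> hN hX; rewrite /forcost.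
apply: leq_trans (_ : X * (T + icost e + 12) + (icost e + 10) * X <= _).
  by rewrite -addnA leq_add // ?leq_mul2r ?hN ?orbT // leq_pmulr.
by rewrite mulnC -mulnDl leq_mul2r; apply/orP; right; lia.
Qed.

Lemma seqcost_le T1 T2 C1 C2 X : T1 <= C1 * X -> T2 <= C2 * X -> 0 < X ->
  (T1 + T2).+1 <= (C1 + C2).+1 * X.
Proof.
by move=> h1 h2 hX; rewrite mulSn mulnDl -add1n !leq_add.
Qed.

Lemma constcost_le T X : 0 < X -> T <= T * X.
Proof. by move=> hX; rewrite leq_pmulr. Qed.

End Costs.

Definition eN := ILoad 0 (INum 0).
Definition eD := ILoad 0 (INum 1).
Definition eDD := IMul (INum 2) eD.

(* A scalar is cell 0 of an array of its own. Natural scalars: 10, 11, 12 loop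
   counters; 14, 15 the rounded logarithms a, b of 4d; 16 direction; 17 cell in
   a loop over cells; 18, 19 number of cells now and at the start of a level;
   33 tree node, 34 free end of the sort buffer, 35 to 38 bounds of the two
   runs being merged; 39 active points; 40 uncovered points; 41 current point;
   42 its cell; 43 box membership flag. *)
Definition ceil_log (a : nat) (e : iexp) : cmd :=
  Seq (iset 13 (INum 1)) (Seq (iset a (INum 0))
    (For 10 e (If (BILe e (ivar 13)) Skip
      (Seq (iset 13 (IMul (INum 2) (ivar 13)))
           (iset a (IAdd (ivar a) (INum 1))))))).

Definition rvar (x : nat) : rexp := RLoad x (INum 0).
Definition rset (x : nat) (e : rexp) : cmd := RStore x (INum 0) e.
Definition rnum (k : nat) : rexp := ROfNat (INum k).

(* Real scalars: 10 is w, 11 the growth factor, 12 is w / 3; array 13 is gpow. *)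
Definition set_widths : cmd :=
  Seq (rset 10 (RDiv (RMul (RLoad 1 (INum 0)) (RLoad 1 (INum 1)))
                     (RMul (rnum 23) (ROfNat (ivar 15)))))
  (Seq (rset 12 (RDiv (rvar 10) (rnum 3)))
  (Seq (rset 11 (RAdd (rnum 1) (RDiv (RLoad 1 (INum 1)) (rnum 2))))
       (RStore 13 (INum 1) (rnum 1)))).

(** The truncated logarithms of [2 * k] and [2 * k + 1] are one more than that of [k], so the table
    is filled from entry 1 by multiplications alone. *)
Definition fill_gpow : cmd :=
  let k := IAdd (ivar 10) (INum 1) in
  For 10 eN
    (Seq (RStore 13 (IMul (INum 2) k) (RMul (RLoad 13 k) (rvar 11)))
         (RStore 13 (IAdd (IMul (INum 2) k) (INum 1))
            (RMul (RLoad 13 k) (rvar 11)))).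

Definition set_params : cmd :=
  Seq (ceil_log 14 (IMul (INum 4) eD))
  (Seq (ceil_log 15 (ivar 14)) (Seq set_widths fill_gpow)).

(* Real array 14: cell e * n + p is y_e(p), where y_e = x_e for e < d and
   y_(d+i) = - x_i. *)
Definition fill_dirs : cmd :=
  let src := RLoad 0 (IAdd (IMul (ivar 11) eD) (ivar 10)) in
  For 10 eD (For 11 eN
    (Seq (RStore 14 (IAdd (IMul (ivar 10) eN) (ivar 11)) src)
         (RStore 14 (IAdd (IMul (IAdd eD (ivar 10)) eN) (ivar 11))
            (RSub (rnum 0) src)))).

Section SetupSpec.
Context {R : realType}.
Implicit Types s : state R.
Local Open Scope nat_scope.

Lemma run_le c s T T' (Q : state R -> Prop) :
  run c s T Q -> T <= T' -> run c s T' Q.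
Proof. by move=> h hT; apply: run_weaken h hT _. Qed.

Lemma ceil_log_spec a e s0 N X :
  a \notin [:: 10; 13] ->
  (forall s, frame (ceil_log a e) s0 s -> ieval s e = N) -> N <= X -> 0 < N ->
  run (ceil_log a e) s0 ((icost e * 6 + 100) * X)
    (fun s => N <= 2 ^ imem s a 0 < 2 * N).
Proof.
move=> ha he hN N0; have X0 : 0 < X by exact: leq_trans hN.
have [a10 a13] : (10 == a) = false /\ (13 == a) = false.
  by split; apply/negbTE; move: ha; rewrite !inE negb_or => /andP[? ?]; rewrite eq_sym.
have [a10' a13'] : (a == 10) = false /\ (a == 13) = false.
  by rewrite ![a == _]eq_sym.
apply: (@run_le _ _ (3 + (3 + forcost e N (icost e + 20)).+1).+1); last first.
  by have := forcost_le e (icost e + 20) hN X0; lia.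
apply: run_seq; apply: run_step; first by [].
set s1 := step _ _.
apply: run_seq; apply: run_step; first by [].
set s2 := step _ _.
have f2 : frame (ceil_log a e) s0 s2.
  split=> x hx; last by [].
  rewrite /= !upd_other //; move: hx; rewrite /= !inE !negb_or.
    by case/and3P.
  by case/and3P.
pose I (i : nat) s := [/\ imem s 13 0 = 2 ^ imem s a 0, 2 ^ imem s a 0 < 2 * N
  & N <= 2 ^ imem s a 0 \/ i <= imem s a 0].
apply: (@run_post _ _ _ _ (I N)); last first.
  (* Every turn either finds the bound reached or raises the exponent, and [N <= 2 ^ N]. *)
  move=> s _ [h1 h2 h3]; rewrite h2 andbT; case: h3 => // h3; apply: leq_trans h3 _.
  exact/ltnW/ltn_expl.
have sub s : frame (For 10 e (If (BILe e (ivar 13)) Skip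
      (Seq (iset 13 (IMul (INum 2) (ivar 13)))
           (iset a (IAdd (ivar a) (INum 1)))))) s2 s -> frame (ceil_log a e) s0 s.
  move=> hf; apply: (frame_trans f2); apply: frame_sub hf => x /=.
    by rewrite !inE => /or3P[] ->; rewrite ?orbT.
  by [].
apply: (@run_for _ I 10 e _ N (icost e + 20)).
- by move=> s hf; apply: he; apply: sub.
- by rewrite /= !inE negb_or a10.
- rewrite /I /setx /= /upd a13 a10' !eqxx /=.
  by split=> //; [lia|right].
move=> i s ltN hf hi [h1 h2 h3].
apply: (@run_le _ _ (cost (If (BILe e (ivar 13)) Skip
      (Seq (iset 13 (IMul (INum 2) (ivar 13)))
           (iset a (IAdd (ivar a) (INum 1))))))); last first.
  by rewrite /=; lia.
apply: run_step => //=; rewrite (he s) ?h1; last exact: sub.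
case: ifP => hle; rewrite /I /setx /= /upd ?a13 ?a13' a10' ?eqxx /= ?a13' /=.
  by split=> //; left.
rewrite expnD expn1 mulnC; split=> //; first by lia.
by case: h3 => h3; [lia|right; lia].
Qed.

Lemma gpow2 (rho : R) k : 0 < k -> gpow rho (2 * k) = (gpow rho k * growth rho)%R.
Proof. by move=> k0; rewrite /gpow mul2n trunc_log2_double // exprSr. Qed.

Lemma gpow2S (rho : R) k : 0 < k ->
  gpow rho (2 * k + 1) = (gpow rho k * growth rho)%R.
Proof.
move=> k0; rewrite /gpow trunc_log2S ?exprSr; last by lia.
by rewrite (_ : (2 * k + 1)./2 = k) //; lia.
Qed.

Lemma fill_gpow_spec (rho : R) s0 n X :
  imem s0 0 0 = n -> n <= X -> 0 < X ->
  rmem s0 11 0 = growth rho -> rmem s0 13 1 = 1%R ->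
  run fill_gpow s0 (100 * X)
    (fun s => forall k, 0 < k <= n -> rmem s 13 k = gpow rho k).
Proof.
move=> en hn hX eg e1.
pose I (i : nat) s := forall k, 0 < k < 2 * i.+1 -> rmem s 13 k = gpow rho k.
cbv beta zeta delta [fill_gpow]; set body := (X in For 10 eN X).
apply: (@run_le _ _ (forcost eN n (cost body))); last first.
  by apply: leq_trans (forcost_le _ _ hn hX) _; rewrite leq_mul2r orbT.
apply: (@run_post _ _ _ _ (I n)); last first.
  by move=> s _ hI k /andP[k0 kn]; apply: hI; lia.
apply: (@run_for _ I 10 eN body n (cost body)).
- by move=> s [hf _]; rewrite /= hf.
- by [].
- move=> k /= hk; have -> : k = 1 by lia.
  by rewrite e1 /gpow trunc_log1 expr0.
move=> i s ltN [_ hf] hi hI; apply: run_step => // k hk.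
rewrite /= hi /upd /= !addn1 (_ : (i.+1 == 2 * i.+1) = false); last by lia.
rewrite (hf 11) // eg hI; last by lia.
case: eqP => [->|ne1]; first by rewrite -gpow2S // addn1.
by case: eqP => [->|ne2]; [rewrite -gpow2|apply: hI; lia].
Qed.

Definition params_ok (n d b : nat) (Delta rho w : R) s : Prop :=
  [/\ w * (23 * b%:R) = Delta * rho /\ 0 < w, rmem s 10 0 = w,
     rmem s 12 0 = w / 3, rmem s 11 0 = growth rho &
     forall k, (0 < k <= n)%N -> rmem s 13 k = gpow rho k]%R.

Lemma set_params_spec (n d : nat) (Delta rho : R) s0 X :
  imem s0 0 0 = n -> imem s0 0 1 = d -> rmem s0 1 0 = Delta ->
  rmem s0 1 1 = rho -> 0 < d -> (0 < Delta)%R -> (0 < rho)%R ->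
  n <= X -> 8 * d <= X ->
  run set_params s0 (500 * X)
    (fun s => exists a b w, [/\ 4 * d <= 2 ^ a < 2 * (4 * d), a <= 2 ^ b < 2 * a,
       0 < b & params_ok n d b Delta rho w s]).
Proof.
move=> en ed eDl er d0 D0 r0 hn hd; have X0 : 0 < X by lia.
apply: (@run_le _ _ ((icost (IMul (INum 4) eD) * 6 + 100) * X +
  ((icost (ivar 14) * 6 + 100) * X + (cost set_widths + 100 * X).+1).+1).+1);
  last by rewrite /=; lia.
apply/run_seq/run_post.
  apply: (@ceil_log_spec _ _ _ (4 * d)) => //; last by lia.
    by move=> s [hf _]; rewrite /= hf // ed.
  by lia.
move=> s1 [i1 r1] ha.
apply/run_seq/run_post.
  apply: (@ceil_log_spec _ _ _ (imem s1 14 0)) => //; last first.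
  - by case: (imem s1 14 0) ha => [|//]; rewrite expn0; lia.
  - have := @ltn_expl 2 (imem s1 14 0) isT; lia.
  - by move=> s [hf _]; rewrite /= hf.
move=> s2 [i2 r2] hb.
apply/run_seq/run_step => //.
set s3 := step _ _.
set a := imem s1 14 0 in ha hb; set b := imem s2 15 0 in hb.
set w : R := (Delta * rho / (23 * b%:R))%R.
(* [4 <= 4 * d <= 2 ^ a] forces [a >= 2], hence [b >= 1]: the division in [w] is not by zero. *)
have a2 : 1 < a.
  by move: ha d0; clearbody a; clear; case: a => [|[|//]]; rewrite ?expn0 ?expn1; lia.
have b0 : 0 < b by move: hb a2; clearbody b; clear; case: b => [|//]; rewrite expn0; lia.
have bR : (0 < b%:R :> R)%R by rewrite ltr0n.
have r2s0 x : rmem s2 x = rmem s0 x by rewrite r2 ?r1.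
have hw : rmem s3 10 0 = w by rewrite /= /upd /= !r2s0 eDl er.
apply: run_post.
  apply: (@fill_gpow_spec rho _ n) => //.
  - by rewrite /= i2 // i1.
  - by rewrite /= /upd /= !r2s0 er.
move=> s4 [i4 r4] hg; exists a, b, w; split=> //.
split=> //.
- by split; [rewrite /w divfK // gt_eqF // mulr_gt0|rewrite /w divr_gt0 ?mulr_gt0].
- by rewrite r4.
- by rewrite r4 //= /upd /= !r2s0 eDl er.
- by rewrite r4 //= /upd /= !r2s0 er.
Qed.

Lemma eq_index n u v u' v' : v < n -> v' < n ->
  (u * n + v == u' * n + v') = (u == u') && (v == v').
Proof.
move=> hv hv'; apply/eqP/andP => [e|[/eqP -> /eqP ->] //].
have n0 : 0 < n by exact: leq_ltn_trans hv.
have := congr1 (divn^~ n) e; rewrite !divnMDl // !divn_small // !addn0 => eu.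
by move: e; rewrite eu => /addnI ->.
Qed.

Definition dirs (d : nat) (x : nat -> nat -> R) (e p : nat) : R :=
  if e < d then x e p else (- x (e - d)%N p)%R.

Lemma fill_dirs_spec (n d : nat) (x : nat -> nat -> R) s0 X :
  imem s0 0 0 = n -> imem s0 0 1 = d ->
  (forall i p, i < d -> p < n -> rmem s0 0 (p * d + i) = x i p) ->
  0 < n -> 0 < d -> n * d <= X ->
  run fill_dirs s0 (1000 * X)
    (fun s => forall e p, e < 2 * d -> p < n ->
      rmem s 14 (e * n + p) = dirs d x e p).
Proof.
move=> en ed ex n0 d0 hX.
have X0 : 0 < X by apply: leq_trans hX; rewrite muln_gt0 n0.
cbv beta zeta delta [fill_dirs]; set body := (X in For 11 eN X).
pose ok (i p i' p' : nat) := i' < i \/ (i' = i /\ p' < p).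
pose J (i p : nat) s := forall i' p', ok i p i' p' -> i' < d -> p' < n ->
   rmem s 14 (i' * n + p') = x i' p' /\
   rmem s 14 ((d + i') * n + p') = (- x i' p')%R.
apply: (@run_le _ _ (forcost eD d (forcost eN n (cost body)))); last first.
  have h1 := @forcost_le eN n (cost body) n (leqnn _) n0.
  apply: leq_trans (_ : ((cost body + (icost eN).*2 + 22) + ((icost eD).*2 + 22)) * X <= _); last first.
    by rewrite leq_mul2r orbT.
  have h2 := @forcost_le eD d (forcost eN n (cost body)) d (leqnn _) d0.
  apply: leq_trans h2 _; apply: leq_trans (leq_mul (leqnn _) hX).
  by rewrite mulnA leq_mul2r; apply/orP; right; nia.
apply: (@run_post _ _ _ _ (fun s => J d 0 s)); last first.
  move=> s _ hJ e p he hp; rewrite /dirs; case: ltnP => hed.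
    by have [|//] := hJ e p _ hed hp; left.
  have [||_] := hJ (e - d) p _ _ hp; [by left; lia|by lia|].
  by rewrite subnKC.
apply: (@run_for _ (fun i s => J i 0 s) 10 eD _ d (forcost eN n (cost body))).
- by move=> s [hf _]; rewrite /= hf.
- by [].
- by move=> i' p' [//|[_ //]].
move=> i s1 ltd f1 hi1 hJ1.
apply: (@run_post _ _ _ _ (fun s => J i n s)); last first.
  move=> s [fi fr] hJ i' p' hok hi' hp'; rewrite /=; apply: hJ => //.
  case: hok => [|[_ //]]; rewrite ltnS leq_eqVlt => /orP[/eqP ->|]; [by right|by left].
apply: (@run_for _ (fun p s => J i p s) 11 eN body n (cost body)).
- by move=> s [hf _]; rewrite /= hf // f1.1.
- by [].
- by move=> i' p' /hJ1 h h1 h2; apply: h.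
move=> p s2 ltn f2 hp2 hJ2; apply: run_step => // i' p' hok hi' hp'.
have hi2 : imem s2 10 0 = i by rewrite f2.1.
have hn2 : imem s2 0 = imem s0 0 by rewrite f2.1 // f1.1.
have hx2 : rmem s2 0 = rmem s0 0 by rewrite f2.2 // f1.2.
rewrite /= hi2 hp2 hn2 en ed /upd /= hx2 ex // sub0r !eq_index //.
have -> : (d + i' == i) = false by lia.
have -> : (i' == d + i) = false by lia.
rewrite eqn_add2l /=.
case: (eqVneq i' i) => [e1|ne1] /=; last first.
  by apply: hJ2 => //; case: hok => [h|[e _]]; [left|move/eqP: ne1].
case: (eqVneq p' p) => [e2|ne2] /=; first by rewrite e1 e2.
by apply: hJ2 => //; case: hok => [h|[e h]]; [left|right; split=> //; lia].
Qed.

End SetupSpec.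

(** * Sorting along every direction *)

Definition dir_key (p : iexp) : rexp := RLoad 14 (IAdd (IMul (ivar 16) eN) p).

(* Merge sort over the heap-shaped tree with leaves n, ..., 2n-1: node v owns
   the run of length LEN v (array 23) starting at STT v (array 22) in the
   buffer, array 21, which only grows. *)
Definition sort_leaves : cmd :=
  For 11 eN (Seq (IStore 22 (IAdd eN (ivar 11)) (ivar 11))
    (Seq (IStore 23 (IAdd eN (ivar 11)) (INum 1))
         (IStore 21 (ivar 11) (ivar 11)))).

(** The order is decreasing in the key, and ties take the left run, as [merge] does for
    [lists_dir]. *)
Definition merge_step : cmd :=
  Seq (If (BAnd (BNot (BILe (ivar 37) (ivar 35)))
                (BNot (BAnd (BNot (BILe (ivar 38) (ivar 36)))
                  (BNot (BRLe (dir_key (ILoad 21 (ivar 36)))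
                              (dir_key (ILoad 21 (ivar 35))))))))
        (Seq (IStore 21 (ivar 34) (ILoad 21 (ivar 35)))
             (iset 35 (IAdd (ivar 35) (INum 1))))
        (Seq (IStore 21 (ivar 34) (ILoad 21 (ivar 36)))
             (iset 36 (IAdd (ivar 36) (INum 1)))))
    (iset 34 (IAdd (ivar 34) (INum 1))).

Definition node_bounds (x y : nat) (v : iexp) : cmd :=
  Seq (iset x (ILoad 22 v)) (iset y (IAdd (ivar x) (ILoad 23 v))).

Definition lchild := IMul (INum 2) (ivar 33).
Definition rchild := IAdd (IMul (INum 2) (ivar 33)) (INum 1).

Definition new_node : cmd :=
  Seq (IStore 22 (ivar 33) (ivar 34))
      (IStore 23 (ivar 33) (IAdd (ILoad 23 lchild) (ILoad 23 rchild))).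

Definition merge_node : cmd :=
  Seq (iset 33 (ISub (ivar 33) (INum 1)))
  (Seq (node_bounds 35 37 lchild)
  (Seq (node_bounds 36 38 rchild)
  (Seq new_node (For 12 (ILoad 23 (ivar 33)) merge_step)))).

Definition merge_node_cost (N : nat) : nat :=
  (cost (iset 33 (ISub (ivar 33) (INum 1))) +
  (cost (node_bounds 35 37 lchild) + (cost (node_bounds 36 38 rchild) +
  (cost new_node + forcost (ILoad 23 (ivar 33)) N (cost merge_step)).+1).+1).+1).+1.

Definition sort_copy : cmd :=
  For 11 eN (IStore 20 (IAdd (IMul (ivar 16) eN) (ivar 11))
    (ILoad 21 (IAdd (ILoad 22 (INum 1)) (ivar 11)))).

Definition sort_dir : cmd :=
  Seq sort_leaves (Seq (iset 34 eN) (Seq (iset 33 eN)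
    (Seq (While (BILe (INum 2) (ivar 33)) merge_node) sort_copy))).

Section SortSpec.
Context {R : realType}.
Implicit Types s : state R.
Local Open Scope nat_scope.

Definition seg (M : nat -> nat) (i k : nat) : seq nat := map M (iota i (k - i)).

Lemma seg_nil M i : seg M i i = [::].
Proof. by rewrite /seg subnn. Qed.

Lemma seg_cons M i k : i < k -> seg M i k = M i :: seg M i.+1 k.
Proof. by move=> ik; rewrite /seg -[k - i]prednK ?subn_gt0 // -subnS. Qed.

Definition lists_dir (n e : nat) s (p p' : nat) : bool :=
  (rmem s 14 (e * n + p') <= rmem s 14 (e * n + p))%R.

Lemma merge_nilr (T : Type) (leT : rel T) l : merge leT l [::] = l.
Proof. by case: l. Qed.

Lemma merge_loop_spec (n e pa pae pb pbe top N : nat) s0 :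
  let M := imem s0 21 in
  imem s0 0 0 = n -> imem s0 16 0 = e ->
  imem s0 35 0 = pa -> imem s0 37 0 = pae -> imem s0 36 0 = pb ->
  imem s0 38 0 = pbe -> imem s0 34 0 = top ->
  imem s0 23 (imem s0 33 0) = N ->
  pa <= pae <= top -> pb <= pbe <= top -> N = (pae - pa) + (pbe - pb) ->
  run (For 12 (ILoad 23 (ivar 33)) merge_step) s0
    (forcost (ILoad 23 (ivar 33)) N (cost merge_step))
    (fun s => [/\ imem s 34 0 = top + N,
       forall i, i < top -> imem s 21 i = M i &
       seg (imem s 21) top (top + N) =
         merge (lists_dir n e s0) (seg M pa pae) (seg M pb pbe)]).
Proof.
move=> M en ee ea eae eb ebe et eN' ha hb hN.
set leT := lists_dir n e s0.
(* What has been written, followed by the merge of what remains of the two runs, is always the merge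
   of the original runs. *)
pose I k s := exists a b, [/\ [/\ imem s 35 0 = a, imem s 36 0 = b &
    imem s 34 0 = top + k], pa <= a <= pae, pb <= b <= pbe,
    k = (a - pa) + (b - pb) /\ (forall i, i < top -> imem s 21 i = M i) &
    seg (imem s 21) top (top + k) ++ merge leT (seg M a pae) (seg M b pbe) =
    merge leT (seg M pa pae) (seg M pb pbe)].
apply: (@run_post _ _ _ _ (I N)); last first.
  move=> s _ [a [b [[_ _ h3] ha' hb' [hk hM] hm]]]; split=> //.
  have ea' : a = pae by lia.
  have eb' : b = pbe by lia.
  by rewrite -hm ea' eb' !seg_nil cats0.
apply: (@run_for _ I 12 _ merge_step N (cost merge_step)).
- by move=> s [hf _]; rewrite /= !hf.
- by [].
- exists pa, pb; rewrite addn0 seg_nil; split=> //; first by lia.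
    by lia.
  by split=> //; lia.
move=> k s ltN [f1 f2] hk [a [b [[h1 h2 h3] ha' hb' [ek hM] hm]]].
apply: run_step => //.
have hkey p q : (rmem s 14 (imem s 16 0 * imem s 0 0 + p) <=
    rmem s 14 (imem s 16 0 * imem s 0 0 + q))%R = leT q p.
  by rewrite f2 // !f1 // en ee.
have fa : a < pae -> imem s 21 a = M a by move=> ?; apply: hM; lia.
have fb : b < pbe -> imem s 21 b = M b by move=> ?; apply: hM; lia.
have seg_upd x : seg (fun j => if (j == top + k) then x else imem s 21 j)
    top (top + k.+1) = seg (imem s 21) top (top + k) ++ [:: x].
  rewrite /seg (_ : top + k.+1 - top = k + 1) ?addKn ?addn1 // -[k.+1]addn1 iotaD map_cat /= eqxx; congr (_ ++ _).
  apply/eq_in_map => j; rewrite mem_iota => /andP[_ lt].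
  by rewrite (_ : (j == top + k) = false) //; lia.
rewrite /= h1 h2 h3 (f1 37) // (f1 38) // eae ebe hkey.
case: ifP => hc.
  have lta : a < pae by move: hc; case: ltnP; lia.
  exists a.+1, b; rewrite /= /upd /= h3; split=> //.
  - by rewrite h1 addn1 addn1 addnS.
  - by lia.
  - split; first by lia.
    by move=> i lti; rewrite (_ : (i == top + k) = false) ?hM //; lia.
  rewrite seg_upd -catA /= fa // -hm (seg_cons M lta).
  congr (_ ++ _); case: (ltnP b pbe) => hbe; last first.
    by rewrite (_ : b = pbe) ?seg_nil ?merge_nilr //; lia.
  move: hc; rewrite (seg_cons M hbe) -ltnNge lta (leqNgt pbe) hbe /= negbK.
  by rewrite fa // fb // => ->.
have ltb : b < pbe.
  case: (ltnP a pae) => hae; last by lia.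
  by move: hc; rewrite -ltnNge hae /= (leqNgt pbe); case: (ltnP b pbe).
exists a, b.+1; rewrite /= /upd /= h3; split=> //.
- by rewrite h2 addn1 addn1 addnS.
- by lia.
- split; first by lia.
  by move=> i lti; rewrite (_ : (i == top + k) = false) ?hM //; lia.
rewrite seg_upd -catA /= fb // -hm (seg_cons M ltb).
congr (_ ++ _); case: (ltnP a pae) => hae; last first.
  by rewrite (_ : a = pae) ?seg_nil //; lia.
move: hc; rewrite (seg_cons M hae) -ltnNge hae (leqNgt pbe) ltb /= negbK.
by rewrite fa // fb // => ->.
Qed.

Definition node s (v : nat) : seq nat :=
  seg (imem s 21) (imem s 22 v) (imem s 22 v + imem s 23 v).

Lemma size_node s v : size (node s v) = imem s 23 v.
Proof. by rewrite /node /seg size_map size_iota addKn. Qed.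

(* g.2 is the number of element moves still to be made. *)
Definition merge_inv (n : nat) (leT : rel nat) (g : nat * nat) s : Prop :=
  [/\ imem s 33 0 = g.1, 0 < g.1 <= n,
     forall v, g.1 <= v < 2 * n ->
       imem s 22 v + imem s 23 v <= imem s 34 0 /\ sorted leT (node s v),
     perm_eq (flatten [seq node s v | v <- iota g.1 g.1]) (iota 0 n) &
     g.2 = \sum_(v <- iota g.1 g.1) imem s 23 v * trunc_log 2 v].

Lemma sorted_dir_total n e s : total (lists_dir n e s).
Proof. by move=> p p'; rewrite /lists_dir orbC le_total. Qed.

(** The nodes [v, ..., 2v - 1] carry runs that together list all points. The last two are the
    children of [v - 1], whose merged run replaces theirs. An element in node [v] has
    [trunc_log 2 v] ancestors left to pass, so merging [N] elements lowers [g.2] by [N]. *)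
Lemma merge_node_spec (n e : nat) g s :
  imem s 0 0 = n -> imem s 16 0 = e ->
  merge_inv n (lists_dir n e s) g s -> 1 < g.1 ->
  exists N, run merge_node s (merge_node_cost N)
    (fun s' => merge_inv n (lists_dir n e s) (g.1.-1, g.2 - N) s' /\ N <= g.2).
Proof.
case: g => v P /= en ee [/= hv vn hrun hperm hP] v1.
set leT := lists_dir n e s in hrun *.
pose t := v.-1; pose N := imem s 23 (2 * t) + imem s 23 (2 * t + 1).
have ev : v = t.+1 by rewrite /t prednK // ltnW.
pose top := imem s 34 0.
have h2t : v <= 2 * t < 2 * n by lia.
have h2t1 : v <= 2 * t + 1 < 2 * n by lia.
have [ha srta] := hrun _ h2t; have [hb srtb] := hrun _ h2t1.
exists N; apply/run_seq/run_post.
  by apply: (run_step (Q := fun s' => imem s' 33 0 = t)) => //=; rewrite hv /upd /= subn1.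
move=> sa [fa ra] h33.
apply/run_seq/run_post.
  apply: (run_step (Q := fun s' => imem s' 35 0 = imem s 22 (2 * t) /\
     imem s' 37 0 = imem s 22 (2 * t) + imem s 23 (2 * t))) => //=.
  by rewrite /upd /= h33 !fa.
move=> sb [fb rb] [i35b i37b].
apply/run_seq/run_post.
  apply: (run_step (Q := fun s' => imem s' 36 0 = imem s 22 (2 * t + 1) /\
     imem s' 38 0 = imem s 22 (2 * t + 1) + imem s 23 (2 * t + 1))) => //=.
  by rewrite /upd /= !(fb 33) // h33 !fb // !fa.
move=> sc [fc rc] [i36c i38c].
have nt2 : (2 * t == t) = false by lia.
have nt3 : (2 * t + 1 == t) = false by lia.
apply/run_seq/run_post.
  apply: (run_step (Q := fun s' => forall x,
     imem s' 23 x = (if x == t then N else imem s 23 x) /\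
     imem s' 22 x = if x == t then top else imem s 22 x)) => //= x.
  rewrite /upd /= !(fc 33) // !(fb 33) // h33 !(fc 23) // !(fb 23) // !fa //.
  by rewrite !(fc 22) // !(fb 22) // !(fc 34) // !(fb 34) // !fa.
move=> s1 [fd rd] hs1.
have i22 x : imem s1 22 x = if x == t then top else imem s 22 x by case: (hs1 x).
have i23 x : imem s1 23 x = if x == t then N else imem s 23 x by case: (hs1 x).
have i33 : imem s1 33 0 = t by rewrite fd // fc // fb.
have i34 : imem s1 34 = imem s 34 by rewrite fd // fc // fb // fa.
have i21 : imem s1 21 = imem s 21 by rewrite fd // fc // fb // fa.
have i35 : imem s1 35 0 = imem s 22 (2 * t) by rewrite fd // fc.
have i36 : imem s1 36 0 = imem s 22 (2 * t + 1) by rewrite fd.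
have i37 : imem s1 37 0 = imem s 22 (2 * t) + imem s 23 (2 * t) by rewrite fd // fc.
have i38 : imem s1 38 0 = imem s 22 (2 * t + 1) + imem s 23 (2 * t + 1) by rewrite fd.
have i0 : imem s1 0 = imem s 0 by rewrite fd // fc // fb // fa.
have i16 : imem s1 16 = imem s 16 by rewrite fd // fc // fb // fa.
have r14 : rmem s1 14 = rmem s 14 by rewrite rd // rc // rb // ra.
apply: run_post.
  apply: (@merge_loop_spec n e _ _ _ _ top N s1) => //.
  - by rewrite i0.
  - by rewrite i16.
  - by rewrite i34.
  - by rewrite i33 i23 eqxx.
  - by rewrite i35 i37 leq_addr.
  - by rewrite i36 i38 leq_addr.
  - by rewrite i35 i36 i37 i38 !addKn.
move=> s2 [f2 _] [j34 j21 jmerge].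
rewrite i35 i36 i37 i38 i21 -!/(node s _) in jmerge.
have jlt : lists_dir n e s1 = leT by rewrite /leT /lists_dir r14.
rewrite jlt in jmerge.
have j22 x : imem s2 22 x = if x == t then top else imem s 22 x by rewrite f2 // i22.
have j23 x : imem s2 23 x = if x == t then N else imem s 23 x by rewrite f2 // i23.
have nodet : node s2 t = merge leT (node s (2 * t)) (node s (2 * t + 1)).
  by rewrite -jmerge /node j22 j23 eqxx.
have nodex x : v <= x < 2 * n -> node s2 x = node s x.
  move=> hx; have [hx1 _] := hrun x hx.
  have nx : (x == t) = false by lia.
  rewrite /node j22 j23 nx /seg; apply/eq_in_map => k.
  rewrite mem_iota addKn => /andP[_ hk]; rewrite j21 ?i21 //.
  exact: leq_trans hk _.
have hiota : iota t t = t :: iota v t.-1.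
  by rewrite ev -{2}[t]prednK //; lia.
have hiota' : iota v v = iota v t.-1 ++ [:: 2 * t; 2 * t + 1].
  have -> : iota v v = iota v (t.-1 + 2) by congr iota; lia.
  rewrite iotaD; congr (_ ++ _) => /=.
  by congr [:: _; _]; lia.
have mid x : x \in iota v t.-1 -> v <= x < 2 * n.
  by rewrite mem_iota; lia.
have eP : P = N + \sum_(x <- iota t t) imem s2 23 x * trunc_log 2 x.
  rewrite hP hiota' hiota big_cat big_cons /= !big_cons big_nil j23 eqxx.
  have -> : trunc_log 2 (2 * t) = (trunc_log 2 t).+1.
    by rewrite mul2n trunc_log2_double //; lia.
  have -> : trunc_log 2 (2 * t + 1) = (trunc_log 2 t).+1.
    by rewrite trunc_log2S; [congr (trunc_log _ _).+1; lia|lia].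
  set S := bigop.body _ _ _.
  have -> : \sum_(x <- iota v t.-1) imem s2 23 x * trunc_log 2 x = S.
    apply: eq_big_seq => x /mid /andP[hx _].
    by rewrite j23 (_ : (x == t) = false) // gtn_eqF // -ev.
  by rewrite addn0 -mulnDl mulnS -/N addnC addnA.
split; last by rewrite eP leq_addr.
split=> /=.
- by rewrite f2 // i33.
- lia.
- move=> x hx; rewrite j34 j22 j23; case: (eqVneq x t) => [->|nx].
    split=> //; rewrite nodet; apply: merge_sorted => //.
    exact: sorted_dir_total.
  have hx' : v <= x < 2 * n by lia.
  have [h1 h2] := hrun x hx'; split; last by rewrite nodex.
  by apply: leq_trans h1 (leq_addr _ _).
- apply: perm_trans hperm; rewrite hiota hiota' map_cat flatten_cat /= cats0.
  rewrite nodet perm_sym perm_catC.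
  have -> : [seq node s2 x | x <- iota v t.-1] = [seq node s x | x <- iota v t.-1].
    by apply/eq_in_map => x /mid; apply: nodex.
  by rewrite perm_cat2r perm_sym perm_merge.
- by rewrite eP addKn.
Qed.

Definition order_dir (n e : nat) s : seq nat :=
  mkseq (fun r => imem s 20 (e * n + r)) n.

(** No leaf lies deeper than [trunc_log 2 n + 1], which bounds the moves per point. The last clause
    protects the orders of earlier directions, stored below [e * n]. *)
Lemma sort_dir_spec (n e : nat) s0 :
  imem s0 0 0 = n -> imem s0 16 0 = e -> 0 < n ->
  run sort_dir s0 (1000 * (n * (trunc_log 2 n).+1))
    (fun s => [/\ perm_eq (order_dir n e s) (iota 0 n),
       sorted (lists_dir n e s0) (order_dir n e s) &
       forall i, i < e * n -> imem s 20 i = imem s0 20 i]).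
Proof.
move=> en ee n0; set leT := lists_dir n e s0.
set X := n * (trunc_log 2 n).+1.
have nX : n <= X by rewrite leq_pmulr.
have X0 : 0 < X by exact: leq_trans nX.
pose K := (bcost (BILe (INum 2) (ivar 33)) + merge_node_cost 0).+1.
pose L := cost merge_step + icost (ILoad 23 (ivar 33)) + 12.
pose V (g : nat * nat) := g.1 * K + g.2 * L.
pose leaves := Seq (IStore 22 (IAdd eN (ivar 11)) (ivar 11))
    (Seq (IStore 23 (IAdd eN (ivar 11)) (INum 1))
         (IStore 21 (ivar 11) (ivar 11))).
pose copyb := IStore 20 (IAdd (IMul (ivar 16) eN) (ivar 11))
    (ILoad 21 (IAdd (ILoad 22 (INum 1)) (ivar 11))).
apply: (@run_le _ _ _ (forcost eN n (cost leaves) + (cost (iset 34 eN) +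
  (cost (iset 33 eN) + ((V (n, X) + (bcost (BILe (INum 2) (ivar 33))).+1) +
   forcost eN n (cost copyb)).+1).+1).+1).+1); last first.
  have h1 := forcost_le eN (cost leaves) nX X0.
  have h2 := forcost_le eN (cost copyb) nX X0.
  have h3 : V (n, X) <= (K + L) * X.
    by rewrite /V (mulnC _ K) (mulnC _ L) mulnDl leq_add2r leq_mul2l nX orbT.
  move: h1 h2 h3; rewrite /K /L /leaves /copyb /merge_node_cost /forcost /=; lia.
apply/run_seq/run_post.
  apply: (@run_for _ (fun j s => forall i, i < j -> [/\ imem s 22 (n + i) = i,
    imem s 23 (n + i) = 1 & imem s 21 i = i]) 11 eN leaves n (cost leaves)) => //.
    by move=> s [hf _]; rewrite /= hf.
  move=> j s ltj [f _] hj hI; apply: run_step => // i; rewrite ltnS leq_eqVlt.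
  rewrite /= /upd /= hj f // en => /orP[/eqP ->|lt]; first by rewrite !eqxx.
  by rewrite eqn_add2l ltn_eqF //; apply: hI.
move=> s1 [f1 g1] hleaf.
apply/run_seq/run_step => //; set s2 := step _ s1.
apply/run_seq/run_step => //; set s3 := step _ s2.
have n3 : imem s3 0 0 = n by rewrite /= /upd /= f1.
have e3 : imem s3 16 0 = e by rewrite /= /upd /= f1.
have lt3 : lists_dir n e s3 = leT by rewrite /leT /lists_dir /= g1.
have i33 : imem s3 33 0 = n by exact: n3.
have i34 : imem s3 34 0 = n by exact: n3.
have i20 : imem s3 20 = imem s0 20 by rewrite -(f1 20).
have [i21 [i22 i23]] : imem s3 21 = imem s1 21 /\ imem s3 22 = imem s1 22 /\
  imem s3 23 = imem s1 23 by [].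
clearbody s3.
pose P0 := \sum_(v <- iota n n) imem s3 23 v * trunc_log 2 v.
have leafn x : n <= x < 2 * n -> [/\ imem s3 22 x = x - n, imem s3 23 x = 1 &
    imem s3 21 (x - n) = x - n].
  move=> hx; have [|h1 h2 h3] := hleaf (x - n); first by lia.
  by rewrite i21 i22 i23; rewrite subnKC in h1 h2; [split|lia].
have inv0 : merge_inv n leT (n, P0) s3.
  split=> //=.
  - by rewrite n0 leqnn.
  - move=> v hv; have [h1 h2 h3] := leafn v hv.
    rewrite i34; split; first by rewrite h1 h2; lia.
    by rewrite /node h2 /seg addKn.
  - have -> : [seq node s3 v | v <- iota n n] = [seq [:: v - n] | v <- iota n n].
      apply/eq_in_map => v; rewrite mem_iota => hv.
      have [|h1 h2 h3] := leafn v; first by lia.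
      by rewrite /node h1 h2 /seg addKn /= h3.
    rewrite -[X in iota X n](addn0 n) iotaDl -map_comp.
    rewrite (_ : [seq _ | i <- _] = [seq [:: i] | i <- iota 0 n]).
      by rewrite flatten_map1 map_id.
    by apply: eq_map => i /=; rewrite addKn.
have P0X : P0 <= X.
  rewrite /P0 (eq_big_seq (fun v => trunc_log 2 v)) => [|v]; last first.
    rewrite mem_iota => hv; have [|_ h2 _] := leafn v; first by lia.
    by rewrite h2 mul1n.
  apply: leq_trans (_ : \sum_(v <- iota n n) (trunc_log 2 n).+1 <= _); last first.
    by rewrite big_const_seq count_predT size_iota iter_addn_0 mulnC.
  rewrite [leqLHS]big_seq [leqRHS]big_seq; apply: leq_sum => v.
  rewrite mem_iota => hv; rewrite -trunc_log2_double //.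
  by apply: leq_trunc_log; lia.
apply/run_seq.
apply: (@run_le _ _ _ (V (n, P0) + (bcost (BILe (INum 2) (ivar 33))).+1)); last first.
  by rewrite leq_add2r leq_add2l leq_mul2r P0X orbT.
apply: run_post.
  apply: (@run_while _ _ (fun g s => [/\ merge_inv n leT g s,
      imem s 0 0 = n, imem s 16 0 = e & lists_dir n e s = leT]) V) => //.
  move=> g s [hI hn he hl] /= hb.
  have g1' : 1 < g.1 by case: hI => <-.
  rewrite -hl in hI.
  have [N hrun] := merge_node_spec hn he hI g1'.
  exists (merge_node_cost N).
  apply: run_post hrun _ => s' [f g'] [hI' hN].
  exists (g.1.-1, g.2 - N); split.
    by rewrite hl in hI'; split; rewrite ?f // -hl /lists_dir g'.
  by rewrite /V /K /L /merge_node_cost /forcost /=; nia.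
move=> s4 [f4 g4] [hb [g [hI n4 e4 lt4]]].
case: hI hb => /= -> g0 hrun hperm _ hb.
have e1 : g.1 = 1 by lia.
rewrite e1 /= cats0 in hperm.
have sz : imem s4 23 1 = n by rewrite -size_node (perm_size hperm) size_iota.
have [|_ hsort] := hrun 1; first by lia.
apply: run_post.
  apply: (@run_for _ (fun j s =>
     (forall i, i < j -> imem s 20 (e * n + i) = imem s4 21 (imem s4 22 1 + i)) /\
     (forall i, i < e * n -> imem s 20 i = imem s4 20 i)) 11 eN copyb n (cost copyb)) => //.
    by move=> s [hf _]; rewrite /= hf.
  move=> j s ltj [f _] hj [hI1 hI2]; apply: run_step => //.
  rewrite /= /upd /= hj (f 16) // (f 0) // (f 21) // (f 22) // n4 e4; split=> i hi; last first.
    by rewrite (_ : (i == e * n + j) = false) ?hI2 //; lia.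
  rewrite eqn_add2l; move: hi; rewrite ltnS leq_eqVlt => /orP[/eqP ->|lt].
    by rewrite eqxx.
  by rewrite ltn_eqF ?hI1.
move=> s5 _ [h1 h2].
have eord : order_dir n e s5 = node s4 1.
  rewrite /node /seg addKn sz /order_dir /mkseq.
  have -> : iota (imem s4 22 1) n = map (addn (imem s4 22 1)) (iota 0 n).
    by rewrite -iotaDl addn0.
  rewrite -map_comp; apply/eq_in_map => i.
  by rewrite mem_iota => hi; rewrite h1.
by rewrite eord; split=> // i hi; rewrite h2 // f4 // i20.
Qed.

Definition sort_all : cmd := For 16 eDD sort_dir.

Lemma sort_all_spec (n d : nat) s0 :
  imem s0 0 0 = n -> imem s0 0 1 = d -> 0 < n -> 0 < d ->
  run sort_all s0 (3000 * (n * d * (trunc_log 2 n).+1))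
    (fun s => forall e, e < 2 * d -> perm_eq (order_dir n e s) (iota 0 n) /\
       sorted (lists_dir n e s0) (order_dir n e s)).
Proof.
move=> en ed n0 d0; set X := n * (trunc_log 2 n).+1.
have X0 : 0 < X by rewrite muln_gt0 n0.
pose T := 1000 * X.
apply: (@run_le _ _ _ (forcost eDD (2 * d) T)); last first.
  apply: leq_trans (forcost_le _ _ (leqnn _) _) _; first by rewrite muln_gt0.
  rewrite /T /= (_ : n * d * _ = X * d); last by rewrite /X; nia.
  by nia.
apply: (@run_for _ (fun k s => forall e, e < k ->
   perm_eq (order_dir n e s) (iota 0 n) /\
   sorted (lists_dir n e s0) (order_dir n e s))) => //.
  by move=> s [hf _]; rewrite /= !hf // ed.
move=> e s lte [f g] he hI.
apply: run_post.
  apply: (@sort_dir_spec n e) => //; rewrite f //.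
move=> s' [f' g'] [h1 h2 h3] k; rewrite ltnS leq_eqVlt => /orP[/eqP ->|lt].
  by split=> //; move: h2; rewrite /lists_dir g.
have -> : order_dir n k (setx s' 16 e.+1) = order_dir n k s.
  rewrite /order_dir /mkseq; apply/eq_in_map => r; rewrite mem_iota => hr.
  by rewrite /setx /= /upd /= h3 //; nia.
exact: hI.
Qed.

End SortSpec.

(** * Finding a separator in every cell *)

(* Natural arrays: 24 uncovered flag, 25 cell of a point (n if dropped),
   26 size of a cell; 27, 28 and real 17: cut flag, direction, threshold of a
   cell; 29 points seen, 30 phase, 31 count B, real 16 threshold of the walk;
   real 15: quantile of cell q in direction e at q * 2d + e. *)

Definition dd_at (a : nat) (q e : iexp) : rexp := RLoad a (IAdd (IMul q eDD) e).
Definition rcell (a : nat) : rexp := RLoad a (ivar 42).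
Definition icell (a : nat) : iexp := ILoad a (ivar 42).
Definition threshold : rexp := RSub (rcell 16) (rvar 10).
Definition at_most_half : bexp := BILe (IMul (INum 2) (icell 29)) (icell 26).

Definition scan_load : cmd :=
  Seq (iset 41 (ILoad 20 (IAdd (IMul (ivar 16) eN) (ivar 11))))
  (Seq (iset 42 (ILoad 25 (ivar 41)))
       (rset 18 (dir_key (ivar 41)))).

(** One retry per point is enough: after a failed test the new [B] equals C, so if the point also
    lies below the next slab, that slab contains no point of the cell and passes the test. *)
Definition scan_retry : cmd :=
  If (BAnd at_most_half
       (BAnd (BNot (BRLe (ROfNat (icell 29)) (RMul (ROfNat (icell 31)) (rvar 11))))
             (BNot (BRLe (RMul (RMul (ROfNat (icell 29)) (RLoad 13 (icell 31)))
                               (rvar 11))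
                         (RMul (ROfNat (icell 31)) (RLoad 13 (icell 26)))))))
     (Seq (RStore 16 (ivar 42) threshold) (IStore 31 (ivar 42) (icell 29)))
     Skip.

Definition scan_close : cmd :=
  If (BRLe (rvar 18) threshold)
     (Seq (If at_most_half
             (Seq (IStore 27 (ivar 42) (INum 1))
             (Seq (IStore 28 (ivar 42) (ivar 16))
                  (RStore 17 (ivar 42) (rcell 16)))) Skip)
          (IStore 30 (ivar 42) (INum 2)))
     Skip.

(** The walk waits until the scan of the cell falls to [THR - w]; only then is C known. *)
Definition scan_event : cmd :=
  If (BAnd (BAnd (BILe (INum 1) (icell 30)) (BILe (icell 30) (INum 1)))
           (BRLe (rvar 18) threshold))
     (Seq scan_retry scan_close) Skip.

Definition scan_count : cmd :=
  Seq (IStore 29 (ivar 42) (IAdd (icell 29) (INum 1)))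
      (If (BAnd (BILe (icell 30) (INum 0))
                (BILe (icell 26) (IMul (IMul (INum 4) eD) (icell 29))))
          (Seq (IStore 30 (ivar 42) (INum 1))
          (Seq (RStore 16 (ivar 42) (rvar 18))
          (Seq (IStore 31 (ivar 42) (icell 29))
               (RStore 15 (IAdd (IMul (ivar 42) eDD) (ivar 16)) (rvar 18)))))
          Skip).

Definition scan_point : cmd :=
  Seq scan_load
    (If (BILe eN (ivar 42)) Skip (Seq scan_event scan_count)).

Definition scan_dir : cmd :=
  Seq (For 11 (ivar 18) (Seq (IStore 29 (ivar 11) (INum 0))
                             (IStore 30 (ivar 11) (INum 0))))
      (For 11 eN scan_point).

Definition find_cuts : cmd :=
  Seq (For 11 (ivar 18) (IStore 27 (ivar 11) (INum 0)))
      (For 16 eDD scan_dir).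

Section FindCuts.
Context {R : realType}.
Variables (rho w : R) (n d a b : nat) (y : nat -> nat -> R).
Variable (ord : nat -> seq nat).
Implicit Types s : state R.
Local Open Scope nat_scope.

Hypothesis rho_gt0 : (0 < rho)%R.
Hypothesis rho_lt1 : (rho < 1)%R.
Hypothesis w_gt0 : (0 < w)%R.
Hypothesis n_gt0 : 0 < n.
Hypothesis d_gt0 : 0 < d.
Hypothesis le_4d : 4 * d <= 2 ^ a.
Hypothesis le_a : a <= 2 ^ b.
Hypothesis ord_perm : forall e, e < 2 * d -> perm_eq (ord e) (iota 0 n).
Hypothesis ord_sorted : forall e, e < 2 * d ->
  sorted (fun p p' => y e p' <= y e p)%R (ord e).

(** The data that no round modifies: parameters, table of powers, coordinates and sorted orders. *)
Record env s : Prop := Env {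
  env_n : imem s 0 0 = n;
  env_d : imem s 0 1 = d;
  env_w : rmem s 10 0 = w;
  env_w3 : rmem s 12 0 = (w / 3)%R;
  env_u : rmem s 11 0 = growth rho;
  env_g : forall k, 0 < k <= n -> rmem s 13 k = gpow rho k;
  env_y : forall e p, e < 2 * d -> p < n -> rmem s 14 (e * n + p) = y e p;
  env_o : forall e r, e < 2 * d -> r < n ->
    imem s 20 (e * n + r) = nth 0 (ord e) r }.

(** Decided by computation on the text of the command, so that [env] is carried through a program
    without inspecting its runs. *)
Definition keeps_env (c : cmd) : bool :=
  all (fun x => x \notin imods c) [:: 0; 20] &&
  all (fun x => x \notin rmods c) [:: 10; 11; 12; 13; 14].

Lemma env_frame c s s' : keeps_env c -> env s -> frame c s s' -> env s'.
Proof.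
move=> /andP[/and3P[i0 i20 _] /and5P[r10 r11 r12 r13 /andP[r14 _]]].
move=> [h1 h2 h3 h4 h5 h6 h7 h8] [fi fr].
by split; rewrite ?(fi 0) ?(fr 10) ?(fr 11) ?(fr 12) // => *;
  rewrite ?(fi 20) ?(fr 13) ?(fr 14) //; auto.
Qed.

Variables (cell : nat -> nat) (Q : nat).
Hypothesis leQ : Q <= n.
Hypothesis cellQ : forall p, p < n -> cell p < Q \/ cell p = n.

Definition config s : Prop :=
  [/\ env s, imem s 18 0 = Q, forall p, p < n -> imem s 25 p = cell p &
      forall q, q < Q -> imem s 26 q = csize n cell q].

Definition keeps_config (c : cmd) : bool :=
  keeps_env c && all (fun x => x \notin imods c) [:: 18; 25; 26].

Lemma config_frame c s s' : keeps_config c -> config s -> frame c s s' ->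
  config s'.
Proof.
move=> /andP[hk /and4P[h18 h25 h26 _]] [he hq hc hs] hf.
split; rewrite ?(hf.1 18) ?(hf.1 25) ?(hf.1 26) //.
exact: env_frame hk he hf.
Qed.

Definition quant s (q e : nat) : R := rmem s 15 (q * (2 * d) + e).

Definition scan_at e r q s : Prop :=
  scan_inv rho w n d b y cell e (ord e) r q (imem s 29 q) (imem s 30 q)
    (imem s 31 q) (imem s 27 q) (imem s 28 q) (rmem s 16 q) (rmem s 17 q)
    (quant s q).

Definition cuts_ok s : Prop := forall q, q < Q -> imem s 27 q != 0 ->
  good_cut rho w n d y cell q (imem s 28 q) (rmem s 17 q).

(** Empty cells are never visited and cannot satisfy phase 0 of [scan_inv]; for them only the
    correctness of the cut flag is kept. *)
Definition scan_all e r s : Prop :=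
  cuts_ok s /\ forall q, q < Q -> 0 < csize n cell q -> scan_at e r q s.

Section Point.
Variables (e r q : nat).
Hypothesis e_lt : e < 2 * d.
Hypothesis r_lt : r < n.
Hypothesis q_lt : q < Q.
Let p0 := nth 0 (ord e) r.
Let v := y e p0.
Hypothesis cell_p0 : cell p0 = q.

Lemma size_ord_dir : size (ord e) = n.
Proof. by rewrite (perm_size (ord_perm e_lt)) size_iota. Qed.

Lemma point_lt : p0 < n.
Proof.
have : p0 \in ord e by rewrite mem_nth ?size_ord_dir.
by rewrite (perm_mem (ord_perm e_lt)) mem_iota.
Qed.

Lemma size_q_gt0 : 0 < csize n cell q.
Proof. by apply/cn_gt0P; exists p0; rewrite ?point_lt // cell_p0. Qed.

Definition at_point s : Prop :=
  [/\ config s, imem s 16 0 = e, imem s 42 0 = q & rmem s 18 0 = v].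

Definition keeps_point (c : cmd) : bool :=
  keeps_config c && all (fun x => x \notin imods c) [:: 16; 42] &&
  (18 \notin rmods c).

Lemma at_point_frame c s s' : keeps_point c -> at_point s -> frame c s s' ->
  at_point s'.
Proof.
move=> /andP[/andP[hk /and3P[h16 h42 _]] h18] [hc he hq hv] hf.
split; rewrite ?(hf.1 16) ?(hf.1 42) ?(hf.2 18) //.
exact: config_frame hk hc hf.
Qed.

Lemma scan_all_at s s' :
  scan_all e r s -> scan_at e r q s' ->
  (forall q', q' != q -> [/\ imem s' 29 q' = imem s 29 q',
     imem s' 30 q' = imem s 30 q', imem s' 31 q' = imem s 31 q',
     imem s' 27 q' = imem s 27 q' & imem s' 28 q' = imem s 28 q'] /\
     [/\ rmem s' 16 q' = rmem s 16 q', rmem s' 17 q' = rmem s 17 q' &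
     forall e', e' < 2 * d -> quant s' q' e' = quant s q' e']) ->
  scan_all e r s'.
Proof.
move=> [h1 h2] h3 h4; split=> q' hq'.
  case: (eqVneq q' q) => [->|ne]; first by case: h3.
  have [[_ _ _ -> ->] [_ -> _]] := h4 q' ne; exact: h1.
case: (eqVneq q' q) => [-> //|ne m0].
have [[e1 e2 e3 e4 e5] [e6 e7 e8]] := h4 q' ne.
rewrite /scan_at e1 e2 e3 e4 e5 e6 e7; apply: scan_inv_quant (h2 q' hq' m0).
by move=> e' le'; apply: e8; exact: leq_ltn_trans e_lt.
Qed.

Let m := csize n cell q.

Lemma scan_retry_spec s :
  at_point s -> scan_all e r s -> imem s 30 q = 1 ->
  run scan_retry s (cost scan_retry) (fun s' =>
    [/\ at_point s', scan_all e r s', imem s' 30 q = 1 &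
      (imem s' 29 q).*2 <= m ->
      good_ratio rho (imem s' 31 q) (imem s' 29 q) m]).
Proof.
move=> hp hs hph.
apply: (@run_post _ _ _ _ (fun s' => [/\ scan_all e r s', imem s' 30 q = 1 &
      (imem s' 29 q).*2 <= m ->
      good_ratio rho (imem s' 31 q) (imem s' 29 q) m])); last first.
  by move=> s' hf [? ? ?]; split=> //; apply: at_point_frame hp hf.
have [[henv hQ hcell hcnt] he hq hv] := hp.
have hat := hs.2 q q_lt size_q_gt0.
have hat1 := hat; rewrite /scan_at hph in hat1.
have [hK _ _ [_ [j [_ [/andP[B0 Bm] _ _] _ hB _]]]] := hat1.
have g1 : rmem s 13 (imem s 31 q) = gpow rho (imem s 31 q).
  by apply: (env_g henv); rewrite B0 (leq_trans Bm) // cn_leq.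
have g2 : rmem s 13 m = gpow rho m.
  by apply: (env_g henv); rewrite size_q_gt0 cn_leq.
apply: run_step => //=; rewrite hq hcnt // -/m g1 g2 (env_u henv) mul2n.
rewrite -negb_or -/(good_ratio rho (imem s 31 q) (imem s 29 q) m).
case: ifP => hc; last first.
  split=> // h2; move: hc; rewrite h2 /= => /negbFE; exact.
case/andP: hc => h2 hg.
have {}hat1 := scan_fail rho_gt0 rho_lt1 w_gt0 hat1 h2 hg.
split; [|by []|].
  apply: (scan_all_at hs).
    by rewrite /scan_at /quant /= /upd /= !eqxx hph (env_w henv).
  by move=> q' /negbTE ne; rewrite /quant /= /upd /= ne.
(* After the failed test [B] has become [K], so the first alternative of [good_ratio] holds. *)
rewrite /= /upd /= eqxx => _; apply/orP; left.
by rewrite ler_peMr // ltW // growth_gt1 //; apply/andP.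
Qed.

Lemma scan_close_spec s :
  at_point s -> scan_all e r s -> imem s 30 q = 1 ->
  ((imem s 29 q).*2 <= m -> good_ratio rho (imem s 31 q) (imem s 29 q) m) ->
  run scan_close s (cost scan_close) (fun s' =>
    [/\ at_point s', scan_all e r s' &
      imem s' 30 q = 1 -> (rmem s' 16 q - w < v)%R]).
Proof.
move=> hp hs hph hg.
apply: (@run_post _ _ _ _ (fun s' => scan_all e r s' /\
    (imem s' 30 q = 1 -> (rmem s' 16 q - w < v)%R))); last first.
  by move=> s' hf [? ?]; split=> //; apply: at_point_frame hp hf.
have [[henv hQ hcell hcnt] he hq hv] := hp.
have hat := hs.2 q q_lt size_q_gt0; rewrite /scan_at hph in hat.
apply: run_step => //=; rewrite hq hcnt // -/m hv (env_w henv) mul2n.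
case: ifP => hle; last by split=> // _; rewrite ltNge hle.
split; last by case: ifP => _; rewrite /= /upd /= hq eqxx.
case: ifP => h2.
  have {}hat := scan_cut rho_gt0 rho_lt1 e_lt (ord_perm e_lt)
    (ord_sorted e_lt) r_lt hat h2 (hg h2) hle.
  apply: (scan_all_at hs).
    by rewrite /scan_at /quant /= /upd /= hq !eqxx he.
  by move=> q' /negbTE ne; rewrite /quant /= /upd /= hq ne.
move/negbT: h2; rewrite -ltnNge => h2.
have {}hat := scan_stop rho_gt0 rho_lt1 d_gt0 le_4d le_a (ord_perm e_lt)
  (ord_sorted e_lt) r_lt hat h2 hle.
apply: (scan_all_at hs).
  by rewrite /scan_at /quant /= /upd /= hq !eqxx.
by move=> q' /negbTE ne; rewrite /quant /= /upd /= hq ne.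
Qed.

Lemma scan_event_spec s :
  at_point s -> scan_all e r s ->
  run scan_event s (cost scan_event) (fun s' =>
    [/\ at_point s', scan_all e r s' &
      imem s' 30 q = 1 -> (rmem s' 16 q - w < v)%R]).
Proof.
move=> hp hs.
have [[henv hQ hcell hcnt] he hq hv] := hp.
have -> : cost scan_event = (bcost (BAnd (BAnd (BILe (INum 1) (icell 30))
   (BILe (icell 30) (INum 1))) (BRLe (rvar 18) threshold)) +
   (cost scan_retry + cost scan_close).+1).+1 by [].
apply: run_if => /=; rewrite hq hv (env_w henv) => hc; last first.
  apply: run_le; first apply: (run_step (c := Skip)) => //=.
    by split=> // h; move: hc; rewrite h /= -ltNge.
  by [].
have hph : imem s 30 q = 1 by move: hc => /andP[/andP[]]; lia.
apply/run_seq/(run_post (scan_retry_spec hp hs hph)).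
by move=> s1 _ [hp1 hs1 hph1 hg1]; apply: scan_close_spec.
Qed.

Lemma scan_all_next s s' :
  scan_all e r s -> scan_at e r.+1 q s' ->
  (forall q', q' != q -> [/\ imem s' 29 q' = imem s 29 q',
     imem s' 30 q' = imem s 30 q', imem s' 31 q' = imem s 31 q',
     imem s' 27 q' = imem s 27 q' & imem s' 28 q' = imem s 28 q'] /\
     [/\ rmem s' 16 q' = rmem s 16 q', rmem s' 17 q' = rmem s 17 q' &
     forall e', e' < 2 * d -> quant s' q' e' = quant s q' e']) ->
  scan_all e r.+1 s'.
Proof.
move=> [h1 h2] h3 h4; split=> q' hq'.
  case: (eqVneq q' q) => [->|ne]; first by case: h3.
  have [[_ _ _ -> ->] [_ -> _]] := h4 q' ne; exact: h1.
case: (eqVneq q' q) => [-> //|ne m0].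
have [[e1 e2 e3 e4 e5] [e6 e7 e8]] := h4 q' ne.
rewrite /scan_at e1 e2 e3 e4 e5 e6 e7.
apply: (scan_other (ord_perm e_lt)) => //.
  by rewrite -/p0 cell_p0 => eq; move: ne; rewrite eq eqxx.
apply: scan_inv_quant (h2 q' hq' m0).
by move=> e' le'; apply: e8; exact: leq_ltn_trans e_lt.
Qed.

Lemma scan_count_spec s :
  at_point s -> scan_all e r s ->
  (imem s 30 q = 1 -> (rmem s 16 q - w < v)%R) ->
  run scan_count s (cost scan_count) (fun s' => scan_all e r.+1 s').
Proof.
move=> hp hs hlt.
have [[henv hQ hcell hcnt] he hq hv] := hp.
have hat := hs.2 q q_lt size_q_gt0.
apply: run_step => //=; rewrite /upd /= hq hv he hcnt // (env_d henv) eqxx addn1.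
case: ifP => [/andP[h0 h4]|hc].
  have e0 : imem s 30 q = 0 by lia.
  rewrite /scan_at e0 in hat.
  apply: (scan_all_next hs).
    rewrite /scan_at /= /upd /= !eqxx /=.
    apply: (scan_first w_gt0 d_gt0 (ord_perm e_lt) (ord_sorted e_lt) r_lt
      cell_p0 hat h4) => //.
      by rewrite /quant /= eqxx.
    move=> e' le'; rewrite /quant /= eqn_add2l.
    by rewrite (ltn_eqF le').
  move=> q' /negbTE ne; rewrite /= /upd /= ne; split=> //; split=> // e' he'.
  by rewrite /quant /= eq_index ?ne.
apply: (scan_all_next hs); last first.
  by move=> q' /negbTE ne; rewrite /quant /= /upd /= ne.
rewrite /scan_at /quant /= /upd /= !eqxx.
apply: (scan_next (ord_perm e_lt)) => //.
by move=> h0; move: hc; rewrite h0 /= => /negbT; rewrite -ltnNge.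
Qed.

End Point.

Lemma scan_point_spec e r s :
  e < 2 * d -> r < n -> config s -> imem s 16 0 = e -> imem s 11 0 = r ->
  scan_all e r s ->
  run scan_point s (cost scan_point) (fun s' => scan_all e r.+1 s').
Proof.
move=> he hr hc ie ir hs; have [henv hQ hcell hcnt] := hc.
set p := nth 0 (ord e) r; have pn : p < n by exact: point_lt.
have -> : cost scan_point = (cost scan_load + (bcost (BILe eN (ivar 42)) +
  (cost scan_event + cost scan_count).+1).+1).+1 by [].
apply/run_seq/run_post.
  apply: (run_step (Q := fun s' => imem s' 42 0 = cell p /\
     rmem s' 18 0 = y e p)) => //=.
  rewrite /upd /= ie ir (env_n henv) (env_o henv) // hcell //.
  by rewrite (env_y henv).
move=> s1 hf [hq hv].
have hc1 : config s1 by apply: config_frame hf.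
have ie1 : imem s1 16 0 = e by rewrite hf.1.
have hs1 : scan_all e r s1.
  have {}hf := hf; have fi := hf.1; have fr := hf.2.
  have eq q : scan_at e r q s -> scan_at e r q s1.
    rewrite /scan_at /quant !(fi 29, fi 30, fi 31, fi 27, fi 28) //.
    by rewrite !(fr 16, fr 17, fr 15).
  split=> [q hq'|q hq' m0]; last by apply: eq; apply: hs.2.
  by rewrite !(fi 27, fi 28) ?(fr 17) //; apply: hs.1.
apply: run_if => /=; rewrite hq (env_n (let: And4 h _ _ _ := hc1 in h)) => hlt.
  apply: run_le; first apply: (run_step (c := Skip)) => //=.
    split; first exact: hs1.1.
    move=> q hq' m0; apply: (scan_other (ord_perm he)) => //; last exact: hs1.2.
    by rewrite -/p => eq; move: hlt; rewrite eq; lia.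
  by [].
have hq1 : cell p < Q.
  by case: (cellQ pn) => // e1; move: hlt; rewrite e1 leqnn.
have hp1 : at_point e r (cell p) s1 by split.
apply/run_seq/(run_post (scan_event_spec he hr hq1 erefl hp1 hs1)).
by move=> s2 _ [h1 h2 h3]; apply: (scan_count_spec he hr hq1 erefl).
Qed.

Definition sides_ok e s : Prop := forall q, q < Q -> 0 < csize n cell q ->
  imem s 27 q = 0 -> forall e', e' < e ->
  box_side rho w n d b y cell q e' (quant s q e').

Lemma scan_dir_spec e s0 :
  e < 2 * d -> config s0 -> imem s0 16 0 = e -> cuts_ok s0 -> sides_ok e s0 ->
  run scan_dir s0 (2000 * n)
    (fun s => [/\ config s, cuts_ok s & sides_ok e.+1 s]).
Proof.
move=> he hc ie hcut hside.
pose init := Seq (IStore 29 (ivar 11) (INum 0)) (IStore 30 (ivar 11) (INum 0)).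
apply: (@run_post _ _ _ _ (fun s => cuts_ok s /\ sides_ok e.+1 s)); last first.
  by move=> s hf [h1 h2]; split=> //; apply: config_frame hc hf.
apply: (@run_le _ _ _ (forcost (ivar 18) Q (cost init) +
  forcost eN n (cost scan_point)).+1); last first.
  apply: leq_trans (seqcost_le (forcost_le _ _ leQ n_gt0)
    (forcost_le _ _ (leqnn _) n_gt0) n_gt0) _.
  by rewrite leq_mul2r orbT.
apply/run_seq/run_post.
  apply: (@run_for _ (fun i s => forall q, q < i -> imem s 29 q = 0 /\
     imem s 30 q = 0) 11 (ivar 18) init Q (cost init)) => //.
    by move=> s [hf _]; rewrite /= hf //; case: hc.
  move=> i s lti hf hi hI; apply: run_step => //= q.
  rewrite /upd /= hi ltnS leq_eqVlt => /orP[/eqP ->|lt]; first by rewrite eqxx.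
  by rewrite ltn_eqF //; apply: hI.
move=> s1 hf1 hz.
have hc1 : config s1 by apply: config_frame hf1.
have ie1 : imem s1 16 0 = e by rewrite hf1.1.
apply: run_post.
  apply: (@run_for _ (fun r s => scan_all e r s) 11 eN scan_point n (cost scan_point)) => //.
  - by move=> s [hf _]; rewrite /= hf //; case: hc1 => -[].
  - split=> [q hq|q hq m0].
      by rewrite /= /upd /= hf1.1 // hf1.1 // hf1.2 //; apply: hcut.
    have [h1 h2] := hz q hq.
    rewrite /scan_at /quant /= /upd /= h1 h2; apply: scan_start => //.
      by rewrite hf1.1 // hf1.1 // hf1.2 //; apply: hcut.
    by rewrite hf1.1 // hf1.2 //; apply: hside.
  move=> r s ltr hf hr hI.
  apply: (run_post (Q := fun s' => scan_all e r.+1 s')); last by [].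
  apply: scan_point_spec => //; first exact: config_frame hf.
  by rewrite hf.1.
move=> s2 hf2 hs2; split; first exact: hs2.1.
move=> q hq m0 c0.
exact: (scan_end rho_gt0 rho_lt1 w_gt0 d_gt0 le_4d le_a he (ord_perm he)
  (ord_sorted he) m0 (hs2.2 q hq m0) c0).
Qed.

Lemma find_cuts_spec s0 :
  config s0 ->
  run find_cuts s0 (5000 * (n * d))
    (fun s => [/\ config s, cuts_ok s & sides_ok (2 * d) s]).
Proof.
move=> hc; have [henv hQ hcell hcnt] := hc.
pose init := IStore 27 (ivar 11) (INum 0).
have X0 : 0 < n * d by rewrite muln_gt0 n_gt0.
have nX : n <= n * d by rewrite leq_pmulr.
apply: (@run_le _ _ _ (forcost (ivar 18) Q (cost init) +
  forcost eDD (2 * d) (2000 * n)).+1); last first.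
  have h1 := forcost_le (ivar 18) (cost init) (leq_trans leQ nX) X0.
  have h2 : forcost eDD (2 * d) (2000 * n) <= (2000 * n + 100) * (2 * d).
    apply: leq_trans (forcost_le _ _ (leqnn _) _) _; first by rewrite muln_gt0.
    by rewrite leq_mul2r -addnA leq_add2l orbT.
  have h3 : (2000 * n + 100) * (2 * d) <= 4200 * (n * d) by nia.
  by move: h1 h2 h3; rewrite /=; lia.
apply/run_seq/run_post.
  apply: (@run_for _ (fun i s => forall q, q < i -> imem s 27 q = 0)
    11 (ivar 18) init Q (cost init)) => //.
    by move=> s [hf _]; rewrite /= hf.
  move=> i s lti hf hi hI; apply: run_step => //= q.
  rewrite /upd /= hi ltnS leq_eqVlt => /orP[/eqP ->|lt]; first by rewrite eqxx.
  by rewrite ltn_eqF //; apply: hI.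
move=> s1 hf1 hz.
have hc1 : config s1 by apply: config_frame hf1.
apply: (@run_for _ (fun e s => [/\ config s, cuts_ok s & sides_ok e s]) 16 eDD
   scan_dir (2 * d) (2000 * n)) => //.
- move=> s hf; have [h _ _ _] : config s by apply: config_frame hf.
  by rewrite /= (env_d h).
- split=> //; first by apply: (config_frame (c := iset 16 (INum 0)) _ hc1) => //;
    split=> // x; rewrite inE => hx; rewrite /= upd_other.
  by move=> q hq; rewrite /= /upd /= hz.
move=> e s lte hf ie [h1 h2 h3].
apply: run_post; first exact: (scan_dir_spec lte).
move=> s' hf' [k1 k2 k3]; split=> //.
by apply: (config_frame (c := iset 16 (INum 0)) _ k1) => //;
  split=> // x; rewrite inE => hx; rewrite /= upd_other.
Qed.

End FindCuts.

(** * Splitting the cells and emitting the boxes *)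

Definition out_at (i : iexp) : iexp := IAdd (IMul (ILoad 1 (INum 0)) eD) i.

Definition emit_side : cmd :=
  let i := ivar 12 in
  Seq (RStore 2 (out_at i)
         (RSub (rnum 0) (RAdd (dd_at 15 (ivar 17) (IAdd eD i)) (rvar 12))))
  (Seq (RStore 3 (out_at i) (RAdd (dd_at 15 (ivar 17) i) (rvar 12)))
  (Seq (IStore 2 (out_at i) (INum 1)) (IStore 3 (out_at i) (INum 1)))).

Definition emit : cmd :=
  Seq (For 12 eD emit_side)
      (IStore 1 (INum 0) (IAdd (ILoad 1 (INum 0)) (INum 1))).

(** An uncut cell without points has no quantiles, so no box is emitted for it. *)
Definition split_cell : cmd :=
  If (BILe (ILoad 27 (ivar 17)) (INum 0))
     (If (BILe (ILoad 26 (ivar 17)) (INum 0)) Skip emit)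
     (Seq (IStore 32 (ivar 17) (ivar 18)) (iset 18 (IAdd (ivar 18) (INum 1)))).

(** The number of cells grows during the loop; the copy in 19 restricts it to those present at the
    start. *)
Definition split_cells : cmd :=
  Seq (iset 19 (ivar 18)) (For 17 (ivar 19) split_cell).

Section SplitCells.
Context {R : realType}.
Variables (n d : nat) (y : nat -> nat -> R).
Implicit Types s : state R.
Local Open Scope nat_scope.

(** A rectangle is treated as [2d] upper bounds, one on each signed coordinate; a left endpoint is
    minus the bound in the opposite direction. *)
Definition rbound s (k e : nat) : R :=
  if e < d then rmem s 3 (k * d + e) else (- rmem s 2 (k * d + (e - d)))%R.

Definition flagged s (k : nat) : Prop := forall i, i < d ->
  imem s 2 (k * d + i) != 0 /\ imem s 3 (k * d + i) != 0.

Definition same_output s s' (K : nat) : Prop := forall k, k < K ->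
  (forall e, e < 2 * d -> rbound s' k e = rbound s k e) /\
  (flagged s k -> flagged s' k).

Definition in_rect s (k j : nat) : bool :=
  all (fun e => y e j <= rbound s k e)%R (iota 0 (2 * d)).

Definition cover_count s (j : nat) : nat :=
  cn (imem s 1 0) (fun k => in_rect s k j).

Lemma same_output_trans s1 s2 s3 K K' : K <= K' ->
  same_output s1 s2 K -> same_output s2 s3 K' -> same_output s1 s3 K.
Proof.
move=> hK h1 h2 k hk; have [e1 f1] := h1 k hk.
have [e2 f2] := h2 k (leq_trans hk hK); split.
  by move=> e he; rewrite e2 // e1.
by move=> /f1.
Qed.

Lemma in_rect_same s s' K k j : same_output s s' K -> k < K ->
  in_rect s' k j = in_rect s k j.
Proof.
move=> h hk; apply: eq_in_all => e; rewrite mem_iota => /andP[_ he].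
by have [-> //] := h k hk.
Qed.

Lemma emit_spec (w3 : R) (q : nat) s0 :
  0 < d -> imem s0 0 1 = d -> rmem s0 12 0 = w3 -> imem s0 17 0 = q ->
  run emit s0 (500 * d) (fun s => let o := imem s0 1 0 in
    [/\ imem s 1 0 = o.+1,
        forall e, e < 2 * d -> rbound s o e = (quant d s0 q e + w3)%R,
        flagged s o & same_output s0 s o]).
Proof.
move=> d0 ed ew eq; set o := imem s0 1 0.
pose I i s := [/\ forall i', i' < i -> [/\
    rmem s 3 (o * d + i') = (quant d s0 q i' + w3)%R,
    rmem s 2 (o * d + i') = (- (quant d s0 q (d + i') + w3))%R,
    imem s 2 (o * d + i') = 1 & imem s 3 (o * d + i') = 1] &
  forall x, x < o * d -> [/\ rmem s 3 x = rmem s0 3 x,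
    rmem s 2 x = rmem s0 2 x, imem s 2 x = imem s0 2 x &
    imem s 3 x = imem s0 3 x]].
apply: (@run_le _ _ _ (forcost eD d (cost emit_side) +
  cost (IStore 1 (INum 0) (IAdd (ILoad 1 (INum 0)) (INum 1)))).+1); last first.
  apply: leq_trans (seqcost_le (forcost_le _ _ (leqnn _) d0)
    (constcost_le _ d0) d0) _.
  by rewrite leq_mul2r orbT.
apply/run_seq/run_post.
  apply: (@run_for _ I 12 eD emit_side d (cost emit_side)) => //.
    by move=> s [hf _]; rewrite /= hf.
  move=> i s lti [f g] hi [hI1 hI2]; apply: run_step => //=.
  rewrite /upd /= hi !(f 0, f 1, f 17) // (g 15) // (g 12) // ed ew eq -/o.
  split=> [i' hi'|x hx] /=; last first.
    rewrite /upd /= (_ : (x == o * d + i) = false); first exact: hI2.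
    by lia.
  rewrite /upd /= eqn_add2l; move: hi'; rewrite ltnS leq_eqVlt => /orP[/eqP ->|lt].
    by rewrite eqxx sub0r.
  by rewrite ltn_eqF //; apply: hI1.
move=> s1 [f g] [hI1 hI2]; apply: run_step => //=.
have o1 : imem s1 1 0 = o by rewrite f.
rewrite /upd /= o1; split.
- by rewrite addn1.
- move=> e he; rewrite /rbound /=; case: ltnP => hed.
    by have [-> _ _ _] := hI1 e hed.
  have [|_ -> _ _] := hI1 (e - d); first by lia.
  by rewrite opprK subnKC.
- by move=> i hi; have [_ _ h3 h4] := hI1 i hi; rewrite /= h3 h4.
- move=> k hk; have idx i : i < d -> k * d + i < o * d by nia.
  split=> [e he|hfl i hi] /=.
    rewrite /rbound /=; case: ltnP => hed.
      by have [-> _ _ _] := hI2 _ (idx e hed).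
    by have [|_ -> _ _] := hI2 _ (idx (e - d) _) => //; lia.
  have [_ _ -> ->] := hI2 _ (idx i hi); exact: hfl.
Qed.

Variables (w : R) (cell : nat -> nat) (Q : nat).
Hypothesis d_gt0 : 0 < d.

Definition boxed_cell s (q : nat) : bool :=
  (imem s 27 q == 0) && (0 < csize n cell q).

Definition box_of s s' (q k : nat) : Prop :=
  forall e, e < 2 * d -> rbound s' k e = (quant d s q e + w / 3)%R.

Definition box_in s (q j : nat) : Prop :=
  forall e, e < 2 * d -> (y e j <= quant d s q e + w / 3)%R.

(** Here [t] cells have been treated. The last clause is the sparsity of a single level: if [l] is
    the only cell whose box can contain [j], at most one rectangle around [j] is added, and none
    unless [l] is boxed. *)
Definition split_post s0 (t : nat) s : Prop :=
  [/\ new_ids (R := R) Q (imem s 18 0) (imem s0 27) (imem s 32) t,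
      imem s0 1 0 <= imem s 1 0 /\ same_output s0 s (imem s0 1 0),
      forall k, imem s0 1 0 <= k < imem s 1 0 -> flagged s k /\
        exists q, [/\ q < t, boxed_cell s0 q & box_of s0 s q k],
      forall q, q < t -> boxed_cell s0 q ->
        exists k, k < imem s 1 0 /\ box_of s0 s q k &
      forall j l, (forall q, q < t -> boxed_cell s0 q -> box_in s0 q j -> q = l) ->
        cover_count s j <= cover_count s0 j + ((l < t) && boxed_cell s0 l)].

Lemma cnS P K : cn K.+1 P = cn K P + P K.
Proof. by rewrite /cn -addn1 iotaD count_cat /= addn0 add0n. Qed.

Lemma split_cells_spec s0 :
  imem s0 0 1 = d -> rmem s0 12 0 = (w / 3)%R -> imem s0 18 0 = Q ->
  (forall q, q < Q -> imem s0 26 q = csize n cell q) ->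
  0 < n -> Q <= n ->
  run split_cells s0 (2000 * (n * d)) (split_post s0 Q).
Proof.
move=> ed ew eQ ec n0 hQn.
have X0 : 0 < n * d by rewrite muln_gt0 n0.
pose T := (bcost (BILe (ILoad 27 (ivar 17)) (INum 0)) +
   ((bcost (BILe (ILoad 26 (ivar 17)) (INum 0)) + 500 * d).+1)).+1.
apply: (@run_le _ _ _ (cost (iset 19 (ivar 18)) + forcost (ivar 19) Q T).+1).
  apply/run_seq/run_step => //; set s1 := step _ _.
  apply: (@run_for _ (split_post s0) 17 (ivar 19) split_cell Q T) => //.
  - by move=> s [f _]; rewrite /= f // -eQ.
  - split=> //=.
    + split=> //; rewrite /= /upd /= eQ //; first by move=> q hq; left.
      by move=> F; rewrite [X in (_ + X)%R]big_ord0 addr0.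
    + by move=> k /andP[]; rewrite leqNgt => /negbTE ->.
    + by move=> j l _; rewrite addn0.
  move=> q s ltq [f g] hq [h1 [h2o h2s] h3 h4 h5].
  have i27 : imem s 27 = imem s0 27 by rewrite f.
  have i26 : imem s 26 = imem s0 26 by rewrite f.
  have r15 : rmem s 15 = rmem s0 15 by rewrite g.
  apply: run_if => /=; rewrite hq i27 => hc; last first.
    apply: run_le; first apply: run_step => //=.
    2: by rewrite /= /T /=; lia.
    have c1 : imem s0 27 q != 0 by rewrite -lt0n ltnNge.
    have nb : boxed_cell s0 q = false by rewrite /boxed_cell (negbTE c1).
    have ltS q0 : q0 < q.+1 -> boxed_cell s0 q0 -> q0 < q.
      by rewrite ltnS leq_eqVlt => /orP[/eqP ->|//]; rewrite nb.
    case: h1 => a1 a2 a3 a4 a5.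
    split=> /=.
    + rewrite /upd /= hq addn1; split.
      * exact: leqW.
      * move=> q0; rewrite ltnS leq_eqVlt => /orP[/eqP ->|lt] cq.
          by rewrite eqxx a1 ltnSn.
        by rewrite ltn_eqF //; have /andP[b1 b2] := a2 q0 lt cq; rewrite b1 leqW.
      * move=> q1 q2 lt12; rewrite ltnS leq_eqVlt => /orP[/eqP e2|lt2] cq1 cq2.
          rewrite e2 eqxx in lt12 *; rewrite ltn_eqF //.
          by have /andP[] := a2 q1 lt12 cq1.
        by rewrite !ltn_eqF // ?(ltn_trans lt12) //; apply: a3.
      * move=> q0; rewrite ltnS leq_eqVlt => /orP[/eqP ->|lt].
          by right; exists q; rewrite eqxx.
        case: (a4 q0 lt) => [|[q1 [b1 b2 b3]]]; [by left|right; exists q1].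
        by split; [exact: leqW|by []|rewrite ltn_eqF].
      * move=> F; rewrite big_ord_recr /= a5 [X in _ = (_ + X)%R]big_mkcond big_ord_recr /=.
        rewrite c1 eqxx -big_mkcond /= -addrA; congr (_ + (_ + _))%R.
        by apply: eq_bigr => -[i hi] _ /=; rewrite ltn_eqF.
    + split=> // k hk; have [b1 b2] := h2s k hk; split=> //.
    + move=> k hk; have [b1 [q0 [b2 b3 b4]]] := h3 k hk; split=> //.
      by exists q0; split=> //; exact: leqW.
    + by move=> q0 lt bq; have [k [b1 b2]] := h4 q0 (ltS _ lt bq) bq; exists k.
    + move=> j l hl; have -> : (l < q.+1) && boxed_cell s0 l = (l < q) && boxed_cell s0 l.
        rewrite ltnS leq_eqVlt; case: (eqVneq l q) => [->|//] /=.
        by rewrite nb andbF.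
      by apply: h5 => q0 lt; apply: hl; exact: leqW.
  have c0 : imem s0 27 q = 0 by apply/eqP; rewrite -leqn0.
  have new' : new_ids (R := R) Q (imem s 18 0) (imem s0 27) (imem s 32) q.+1.
    case: h1 => a1 a2 a3 a4 a5; split=> //.
    * by move=> q0; rewrite ltnS leq_eqVlt => /orP[/eqP ->|]; [rewrite c0|exact: a2].
    * move=> q1 q2 lt12; rewrite ltnS leq_eqVlt => /orP[/eqP ->|].
        by rewrite c0.
      exact: a3.
    * move=> q0 /a4[|[q1 [b1 b2 b3]]]; [by left|right; exists q1].
      by split=> //; exact: leqW.
    * move=> F; rewrite a5 [X in _ = (_ + X)%R]big_mkcond big_ord_recr /=.
      by rewrite c0 eqxx /= addr0 -big_mkcond.
  apply: run_if => /=; rewrite hq i26 ec // leqn0 => hm.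
    have nb : boxed_cell s0 q = false by rewrite /boxed_cell (eqP hm) ltnn andbF.
    have ltS q0 : q0 < q.+1 -> boxed_cell s0 q0 -> q0 < q.
      by rewrite ltnS leq_eqVlt => /orP[/eqP ->|//]; rewrite nb.
    apply: run_le; first apply: (run_step (c := Skip)) => //=.
    2: by rewrite /=; lia.
    split=> //=.
    + move=> k hk; have [b1 [q0 [b2 b3 b4]]] := h3 k hk; split=> //.
      by exists q0; split=> //; exact: leqW.
    + by move=> q0 lt bq; have [k [b1 b2]] := h4 q0 (ltS _ lt bq) bq; exists k.
    + move=> j l hl; have -> : (l < q.+1) && boxed_cell s0 l = (l < q) && boxed_cell s0 l.
        rewrite ltnS leq_eqVlt; case: (eqVneq l q) => [->|//] /=.
        by rewrite nb andbF.
      by apply: h5 => q0 lt; apply: hl; exact: leqW.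
  have bq : boxed_cell s0 q by rewrite /boxed_cell c0 lt0n.
  apply: run_post; first apply: (@emit_spec (w / 3)%R q s) => //.
    by rewrite f // ed.
  - by rewrite g // ew.
  move=> s2 [f2 g2] [k1 k2 k3 k4].
  have {}k2 e : e < 2 * d -> rbound s2 (imem s 1 0) e = (quant d s0 q e + w / 3)%R.
    by move=> he; rewrite k2 // /quant r15.
  split=> /=.
  + by rewrite /upd /= !f2.
  + split; first by rewrite /upd /= k1 leqW.
    exact: same_output_trans h2o h2s k4.
  + move=> k; rewrite /upd /= k1 ltnS [k <= _]leq_eqVlt => /andP[hk1 /orP[/eqP ek|hk2]].
      rewrite ek; split=> //; exists q; split=> //.
    have [|b1 [q0 [b2 b3 b4]]] := h3 k; first by rewrite hk1.
    have [e1 e2] := k4 k hk2; split; first exact: e2.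
    exists q0; split=> //; first exact: leqW.
    by move=> e he; rewrite -b4 // -e1.
  + move=> q0; rewrite ltnS leq_eqVlt => /orP[/eqP ->|lt] bq0.
      by exists (imem s 1 0); rewrite /upd /= k1; split.
    have [k [b1 b2]] := h4 q0 lt bq0; exists k; rewrite /upd /= k1.
    split; first exact: leqW.
    by have [e1 e2] := k4 k b1; move=> e he; rewrite -b2 // -e1.
  + move=> j l hl.
    have hcc : cover_count (setx s2 17 q.+1) j =
        cover_count s j + in_rect s2 (imem s 1 0) j.
      rewrite /cover_count /= /upd /= k1 cnS; congr (_ + _).
      by apply: cn_eq => k hk; rewrite -(in_rect_same j k4 hk).
    rewrite hcc.
    have hin : in_rect s2 (imem s 1 0) j -> q = l.
      move=> /allP h; apply: hl => // e he.
      by rewrite -k2 //; apply: h; rewrite mem_iota.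
    have hle : cover_count s j <= cover_count s0 j + ((l < q) && boxed_cell s0 l).
      by apply: h5 => q0 lt; apply: hl; exact: leqW.
    case: (boolP (in_rect s2 (imem s 1 0) j)) => hr.
      by rewrite -(hin hr) ltnn /= addn0 in hle *; rewrite ltnSn bq /= leq_add2r.
    rewrite addn0; apply: leq_trans hle _; rewrite leq_add2l.
    by case: boxed_cell; rewrite ?andbF // !andbT; case: ltnP => // lt; rewrite leqW.
apply: leq_trans (_ : (cost (iset 19 (ivar 18)) + (T + 100) * n).+1 <= _).
  rewrite ltnS leq_add2l; apply: leq_trans (forcost_le _ _ hQn n0) _.
  by rewrite leq_mul2r -addnA leq_add2l orbT.
have hd : n <= n * d by rewrite leq_pmulr.
by rewrite /T /=; nia.
Qed.

End SplitCells.

(** * Moving the points to the new cells *)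

Definition unbox : cmd :=
  Seq (iset 43 (INum 1))
  (Seq (For 12 eDD
          (If (BRLe (RLoad 14 (IAdd (IMul (ivar 12) eN) (ivar 11)))
                    (dd_at 15 (ivar 42) (ivar 12)))
              Skip (iset 43 (INum 0))))
       (If (BILe (ivar 43) (INum 0)) Skip
           (Seq (IStore 24 (ivar 11) (INum 0)) (IStore 25 (ivar 11) eN)))).

Definition move_cut : cmd :=
  Seq (rset 18 (RLoad 14 (IAdd (IMul (icell 28) eN) (ivar 11))))
      (If (BRLe (rcell 17) (rvar 18))
          (IStore 25 (ivar 11) (icell 32))
          (If (BRLe (rvar 18) (RSub (rcell 17) (rvar 10))) Skip
              (IStore 25 (ivar 11) eN))).

Definition reassign_point : cmd :=
  Seq (iset 42 (ILoad 25 (ivar 11)))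
      (If (BILe eN (ivar 42)) Skip
          (If (BILe (icell 27) (INum 0)) unbox move_cut)).

Definition reassign : cmd := For 11 eN reassign_point.

Definition count_point : cmd :=
  Seq (iset 40 (IAdd (ivar 40) (ILoad 24 (ivar 11))))
      (If (BILe eN (ILoad 25 (ivar 11))) Skip
          (Seq (IStore 26 (ILoad 25 (ivar 11))
                  (IAdd (ILoad 26 (ILoad 25 (ivar 11))) (INum 1)))
               (iset 39 (IAdd (ivar 39) (INum 1))))).

Definition recount : cmd :=
  Seq (For 11 (ivar 18) (IStore 26 (ivar 11) (INum 0)))
  (Seq (iset 39 (INum 0)) (Seq (iset 40 (INum 0)) (For 11 eN count_point))).

Definition level : cmd :=
  Seq find_cuts (Seq split_cells (Seq reassign recount)).

Section MovePoints.
Context {R : realType}.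
Variables (rho w : R) (n d : nat) (y : nat -> nat -> R).
Variable (ord : nat -> seq nat).
Implicit Types s : state R.
Local Open Scope nat_scope.
Hypothesis n_gt0 : 0 < n.

Definition unc_count s : nat := cn n (fun p => imem s 24 p != 0).

Lemma recount_spec (cell : nat -> nat) (Q : nat) s0 :
  imem s0 0 0 = n -> imem s0 18 0 = Q -> Q <= n ->
  (forall p, p < n -> imem s0 25 p = cell p) ->
  (forall p, p < n -> cell p < Q \/ cell p = n) ->
  (forall p, p < n -> imem s0 24 p <= 1) ->
  run recount s0 (500 * n) (fun s =>
    [/\ forall q, q < Q -> imem s 26 q = csize n cell q,
        imem s 39 0 = cn n (fun p => cell p < Q) & imem s 40 0 = unc_count s]).
Proof.
move=> en eQ hQ hc hcQ hu.
pose z := IStore 26 (ivar 11) (INum 0).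
apply: (@run_le _ _ _ (forcost (ivar 18) Q (cost z) + (cost (iset 39 (INum 0)) +
  (cost (iset 40 (INum 0)) + forcost eN n (cost count_point)).+1).+1).+1); last first.
  have h1 := forcost_le (ivar 18) (cost z) hQ n_gt0.
  have h2 := forcost_le eN (cost count_point) (leqnn n) n_gt0.
  by move: h1 h2; rewrite /=; lia.
apply/run_seq/run_post.
  apply: (@run_for _ (fun i s => forall q, q < i -> imem s 26 q = 0)
    11 (ivar 18) z Q (cost z)) => //.
    by move=> s [f _]; rewrite /= f.
  move=> i s lti [f _] hi hI; apply: run_step => // q.
  rewrite /= /upd /= hi ltnS leq_eqVlt => /orP[/eqP ->|lt]; first by rewrite eqxx.
  by rewrite ltn_eqF ?hI.
move=> s1 [f1 _] hz.
apply/run_seq/run_step => //; set s2 := step _ s1.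
apply/run_seq/run_step => //; set s3 := step _ s2.
have i26 : imem s3 26 = imem s1 26 by [].
have i39 : imem s3 39 0 = 0 by [].
have i40 : imem s3 40 0 = 0 by [].
have i0 : imem s3 0 = imem s0 0 by rewrite -(f1 0).
have i24 : imem s3 24 = imem s0 24 by rewrite -(f1 24).
have i25 : imem s3 25 = imem s0 25 by rewrite -(f1 25).
clearbody s3.
apply: run_post.
  apply: (@run_for _ (fun k s =>
    [/\ forall q, q < Q -> imem s 26 q = cn k (fun p => cell p == q),
        imem s 39 0 = cn k (fun p => cell p < Q) &
        imem s 40 0 = cn k (fun p => imem s0 24 p != 0)]) 11 eN count_point n
    (cost count_point)) => //.
  - by move=> s [f _]; rewrite /= f // i0 en.
  - by split=> //= q hq; rewrite /upd /= i26 hz.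
  move=> p s ltp [f _] hp [h1 h2 h3].
  have u1 : imem s0 24 p = (imem s0 24 p != 0) by have := hu p ltp; case: (imem s0 24 p) => [|[]].
  apply: run_step => //=; rewrite /upd /= hp !(f 0, f 24, f 25) // i0 i24 i25 en hc // h3.
  have [lt|e] := hcQ p ltp.
    rewrite leqNgt (leq_trans lt hQ) /= h2; split.
    - move=> q hq; rewrite cnS; case: (eqVneq q (cell p)) => [->|ne].
        by rewrite h1 // eqxx.
      by rewrite h1 // addn0.
    - by rewrite cnS lt addn1.
    - by rewrite cnS {1}u1.
  rewrite e leqnn /= h2; split.
  - move=> q hq; rewrite cnS e (_ : (n == q) = false) ?addn0 ?h1 //.
    by apply/eqP => en'; move: hq; rewrite -en' ltnNge hQ.
  - by rewrite cnS e ltnNge hQ addn0.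
  - by rewrite cnS {1}u1.
move=> s [f _] [h1 h2 h3]; split=> //.
by rewrite h3; apply: cn_eq => p hp; rewrite f // i24.
Qed.

Hypothesis d_gt0 : 0 < d.
Variables (cell : nat -> nat) (Q : nat).
Hypothesis leQ : Q <= n.
Hypothesis cellQ : forall p, p < n -> cell p < Q \/ cell p = n.

Definition moved s0 : nat -> nat :=
  newcell w n d y cell (imem s0 27) (imem s0 28) (imem s0 32) (rmem s0 17)
    (quant d s0).

Definition boxed_point s0 (p : nat) : bool :=
  [&& cell p < Q, imem s0 27 (cell p) == 0 & inbox d y (quant d s0) (cell p) p].

(** Array 25 is overwritten in place; this is sound because the new cell of a point depends only on
    its own old cell, its coordinates and data stored per cell. *)
Definition unbox_post s0 p s : Prop :=
  forall p', p' < n ->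
   imem s 25 p' = (if p' < p then moved s0 p' else cell p') /\
   imem s 24 p' = (if (p' < p) && boxed_point s0 p' then 0 else imem s0 24 p').

Lemma reassign_spec s0 :
  env rho w n d y ord s0 -> (forall p, p < n -> imem s0 25 p = cell p) ->
  (forall q, q < Q -> imem s0 27 q != 0 -> imem s0 28 q < 2 * d) ->
  run reassign s0 (1000 * (n * d)) (unbox_post s0 n).
Proof.
move=> henv hc hcd.
pose inner := If (BRLe (RLoad 14 (IAdd (IMul (ivar 12) eN) (ivar 11)))
                    (dd_at 15 (ivar 42) (ivar 12))) Skip (iset 43 (INum 0)).
pose fin := If (BILe (ivar 43) (INum 0)) Skip
           (Seq (IStore 24 (ivar 11) (INum 0)) (IStore 25 (ivar 11) eN)).
pose Tu := (cost (iset 43 (INum 1)) + (forcost eDD (2 * d) (cost inner) + cost fin).+1).+1.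
pose T := (cost (iset 42 (ILoad 25 (ivar 11))) + (bcost (BILe eN (ivar 42)) +
  (bcost (BILe (icell 27) (INum 0)) + (Tu + cost move_cut)).+1).+1).+1.
apply: (@run_le _ _ _ (forcost eN n T)); last first.
  apply: leq_trans (forcost_le _ _ (leqnn _) n_gt0) _.
  rewrite [n * d]mulnC mulnA leq_mul2r; apply/orP; right.
  have d2 : 0 < 2 * d by lia.
  have := forcost_le eDD (cost inner) (leqnn _) d2.
  by rewrite /T /Tu /=; lia.
apply: (@run_for _ (unbox_post s0) 11 eN reassign_point n T) => //.
- by move=> s [f _]; rewrite /= f // (env_n henv).
- by move=> p hp; rewrite /= /upd /= hc.
move=> p s ltp hf hp hI; have [f g] := hf.
have henv1 : env rho w n d y ord s by apply: env_frame hf.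
have [c25 c24] := hI p ltp; rewrite ltnn /= in c25 c24.
have later s' : 
   imem s' 25 p = moved s0 p -> 
   imem s' 24 p = (if boxed_point s0 p then 0 else imem s0 24 p) ->
   (forall p', p' != p -> imem s' 25 p' = imem s 25 p' /\ imem s' 24 p' = imem s 24 p') ->
   unbox_post s0 p.+1 (setx s' 11 p.+1).
  move=> k1 k2 k3 p' hp'; rewrite /= /upd /= ltnS.
  case: (eqVneq p' p) => [->|ne]; first by rewrite leqnn.
  by have [-> ->] := k3 p' ne; rewrite leq_eqVlt (negbTE ne) /=; apply: hI.
apply/run_seq/run_post.
  by apply: (run_step (Q := fun s' => imem s' 42 0 = cell p)) => //=; rewrite /upd /= hp.
move=> s1 hf1 h42; have [f1 g1] := hf1.
have henv2 : env rho w n d y ord s1 by apply: env_frame hf1.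
have h11 : imem s1 11 0 = p by rewrite f1.
have i25 : imem s1 25 = imem s 25 by rewrite f1.
have i24 : imem s1 24 = imem s 24 by rewrite f1.
have i27 : imem s1 27 = imem s0 27 by rewrite f1 // f.
have i28 : imem s1 28 = imem s0 28 by rewrite f1 // f.
have i32 : imem s1 32 = imem s0 32 by rewrite f1 // f.
have r17 : rmem s1 17 = rmem s0 17 by rewrite g1 // g.
have r15 : rmem s1 15 = rmem s0 15 by rewrite g1 // g.
apply: run_if => /=; rewrite h42 (env_n henv2) => hn.
  have en : cell p = n by case: (cellQ ltp) => // lt; move: hn; rewrite leqNgt (leq_trans lt leQ).
  apply: run_le; first apply: (run_step (c := Skip)) => //.
    apply: later => [||p' _]; rewrite ?i25 ?i24 //.
      by rewrite c25 /moved /newcell en leqnn.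
    by rewrite c24 /boxed_point en ltnNge leQ.
  by rewrite /=; lia.
have lt : cell p < Q by case: (cellQ ltp) => // e; move: hn; rewrite e leqnn.
apply: run_if => /=; rewrite h42 i27 => hcf; last first.
  have c1 : imem s0 27 (cell p) != 0 by rewrite -lt0n ltnNge.
  apply: (@run_le _ _ _ (cost move_cut)); last by rewrite leq_addl.
  apply: run_step => //=.
  rewrite /upd /= h11 h42 i28 r17 (env_n henv2) (env_w henv2) i32.
  rewrite (env_y henv2) ?hcd //.
  have eb : boxed_point s0 p = false by rewrite /boxed_point (negbTE c1) andbF.
  have em : moved s0 p = if (rmem s0 17 (cell p) <= y (imem s0 28 (cell p)) p)%R
     then imem s0 32 (cell p) else if (y (imem s0 28 (cell p)) p <=
       rmem s0 17 (cell p) - w)%R then cell p else n.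
    by rewrite /moved /newcell (negbTE hn) c1.
  case: ifP em => h1 em.
    by apply: later => [||p' /negbTE ne]; rewrite /= /upd /= ?eqxx ?ne ?em ?eb ?i24 ?i25.
  case: ifP em => h2 em.
    by apply: later => [||p' _]; rewrite /= /upd /= ?em ?eb ?i24 ?i25.
  by apply: later => [||p' /negbTE ne]; rewrite /= /upd /= ?eqxx ?ne ?em ?eb ?i24 ?i25.
have c0 : imem s0 27 (cell p) == 0 by rewrite -leqn0.
apply: (@run_le _ _ _ Tu); last by rewrite leq_addr.
apply/run_seq/run_post.
  by apply: (run_step (Q := fun s' => imem s' 43 0 = 1)).
move=> s2 hf2 h43; have [f2 g2] := hf2.
have henv3 : env rho w n d y ord s2 by apply: env_frame hf2.
apply/run_seq/run_post.
  apply: (@run_for _ (fun e s => imem s 43 0 =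
    all (fun e => y e p <= quant d s0 (cell p) e)%R (iota 0 e)) 12 eDD inner (2 * d)
    (cost inner)) => //.
    by move=> s' [f' _]; rewrite /= f' // (env_d henv3).
  move=> e s' lte hf' he hI'; have [f' g'] := hf'.
  have henv4 : env rho w n d y ord s' by apply: env_frame hf'.
  apply: (run_post (Q := fun s => imem s 43 0 =
    all (fun e => y e p <= quant d s0 (cell p) e)%R (iota 0 e) &&
    (y e p <= quant d s0 (cell p) e)%R)); last first.
    by move=> s4 _ h; rewrite -[in RHS]addn1 iotaD all_cat /= andbT.
  apply: run_step => //=; rewrite he (env_n henv4) (env_d henv4).
  rewrite (f' 11) // (f2 11) // h11 (f' 42) // (f2 42) // h42 (env_y henv4) //.
  rewrite g' // g2 // r15 -/(quant d s0 (cell p) e).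
  by case: ifP => hle; rewrite /= /upd /= ?hI' ?andbT ?andbF.
move=> s3 hf3 h43'; have [f3 g3] := hf3.
have henv4 : env rho w n d y ord s3 by apply: env_frame hf3.
apply: run_step => //=; rewrite /upd /= h43' (env_n henv4) (f3 11) // (f2 11) // h11.
have i25' : imem s3 25 = imem s 25 by rewrite f3 // f2.
have i24' : imem s3 24 = imem s 24 by rewrite f3 // f2.
rewrite -/(inbox d y (quant d s0) (cell p) p).
have em : moved s0 p = if inbox d y (quant d s0) (cell p) p then n else cell p.
  by rewrite /moved /newcell (negbTE hn) c0.
have eb : boxed_point s0 p = inbox d y (quant d s0) (cell p) p.
  by rewrite /boxed_point lt c0.
case: (inbox _ _ _ _ _) em eb => em eb /=.
  by apply: later => [||p' /negbTE ne]; rewrite /= /upd /= ?eqxx ?ne ?em ?eb ?i24' ?i25'.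
by apply: later => [||p' _]; rewrite ?em ?eb ?i24' ?i25'.
Qed.

End MovePoints.

(** * The invariant of a round *)

Section Round.
Context {R : realType}.
Variables (rho w Delta : R) (n d a b : nat) (y : nat -> nat -> R).
Variable (ord : nat -> seq nat).
Implicit Types s : state R.
Local Open Scope nat_scope.

Hypothesis rho_gt0 : (0 < rho)%R.
Hypothesis rho_lt1 : (rho < 1)%R.
Hypothesis w_gt0 : (0 < w)%R.
Hypothesis w_eq : (w * (23 * b%:R) = Delta * rho)%R.
Hypothesis n_gt0 : 0 < n.
Hypothesis d_gt0 : 0 < d.
Hypothesis b_gt0 : 0 < b.
Hypothesis le_4d : 4 * d <= 2 ^ a.
Hypothesis le_a : a <= 2 ^ b.
Hypothesis y_opp : forall e p, e < 2 * d -> y (opp_dir d e) p = (- y e p)%R.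
Hypothesis ord_perm : forall e, e < 2 * d -> perm_eq (ord e) (iota 0 n).
Hypothesis ord_sorted : forall e, e < 2 * d ->
  sorted (fun p p' => y e p' <= y e p)%R (ord e).

Definition output_ok s : Prop := forall k, k < imem s 1 0 -> flagged d s k /\
  forall i, i < d -> (rbound d s k i + rbound d s k (d + i)%N <= Delta)%R.

Definition covered_ok s : Prop := forall p, p < n -> imem s 24 p = 0 ->
  exists k, k < imem s 1 0 /\
    forall e, e < 2 * d -> (y e p + w / 3 <= rbound d s k e)%R.

(** The second bound records that each box around [j] halves the cell at [loc j], but it is void
    once this cell is empty; the third one remains. It survives a further box because only a
    nonempty cell emits one, and there the second bound still gives [2 ^ E j <= m0]. *)
Definition sparse_ok (m0 : nat) (c0 : nat -> nat) (cell loc E : nat -> nat) s :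
    Prop := forall j, j < n ->
  [/\ cover_count d y s j <= c0 j + E j,
      2 ^ E j * csize n cell (loc j) <= m0 & 2 ^ E j <= 2 * m0].

(* m0 and c0 are the number of uncovered points and the cover counts at the
   start of the round; k counts its levels, and E j the boxes it has emitted
   around point j. *)
Record round_inv (m0 : nat) (c0 : nat -> nat) (k : nat)
    (cell loc E : nat -> nat) (Q : nat) s : Prop := RoundInv {
  ri_config : config rho w n d y ord cell Q s;
  ri_leQ : Q <= n;
  ri_cell : forall p, p < n -> cell p < Q \/ cell p = n;
  ri_unc : forall p, p < n -> imem s 24 p <= 1;
  ri_active : forall p, p < n -> cell p < Q -> imem s 24 p != 0;
  ri_act : imem s 39 0 = cn n (fun p => cell p < Q);
  ri_nu : imem s 40 0 = unc_count n s;
  ri_nu_le : unc_count n s <= m0;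
  ri_max : (\sum_(q < Q) (maxn (csize n cell q) 1)%:R <= n%:R :> R)%R;
  ri_pot : (m0%:R `^ (1 - rho) <= m0%:R - (unc_count n s)%:R +
    \sum_(q < Q) (csize n cell q)%:R `^ (1 - rho))%R;
  ri_size : forall q, q < Q ->
    ((csize n cell q)%:R <= n%:R * (1 - (4 * d)%:R^-1) ^+ k :> R)%R;
  ri_loc : forall j, j < n -> loc j < Q;
  ri_sep : kept_apart w n d y cell Q loc;
  ri_sparse : sparse_ok m0 c0 cell loc E s;
  ri_out : output_ok s;
  ri_covered : covered_ok s }.

Lemma rbound_frame s s' k e : rmem s' 2 = rmem s 2 -> rmem s' 3 = rmem s 3 ->
  rbound d s' k e = rbound d s k e.
Proof. by rewrite /rbound => -> ->. Qed.

Lemma level_spec m0 c0 k cell loc E Q s0 :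
  round_inv m0 c0 k cell loc E Q s0 ->
  run level s0 (9 * 1000 * (n * d)) (fun s => exists cell' loc' E' Q',
    round_inv m0 c0 k.+1 cell' loc' E' Q' s).
Proof.
move=> [hc hQ hcell hunc hact hactn hnu hnule hmax hpot hsize hloc hsep
  hsparse hout hcov].
have nd0 : 0 < n * d by rewrite muln_gt0 n_gt0.
have ndn : n <= n * d by rewrite leq_pmulr.
apply: (@run_le _ _ _ (5000 * (n * d) + (2000 * (n * d) +
  (1000 * (n * d) + 500 * n).+1).+1).+1); last first.
  by move: ndn nd0; move: (n * d) => X; clear; lia.
apply/run_seq/(run_post (find_cuts_spec rho_gt0 rho_lt1 w_gt0 n_gt0 d_gt0 le_4d
  le_a ord_perm ord_sorted hQ hcell hc)).
move=> s1 [f1 g1] [hc1 cuts1 sides1].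
have [env1 eQ1 ecell1 ecnt1] := hc1.
have boxes1 q : q < Q -> 0 < csize n cell q -> imem s1 27 q = 0 ->
  forall e, e < 2 * d -> box_side rho w n d b y cell q e (quant d s1 q e).
  exact: sides1.
apply/run_seq/(run_post (split_cells_spec y d_gt0 (env_d env1) (env_w3 env1) eQ1
  ecnt1 n_gt0 hQ)).
move=> s2 hf2 [ids [leo hsame] hnewout hallout hcount]; have [f2 g2] := hf2.
have env2 : env rho w n d y ord s2 by apply: env_frame hf2.
set Q' := imem s2 18 0 in ids.
set CF := imem s1 27 in ids cuts1 boxes1 *.
set NEW := imem s2 32 in ids.
set H := quant d s1 in boxes1.
have leQ' : Q' <= n.
  exact: (new_le_n rho_gt0 rho_lt1 w_gt0 d_gt0 hQ cuts1 ids hmax).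
have i27 : imem s2 27 = CF by rewrite f2.
have i28 : imem s2 28 = imem s1 28 by rewrite f2.
have r17 : rmem s2 17 = rmem s1 17 by rewrite g2.
have r15 : rmem s2 15 = rmem s1 15 by rewrite g2.
pose cell' := newcell w n d y cell CF (imem s1 28) NEW (rmem s1 17) H.
have eqH : quant d s2 = H by rewrite /H /quant r15.
have emoved : moved w n d y cell s2 = cell'.
  by rewrite /moved /cell' i27 i28 r17 eqH.
apply/run_seq/run_post.
  apply: (reassign_spec n_gt0 d_gt0 hQ hcell env2).
    by move=> p hp; rewrite f2 // ecell1.
  by move=> q hq; rewrite i27 i28 => hcf; case: (cuts1 q hq hcf).
move=> s3 hf3 hmv; have [f3 g3] := hf3.
have hmv25 p : p < n -> imem s3 25 p = cell' p.
  by move=> hp; have [-> _] := hmv p hp; rewrite hp emoved.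
have hmv24 p : p < n -> imem s3 24 p =
    if [&& cell p < Q, CF (cell p) == 0 & inbox d y H (cell p) p] then 0
    else imem s0 24 p.
  move=> hp; have [_ ->] := hmv p hp; rewrite hp /boxed_point i27 eqH /=.
  by rewrite (f2 24) // (f1 24).
have hcell' p : p < n -> cell' p < Q' \/ cell' p = n.
  by move=> hp; exact: (newcell_range _ _ _ _ _ _ hQ hcell ids hp).
have env3 : env rho w n d y ord s3 by apply: env_frame hf3.
have hQ3 : imem s3 18 0 = Q' by rewrite f3.
have hunc3 p : p < n -> imem s3 24 p <= 1.
  by move=> hp; rewrite hmv24 //; case: ifP => // _; apply: hunc.
apply: run_post.
  exact: (recount_spec n_gt0 (env_n env3) hQ3 leQ' hmv25 hcell' hunc3).
move=> s4 hf4 [j26 j39 j40]; have [f4 g4] := hf4.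
have i24 : imem s4 24 = imem s3 24 by rewrite f4.
have eout : imem s4 1 0 = imem s2 1 0 by rewrite f4 // f3.
have out0 : imem s1 1 0 = imem s0 1 0 by rewrite f1.
have rb42 k' e : rbound d s4 k' e = rbound d s2 k' e.
  by apply: rbound_frame; rewrite g4 // g3.
have rb10 k' e : rbound d s1 k' e = rbound d s0 k' e.
  by apply: rbound_frame; rewrite g1.
have fl42 k' : flagged d s2 k' -> flagged d s4 k'.
  by move=> hfl i hi; rewrite !(f4 2, f4 3) // !(f3 2, f3 3) //; apply: hfl.
have fl01 k' : flagged d s0 k' -> flagged d s1 k'.
  by move=> hfl i hi; rewrite !(f1 2, f1 3) //; apply: hfl.
(* Boxed points are active, hence uncovered until now: their number is the drop in the uncovered
   count. *)
have hbox : (\sum_(q < Q | CF q == 0%N)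
   (cn n (fun p => (cell p == q) && inbox d y H q p))%:R =
   (unc_count n s0)%:R - (unc_count n s4)%:R :> R)%R.
  rewrite sum_boxed; apply/eqP; rewrite eq_sym subr_eq -natrD eqr_nat addnC.
  apply/eqP/cnD => p hp; rewrite i24 hmv24 //.
    case: ifP => hb; last by rewrite orbF.
    by case/and3P: hb => h _ _; rewrite (hact p hp h).
  by case: ifP.
(* The level can add a rectangle around [j] only if the cell at [loc j] emits its box. *)
pose em j := (CF (loc j) == 0) && (0 < csize n cell (loc j)).
exists cell', (newloc w y CF (imem s1 28) NEW (rmem s1 17) loc),
  (fun j => E j + em j), Q'.
have nule : unc_count n s4 <= unc_count n s0.
  by apply: cn_le => p hp; rewrite i24 hmv24 //; case: ifP.
split => //.
- split; rewrite ?(f4 18) //; first by apply: env_frame hf4.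
  by move=> p hp; rewrite f4 // hmv25.
- by move=> p hp; rewrite i24; apply: hunc3.
- move=> p hp hp'; rewrite i24 hmv24 //.
  have [q0 [h0 e0 _]] := newcell_sub w_gt0 hQ leQ' hcell ids hp hp' erefl.
  have hq : cell p < Q by rewrite e0.
  rewrite hq /=; case: ifP => hb; last exact: hact.
  move: hp'; rewrite /cell' /newcell (leqNgt n) (leq_trans hq hQ) /=.
  by case/andP: hb => -> ->; rewrite /= ltnNge leQ'.
- exact: leq_trans hnule.
- apply: le_trans hmax.
  exact: (sum_max_new _ rho_gt0 rho_lt1 w_gt0 d_gt0 hQ leQ' hcell cuts1 ids).
- apply: le_trans hpot _.
  have := potential_new H rho_gt0 rho_lt1 w_gt0 hQ leQ' hcell cuts1 ids.
  by rewrite hbox -/cell'; lra.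
- move=> q hq; rewrite exprSr mulrA [X in (_ <= X)%R]mulrC.
  apply: (size_new_le rho_gt0 rho_lt1 w_gt0 d_gt0 hQ leQ' hcell cuts1 boxes1 ids) => //.
  apply: mulr_ge0; rewrite ?ler0n // exprn_ge0 // subr_ge0 invf_le1.
    by rewrite ler1n muln_gt0.
  by rewrite ltr0n muln_gt0.
- by move=> j hj; exact: (newloc_lt _ _ _ _ ids hloc hj).
- exact: (newloc_sep H rho_gt0 rho_lt1 w_gt0 d_gt0 y_opp hQ leQ' hcell cuts1 ids hloc hsep).
- move=> j hj; have [h1 h2 h3] := hsparse j hj.
  have hbl q : q < Q -> boxed_cell n cell s1 q -> box_in d y w s1 q j -> q = loc j.
    move=> hq /andP[/eqP c0' m0'] hin.
    exact: (box_loc boxes1 hsep hj hq m0' c0' hin).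
  have := hcount j (loc j) hbl; rewrite hloc //= => hcc.
  have ec4 : cover_count d y s4 j = cover_count d y s2 j.
    rewrite /cover_count eout; apply: cn_eq => k' _.
    by apply: eq_in_all => e _; rewrite rb42.
  have ec1 : cover_count d y s1 j = cover_count d y s0 j.
    rewrite /cover_count out0; apply: cn_eq => k' _.
    by apply: eq_in_all => e _; rewrite rb10.
  have hs : csize n cell' (newloc w y CF (imem s1 28) NEW (rmem s1 17) loc j) <= csize n cell (loc j).
    exact: (size_newloc _ _ _ _ _ w_gt0 hQ leQ' hcell ids hloc hj).
  split.
  + rewrite ec4 addnA; apply: leq_trans hcc _; rewrite ec1.
    by rewrite leq_add2r.
  + rewrite /em; case: (boolP (_ && _)) => [/andP[/eqP c0' m0']|_]; last first.
      by rewrite addn0; apply: leq_trans h2; rewrite leq_mul2l hs orbT.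
    rewrite addn1 expnSr -mulnA mul2n; apply: leq_trans h2; rewrite leq_mul2l.
    apply/orP; right.
    exact: (size_newloc_box _ _ rho_gt0 rho_lt1 w_gt0 d_gt0 hQ leQ' hcell boxes1 ids hloc hj m0' c0').
  + rewrite /em; case: (boolP (_ && _)) => [/andP[/eqP c0' m0']|_]; last by rewrite addn0.
    rewrite addn1 expnS leq_mul2l /=; apply: leq_trans h2.
    by rewrite leq_pmulr.
- move=> k'; rewrite eout => hk'; case: (ltnP k' (imem s1 1 0)) => hk1.
    have [e1 e2] := hsame k' hk1.
    have [|o1 o2] := hout k'; first by rewrite -out0.
    split; first by apply/fl42/e2/fl01.
    move=> i hi; rewrite !rb42 !e1 ?rb10 //; [exact: o2|lia|lia].
  have [|o1 [q [hq /andP[/eqP c0' m0'] hbq]]] := hnewout k'; first by rewrite hk1.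
  split; first exact: fl42.
  move=> i hi; rewrite !rb42 !hbq; [|lia|lia].
  rewrite -/H addrACA addrA.
  exact: (box_width rho_gt0 rho_lt1 w_gt0 d_gt0 y_opp hQ leQ' boxes1 hq m0' c0' hi w_eq b_gt0).
(* A newly covered point lies in the box before its enlargement, hence [w / 3] deep in the emitted
   one. *)
- move=> p hp; rewrite i24 hmv24 //; case: ifP => hb.
    move=> _; case/and3P: hb => hq /eqP c0' hin.
    have m0' : 0 < csize n cell (cell p) by apply/cn_gt0P; exists p.
    have [|k' [hk' hbq]] := hallout (cell p) hq; first by rewrite /boxed_cell -/CF c0'.
    exists k'; rewrite eout; split=> // e he; rewrite rb42 hbq // lerD2r.
    by move/allP: hin; apply; rewrite mem_iota.
  move=> h0; have [k' [hk' hb']] := hcov p hp h0.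
  have hk1 : k' < imem s1 1 0 by rewrite out0.
  exists k'; rewrite eout; split; first exact: leq_trans leo.
  by move=> e he; have [e1 _] := hsame k' hk1; rewrite rb42 e1 // rb10; apply: hb'.
Qed.

End Round.

(** * Rounds *)

Definition start_round : cmd :=
  Seq (For 11 eN (If (BILe (ILoad 24 (ivar 11)) (INum 0))
                     (IStore 25 (ivar 11) eN) (IStore 25 (ivar 11) (INum 0))))
  (Seq (iset 18 (INum 1)) recount).

Definition one_round : cmd :=
  Seq start_round (While (BILe (INum 1) (ivar 39)) level).

Definition rounds : cmd := While (BILe (INum 1) (ivar 40)) one_round.

Section Rounds.
Context {R : realType}.
Variables (rho w Delta : R) (n d a b : nat) (y : nat -> nat -> R).
Variable (ord : nat -> seq nat).
Implicit Types s : state R.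
Local Open Scope nat_scope.

Hypothesis rho_gt0 : (0 < rho)%R.
Hypothesis rho_lt1 : (rho < 1)%R.
Hypothesis w_gt0 : (0 < w)%R.
Hypothesis w_eq : (w * (23 * b%:R) = Delta * rho)%R.
Hypothesis n_gt0 : 0 < n.
Hypothesis d_gt0 : 0 < d.
Hypothesis b_gt0 : 0 < b.
Hypothesis le_4d : 4 * d <= 2 ^ a.
Hypothesis le_a : a <= 2 ^ b.
Hypothesis y_opp : forall e p, e < 2 * d -> y (opp_dir d e) p = (- y e p)%R.
Hypothesis ord_perm : forall e, e < 2 * d -> perm_eq (ord e) (iota 0 n).
Hypothesis ord_sorted : forall e, e < 2 * d ->
  sorted (fun p p' => y e p' <= y e p)%R (ord e).

(** Bounds the boxes around a point in one round, by [2 ^ E <= 2 * m0 <= 2 * n]. It is also a number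
    of halvings that brings [n] below 1. *)
Definition max_boxes : nat := (trunc_log 2 n).+1.

Definition max_levels : nat := 4 * d * max_boxes.

(** Every [4 * d] levels shrink the cells by [(1 - 1/(4d)) ^ (4d) <= exp (-1) <= 1/2], so after
    [max_levels] of them no cell can hold a point. *)
Lemma level_bound k : (1 <= n%:R * (1 - (4 * d)%:R^-1) ^+ k :> R)%R ->
  k < max_levels.
Proof.
have d4 : (0 < (4 * d)%:R :> R)%R by rewrite ltr0n muln_gt0.
have x0 : (0 <= 1 - (4 * d)%:R^-1 :> R)%R.
  by rewrite subr_ge0 invf_le1 // ler1n muln_gt0.
have x1 : (1 - (4 * d)%:R^-1 <= 1 :> R)%R.
  by rewrite lerBlDr lerDl invr_ge0 ltW.
have half : ((1 - (4 * d)%:R^-1) ^+ (4 * d) <= 2^-1 :> R)%R.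
  apply: le_trans (_ : (expR (- 1) <= _)%R); last first.
    rewrite expRN lef_pV2 ?posrE ?expR_gt0 //.
    by have := expR_ge1Dx (1 : R); lra.
  have -> : expR (- 1) = expR (- (4 * d)%:R^-1) ^+ (4 * d) :> R.
    by rewrite -expRM_natr mulNr mulVf // gt_eqF.
  by apply: lerXn2r; rewrite ?nnegrE ?expR_ge0 // expR_ge1Dx.
rewrite ltnNge; apply: contraL => hk; rewrite -ltNge.
apply: le_lt_trans (_ : (n%:R * (2^-1) ^+ max_boxes < 1 :> R)%R).
  rewrite ler_pM2l ?ltr0n //.
  apply: le_trans (_ : ((1 - (4 * d)%:R^-1) ^+ max_levels <= _)%R).
    by apply: ler_wiXn2l.
  by rewrite exprM; apply: lerXn2r; rewrite ?nnegrE ?exprn_ge0 // invr_ge0.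
rewrite exprVn ltr_pdivrMr ?exprn_gt0 // mul1r -natrX ltr_nat.
exact: trunc_log_ltn.
Qed.

Record main_inv (r : nat) s : Prop := MainInv {
  mi_env : env rho w n d y ord s;
  mi_unc : forall p, p < n -> imem s 24 p <= 1;
  mi_nu : imem s 40 0 = unc_count n s;
  mi_out : output_ok Delta d s;
  mi_covered : covered_ok w n d y s;
  mi_sparse : forall j, j < n -> cover_count d y s j <= r * max_boxes;
  mi_pot : (r%:R + (unc_count n s)%:R `^ rho / rho <= n%:R `^ rho / rho)%R }.

Lemma start_round_spec r s0 : main_inv r s0 -> 0 < unc_count n s0 ->
  run start_round s0 (1000 * n) (fun s => exists cell,
    round_inv rho w Delta n d y ord (unc_count n s0)
      (cover_count d y s0) 0 cell (fun=> 0) (fun=> 0) 1 s).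
Proof.
move=> [henv hunc hnu hout hcov hsp hpot] U0.
pose body := If (BILe (ILoad 24 (ivar 11)) (INum 0))
                     (IStore 25 (ivar 11) eN) (IStore 25 (ivar 11) (INum 0)).
apply: (@run_le _ _ _ (forcost eN n (cost body) +
  (cost (iset 18 (INum 1)) + 500 * n).+1).+1); last first.
  have := @forcost_le eN n (cost body) n (leqnn _) n_gt0.
  by move: n_gt0; rewrite /=; clear; lia.
pose cell p := if imem s0 24 p == 0 then n else 0.
have hcell p : p < n -> cell p < 1 \/ cell p = n.
  by rewrite /cell; case: ifP; [right|left].
have ecell p : p < n -> (cell p < 1) = (imem s0 24 p != 0).
  by move=> _; rewrite /cell; case: eqP => //= _; rewrite ltnS leqNgt n_gt0.
have esize : csize n cell 0 = unc_count n s0.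
  apply: cn_eq => p hp; rewrite /cell; case: (eqVneq (imem s0 24 p) 0) => //= _.
  by rewrite gtn_eqF.
apply/run_seq/run_post.
  apply: (@run_for _ (fun k s => forall p, p < k -> imem s 25 p = cell p) 11 eN
    body n (cost body)) => //.
    by move=> s [f _]; rewrite /= f // (env_n henv).
  move=> p s ltp [f _] hp hI; apply: run_step => //=.
  rewrite hp (f 24) // (f 0) // (env_n henv) leqn0 => p'.
  rewrite ltnS leq_eqVlt /cell => /orP[/eqP ->|lt].
    by case: ifP => _; rewrite /= /upd /= ?hp eqxx.
  by case: ifP => _; rewrite /= /upd /= ?hp ltn_eqF // hI.
move=> s1 hf1 h25; have [f1 g1] := hf1.
apply/run_seq/run_step => //; set s2 := step _ s1.
have f2 x : x != 18 -> imem s2 x = imem s1 x.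
  by move=> hx; rewrite /= upd_other.
have g2 : rmem s2 = rmem s1 by [].
have h18 : imem s2 18 0 = 1 by [].
clearbody s2.
have hunc2 p : p < n -> imem s2 24 p <= 1.
  by move=> hp; rewrite f2 // f1 //; apply: hunc.
apply: run_post.
  apply: (recount_spec n_gt0 (cell := cell) _ h18 n_gt0) => //.
    by rewrite f2 // f1 // (env_n henv).
  by move=> p hp; rewrite f2 // h25.
move=> s3 hf3 [h26 h39 h40]; have [f3 g3] := hf3.
have i24 : imem s3 24 = imem s0 24 by rewrite f3 // f2 // f1.
have eU : unc_count n s3 = unc_count n s0 by rewrite /unc_count i24.
have i1 : imem s3 1 = imem s0 1 by rewrite f3 // f2 // f1.
have i2 : imem s3 2 = imem s0 2 by rewrite f3 // f2 // f1.
have i3 : imem s3 3 = imem s0 3 by rewrite f3 // f2 // f1.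
have rb k e : rbound d s3 k e = rbound d s0 k e.
  by rewrite /rbound !g3 // g2 !g1.
have env3 : env rho w n d y ord s3.
  case: henv => e1 e2 e3 e4 e5 e6 e7 e8; split; rewrite ?f3 ?f2 ?f1 ?g3 ?g2 ?g1 // => *;
  rewrite ?f3 ?f2 ?f1 ?g3 ?g2 ?g1 //; auto.
exists cell; split => //.
- split=> //; first by rewrite f3.
  by move=> p hp; rewrite f3 // f2 // h25.
- by move=> p hp; rewrite i24; apply: hunc.
- by move=> p hp; rewrite ecell // i24.
- by rewrite eU.
- by rewrite big_ord1 ler_nat esize geq_max n_gt0 cn_leq.
- by rewrite big_ord1 esize eU subrr add0r.
- by move=> q; rewrite ltnS leqn0 => /eqP ->; rewrite esize expr0 mulr1 ler_nat cn_leq.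
- by move=> j q _; rewrite ltnS leqn0 => /eqP ->.
- move=> j hj; split; rewrite ?mul1n ?addn0 ?esize //; last by rewrite muln_gt0.
  rewrite /cover_count i1; apply: eq_leq; apply: cn_eq => k _.
  by apply: eq_in_all => e _; rewrite rb.
- move=> k; rewrite i1 => hk; have [h1 h2] := hout k hk; split.
    by move=> i hi; rewrite i2 i3; apply: h1.
  by move=> i hi; rewrite !rb; apply: h2.
- move=> p hp; rewrite i24 => h0; have [k [hk hb]] := hcov p hp h0.
  by exists k; rewrite i1; split=> // e he; rewrite rb; apply: hb.
Qed.

Definition round_cost : nat := 100 * 1000 * (n * d * d * max_boxes).

Lemma one_round_spec r s0 : main_inv r s0 -> 0 < unc_count n s0 ->
  run one_round s0 round_cost (main_inv r.+1).
Proof.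
move=> hmi U0; have [henv hunc hnu hout hcov hsp hpot] := hmi.
pose Tl := (bcost (BILe (INum 1) (ivar 39)) + 9 * 1000 * (n * d)).+1.
pose V k := (max_levels - k) * Tl.
set m0 := unc_count n s0; set c0 := cover_count d y s0.
pose I k s := exists cell loc E Q, 
  round_inv rho w Delta n d y ord m0 c0 k cell loc E Q s.
apply: (@run_le _ _ _ (1000 * n + (V 0 + (bcost (BILe (INum 1) (ivar 39))).+1)).+1); last first.
  have h1 : n <= n * d * d * max_boxes.
    by rewrite -!mulnA leq_pmulr // !muln_gt0 d_gt0.
  have h2 : 0 < n * d * d * max_boxes by exact: leq_trans h1.
  have -> : V 0 = 4 * (bcost (BILe (INum 1) (ivar 39))).+1 * (d * max_boxes) +
     4 * (9 * 1000) * (n * d * d * max_boxes).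
    by rewrite /V subn0 /Tl /max_levels /=; clear; nia.
  have h3 : d * max_boxes <= n * d * d * max_boxes.
    by rewrite leq_mul2r leq_pmull ?orbT // muln_gt0 n_gt0.
  move: h1 h2 h3; rewrite /round_cost /=; move: (n * d * d * _) (d * _) => X Z.
  by clear; lia.
apply/run_seq/(run_post (start_round_spec hmi U0)).
move=> s1 _ [cell1 inv1].
apply: run_post.
  apply: (@run_while _ nat I V _ _ 0).
    by exists cell1, (fun=> 0), (fun=> 0), 1.
  move=> k s [cell [loc [E [Q hinv]]]] /= hb.
  exists (9 * 1000 * (n * d)).
  apply: run_post.
    exact: (level_spec rho_gt0 rho_lt1 w_gt0 w_eq n_gt0 d_gt0 b_gt0 le_4d le_a
      y_opp ord_perm ord_sorted hinv).
  move=> s' _ [cell' [loc' [E' [Q' hinv']]]]; exists k.+1; split.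
    by exists cell', loc', E', Q'.
  have hk : k < max_levels.
    apply: level_bound; move: hb; rewrite (ri_act hinv) => /cn_gt0P[p hp hq].
    apply: le_trans (ri_size hinv hq); rewrite ler1n.
    by apply/cn_gt0P; exists p.
  by rewrite /V -(subnSK hk) mulSn /Tl.
move=> s _ [/= hb [k [cell [loc [E [Q [hc hQ hcell hunc' hact hactn hnu' hnule hmax
  hpot' hsize hloc hsep hsparse hout' hcov']]]]]]].
have [henv' _ _ _] := hc.
have sz q : q < Q -> csize n cell q = 0.
  move=> hq; apply: cn0 => p hp; apply/negP => /eqP e.
  move: hb; rewrite hactn => /negP; apply; apply/cn_gt0P; exists p => //.
  by rewrite e.
(* All cells are empty and 0 to the power [1 - rho] is 0, so [ri_pot] now says that the round
   covered at least [m0 ^ (1 - rho)] points. *)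
have hU : (m0%:R `^ (1 - rho) <= (m0 - unc_count n s)%:R :> R)%R.
  apply: le_trans hpot' _; rewrite natrB // big1 ?addr0 // => -[q hq] _ /=.
  by rewrite sz // powR0 // gt_eqF // subr_gt0.
have hrho : (0 < rho < 1)%R by apply/andP.
have := powR_round hrho U0 (leq_subr _ _) hU; rewrite subKn // => hr.
split => //.
  move=> j hj; have [h1 h2 h3] := hsparse j hj.
  apply: leq_trans h1 _; rewrite mulSn addnC leq_add //; last exact: hsp.
  rewrite /max_boxes -trunc_log2_double // trunc_log_max //.
  by apply: leq_trans h3 _; rewrite mul2n leq_double cn_leq.
by rewrite -natr1; move: hpot hr; rewrite -/m0; lra.
Qed.

Lemma rounds_spec s0 : main_inv 0 s0 ->
  run rounds s0 ((Num.truncn (n%:R `^ rho / rho)%R).+1 * (round_cost + 10))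
    (fun s => exists r, main_inv r s /\ unc_count n s = 0).
Proof.
move=> hmi; set K := Num.truncn _.
pose V r := (K - r) * (round_cost + 10).
apply: (@run_le _ _ _ (V 0 + (bcost (BILe (INum 1) (ivar 40))).+1)); last first.
  by rewrite /V subn0 mulSn addnC leq_add2r; apply: leq_trans (leq_addl _ _).
apply: run_post.
  apply: (@run_while _ nat main_inv V _ _ 0) => // r s hinv /= hb.
  have U0 : 0 < unc_count n s by rewrite -(mi_nu hinv).
  exists round_cost; apply: run_post; first exact: (one_round_spec hinv U0).
  move=> s' _ hinv'; exists r.+1; split=> //.
  have hr : r < K.
    rewrite /K; have x0 : (0 <= n%:R `^ rho / rho :> R)%R.
      by rewrite divr_ge0 ?powR_ge0 // ltW.
    (* An uncovered point is left, so its term in [mi_pot] is at least [1 / rho >= 1], and one more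
       round fits under the bound. *)
    rewrite truncn_ge_nat //; apply: le_trans (mi_pot hinv).
    rewrite -natr1 lerD2l ler_pdivlMr // mul1r.
    apply: le_trans (ltW rho_lt1) _.
    have := @ler_powR R (unc_count n s)%:R _ 0%R rho; rewrite powRr0; apply.
      by rewrite ler1n.
    exact: ltW.
  by rewrite /V -(subnSK hr) mulSn leq_add2r; lia.
move=> s _ [/= hb [r hinv]]; exists r; split=> //.
by rewrite -(mi_nu hinv); apply/eqP; rewrite -leqn0 leqNgt.
Qed.

End Rounds.

(** * The output as rectangles of R^d *)

Section Geometry.
Context {R : realType}.
Implicit Types (s : state R).

Lemma mx_norm_leP (d : nat) (x : 'rV[R]_d) (r : R) : 0 <= r ->
  `|x| <= r <-> forall i, `|x ord0 i| <= r.
Proof.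
move=> r0; rewrite {1}/Num.norm /= mx_normrE; split=> [h i|h].
  by apply: le_trans h; apply: (le_bigmax _ (fun ij => `|x ij.1 ij.2|) (ord0, i)).
by apply: bigmax_le => // -[j i] _ /=; rewrite (ord1 j).
Qed.

Lemma in_rect_setP (d : nat) s (k : 'I_(output_size s)) (x : 'rV[R]_d) :
  flagged d s k ->
  rect_set (output d s k) x <-> forall i : 'I_d,
    rmem s 2 (k * d + i)%N <= x ord0 i <= rmem s 3 (k * d + i)%N.
Proof.
move=> hf; split=> h i; have := h i; have [h2 h3] := hf i (ltn_ord i);
  by rewrite /rside /= h2 h3 in_itv.
Qed.

Variables (n d : nat) (X : 'I_n -> 'rV[R]_d) (Delta rho : R).

Definition coordinate (i p : nat) : R :=
  rmem (input X Delta rho) 0 (p * d + i)%N.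

Lemma coordinateE (i : 'I_d) (j : 'I_n) : coordinate i j = X j ord0 i.
Proof.
rewrite /coordinate /= divnMDl ?divn_small ?addn0 ?modnMDl ?modn_small //; last first.
  by apply: leq_ltn_trans (ltn_ord i).
by rewrite !valK.
Qed.

Lemma dirs_opp e p : (e < 2 * d)%N ->
  dirs d coordinate (opp_dir d e) p = - dirs d coordinate e p.
Proof.
rewrite /dirs /opp_dir => he; case: (ltnP e d) => hd.
  by rewrite ltnNge leq_addr /= addKn.
have -> : (e - d < d)%N by lia.
by rewrite opprK.
Qed.

Local Notation y := (dirs d coordinate).

Lemma in_rectE s (k : 'I_(output_size s)) (j : 'I_n) : flagged d s k ->
  in_rect d y s k j = (X j \in rect_set (output d s k)).
Proof.
move=> hf; apply/idP/idP => [/allP h|]; last first.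
  rewrite inE => /(in_rect_setP _ hf) h; apply/allP => e; rewrite mem_iota => /= he.
  rewrite /dirs /rbound; case: ltnP => hd.
    by have := h (Ordinal hd); rewrite -coordinateE => /andP[].
  have hd' : (e - d < d)%N by lia.
  by have := h (Ordinal hd'); rewrite -coordinateE lerN2 => /andP[].
rewrite inE; apply/(in_rect_setP _ hf) => i.
have [h1 h2] : (i < 2 * d)%N /\ (d + i < 2 * d)%N by have := ltn_ord i; lia.
have := h (i : nat); rewrite mem_iota => /(_ h1).
have := h (d + i)%N; rewrite mem_iota => /(_ h2).
rewrite /dirs /rbound ltn_ord ltnNge leq_addr /= addKn lerN2 coordinateE.
by move=> -> ->.
Qed.

Lemma card_cn (m : nat) (P : pred nat) : #|[pred k : 'I_m | P k]| = cn m P.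
Proof.
rewrite /cn -val_enum_ord count_map cardE size_filter.
by rewrite enumT; apply: eq_count => k; rewrite inE.
Qed.

Lemma card_rects s (j : 'I_n) :
  (forall k, (k < output_size s)%N -> flagged d s k) ->
  #|[pred k | X j \in rect_set (output d s k)]| = cover_count d y s j.
Proof.
move=> hf; rewrite /cover_count -card_cn; apply: eq_card => k.
by rewrite !inE /= in_rectE //; apply: hf.
Qed.

Lemma closed_ball_sub_rect s (k : 'I_(output_size s)) (j : 'I_n) (r t : R) :
  flagged d s k -> r <= t ->
  (forall e, (e < 2 * d)%N -> y e j + t <= rbound d s k e) ->
  closed_ball_ Num.norm (X j) r `<=` rect_set (output d s k).
Proof.
move=> hf rt h z /= hz; apply/(in_rect_setP _ hf) => i.
have r0 : 0 <= r by apply: le_trans hz.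
have := (mx_norm_leP _ r0).1 hz i; rewrite !mxE ler_norml.
have [h1 h2] : (i < 2 * d)%N /\ (d + i < 2 * d)%N by have := ltn_ord i; lia.
have := h i h1; have := h _ h2.
rewrite /dirs /rbound ltn_ord ltnNge leq_addr /= addKn coordinateE.
move: (rmem _ _ _) (rmem _ _ _) (z _ _) (X _ _ _) => x1 x2 x3 x4.
by move=> h3 h4 /andP[h5 h6]; apply/andP; lra.
Qed.

Lemma diam_rect s (k : 'I_(output_size s)) (A : set 'rV[R]_d) :
  flagged d s k -> 0 <= Delta -> A `<=` rect_set (output d s k) ->
  (forall i, (i < d)%N -> rbound d s k i + rbound d s k (d + i)%N <= Delta) ->
  (diam A <= Delta%:E)%E.
Proof.
move=> hf D0 hA hw; apply: ge_ereal_sup => _ [x Ax [z Az <-]].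
rewrite lee_fin; apply/mx_norm_leP => // i.
have := (in_rect_setP _ hf).1 (hA _ Ax) i; have := (in_rect_setP _ hf).1 (hA _ Az) i.
have := hw i (ltn_ord i); rewrite /rbound ltn_ord ltnNge leq_addr /= addKn !mxE.
rewrite ler_norml.
move: (rmem _ _ _) (rmem _ _ _) (z _ _) (x _ _) => x1 x2 x3 x4.
by move=> h1 /andP[h2 h3] /andP[h4 h5]; apply/andP; lra.
Qed.

Lemma width_rect s (k : 'I_(output_size s)) : 0 <= Delta ->
  (forall i, (i < d)%N -> rbound d s k i + rbound d s k (d + i)%N <= Delta) ->
  width (output d s k) <= Delta.
Proof.
move=> D0 hw; apply: bigmax_le => // i _ /=.
by have := hw i (ltn_ord i); rewrite /rbound ltn_ord ltnNge leq_addr /= addKn.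
Qed.

End Geometry.

(** * Logarithms *)

Section Logs.
Context {R : realType}.

Lemma lg_ge1 (x : R) : 1 <= lg x. Proof. by rewrite /lg le_max lexx. Qed.

Lemma ln_le_lg (x : R) : ln x <= lg x. Proof. by rewrite /lg le_max lexx orbT. Qed.

(** [ln 2 >= 1/2] gives [trunc_log 2 n <= 2 * ln n]. *)
Lemma trunc_log_lg (n : nat) : (0 < n)%N ->
  (trunc_log 2 n).+1%:R <= 3 * lg n%:R :> R.
Proof.
move=> n0; have h1 := lg_ge1 (n%:R : R); have h2 := ln_le_lg (n%:R : R).
have h3 : (trunc_log 2 n)%:R * ln 2 <= ln n%:R :> R.
  rewrite mulr_natl -lnXn // ler_ln ?posrE ?exprn_gt0 ?ltr0n //.
  exact: trunc_log2_le.
have h4 : (trunc_log 2 n)%:R * 2^-1 <= (trunc_log 2 n)%:R * ln 2 :> R.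
  by apply: ler_wpM2l; [exact: ler0n|exact: half_le_ln2].
by rewrite -natr1; lra.
Qed.

(** By [ln 2 >= 1/2], [a <= 3 + 2 * ln d <= 5 * lg d]; hence [2 ^ b < 10 * lg d <= 2 ^ 4 * lg d] and
    [b <= 4 + 2 * ln (lg d) <= 6 * lg (lg d)]. *)
Lemma ceil_log_log (d a b : nat) : (0 < d)%N ->
  (2 ^ a < 2 * (4 * d))%N -> (2 ^ b < 2 * a)%N ->
  b%:R <= 6 * lg (lg d%:R) :> R.
Proof.
move=> d0 ha hb; have l2 := @half_le_ln2 R; have l2' := @ln2_le1 R.
have lnX (k m : nat) : (0 < m)%N -> (2 ^ k < m)%N -> k%:R * ln 2 <= ln m%:R :> R.
  move=> m0 h; rewrite mulr_natl -lnXn // ler_ln ?posrE ?exprn_gt0 ?ltr0n //.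
  by rewrite -natrX ler_nat ltnW.
have h1 := lg_ge1 (d%:R : R); have h2 := ln_le_lg (d%:R : R).
have h3 := lg_ge1 (lg d%:R : R); have h4 := ln_le_lg (lg d%:R : R).
have a0 : (0 < a)%N by case: a hb {ha}; rewrite ?muln0.
have ea : a%:R * ln 2 <= 3 * ln 2 + ln d%:R :> R.
  apply: le_trans (lnX a (2 * (4 * d))%N _ ha) _; first by rewrite !muln_gt0.
  rewrite mulnA natrM lnM ?posrE ?ltr0n // lerD2r.
  by rewrite (_ : (2 * 4)%N%:R = 2 ^+ 3) ?lnXn // ?mulr_natl // -natrX.
have ea' : a%:R <= 5 * lg d%:R :> R.
  (* For [a >= 3] the factor [ln 2] of [a - 3] may be lowered to [1/2]; for smaller [a] the bound
     follows from [lg d >= 1]. *)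
  have : 0 <= (a%:R - 3) * (ln 2 - 2^-1) :> R \/ a%:R <= 3 :> R.
    case: (leP (3 : R) a%:R) => h; last by right; exact: ltW.
    by left; apply: mulr_ge0; lra.
  by case=> h; lra.
have eb : b%:R * ln 2 <= 4 * ln 2 + ln (lg d%:R) :> R.
  apply: le_trans (lnX b (2 * a)%N _ hb) _; first by rewrite muln_gt0.
  have lp : 0 < lg d%:R :> R by exact: lt_le_trans h1.
  apply: le_trans (_ : ln (2 ^+ 4 * lg d%:R) <= _); last first.
    by rewrite lnM ?posrE ?exprn_gt0 // lnXn // mulr_natl.
  rewrite ler_ln ?posrE ?ltr0n ?muln_gt0 ?mulr_gt0 ?exprn_gt0 //.
  by rewrite natrM exprS -mulrA ler_pM2l //; apply: le_trans ea' _; lra.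
have : 0 <= (b%:R - 4) * (ln 2 - 2^-1) :> R \/ b%:R <= 4 :> R.
  case: (leP (4 : R) b%:R) => h; last by right; exact: ltW.
  by left; apply: mulr_ge0; lra.
by case=> h; lra.
Qed.

End Logs.

(** * The complete program and the bounds of the theorem *)

Definition init_uncovered : cmd :=
  Seq (For 11 eN (IStore 24 (ivar 11) (INum 1))) (iset 40 eN).

Definition cover_program : cmd :=
  Seq set_params (Seq fill_dirs (Seq sort_all (Seq init_uncovered rounds))).

Section CoverProgram.
Context {R : realType}.
Variables (n d : nat) (X : 'I_n -> 'rV[R]_d) (Delta rho : R).
Local Open Scope nat_scope.
Hypothesis n_gt0 : 0 < n.
Hypothesis d_gt0 : 0 < d.
Hypothesis Delta_gt0 : (0 < Delta)%R.
Hypothesis rho_gt0 : (0 < rho)%R.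
Hypothesis rho_lt1 : (rho < 1)%R.

Local Notation y := (dirs d (coordinate X Delta rho)).

Definition round_bound : nat := Num.truncn (n%:R `^ rho / rho)%R.

Lemma cover_program_spec :
  run cover_program (input X Delta rho)
    (200 * 1000 * (n * d * d * max_boxes n * round_bound.+1))
    (fun s => exists a b w r ord,
      [/\ 2 ^ a < 2 * (4 * d), 2 ^ b < 2 * a, 0 < b,
          (w * (23 * b%:R) = Delta * rho)%R /\ unc_count n s = 0 &
          main_inv rho w Delta n d y ord r s]).
Proof.
set s0 := input _ _ _.
have nd0 : 0 < n * d by rewrite muln_gt0 n_gt0.
have n0 : imem s0 0 0 = n by [].
have d0 : imem s0 0 1 = d by [].
pose c1 := IStore 24 (ivar 11) (INum 1).
apply: (@run_le _ _ _ (500 * (8 * (n * d)) + (1000 * (n * d) +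
  (3000 * (n * d * max_boxes n) + ((forcost eN n (cost c1) + cost (iset 40 eN)).+1 +
   round_bound.+1 * (round_cost n d + 10)).+1).+1).+1).+1); last first.
  have h : forcost eN n (cost c1) <= 100 * n.
    apply: leq_trans (forcost_le eN _ (leqnn n) n_gt0) _.
    by rewrite leq_mul2r orbT.
  have hi : cost (iset 40 eN) <= 100 by [].
  rewrite /round_cost.
  set Y := n * d * d * max_boxes n.
  have hn : n <= n * d by rewrite leq_pmulr.
  have h1 : n * d * max_boxes n <= Y by rewrite leq_mul2r leq_pmulr ?orbT.
  have h2 : n * d <= n * d * max_boxes n by rewrite leq_pmulr.
  have h3 : Y <= Y * round_bound.+1 by rewrite leq_pmulr.
  have h4 : round_bound.+1 <= Y * round_bound.+1.
    by rewrite leq_pmull // (leq_trans nd0) // (leq_trans h2).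
  have -> : round_bound.+1 * (100 * 1000 * Y + 10) =
    100 * 1000 * (Y * round_bound.+1) + 10 * round_bound.+1.
    by rewrite mulnDr mulnCA [_.+1 * Y]mulnC [_.+1 * 10]mulnC.
  clearbody Y; move: h hi hn h1 h2 h3 h4 nd0.
  move: (forcost _ _ _) => F; move: (cost _) (Y * _) => c Z.
  by move: (n * d * _) => A; move: (n * d) round_bound.+1 => B K; clear; lia.
apply/run_seq/run_post.
  apply: (@set_params_spec _ n d Delta rho s0) => //.
    by apply: leq_trans (_ : n * d <= _); [rewrite leq_pmulr|rewrite leq_pmull].
  by rewrite leq_mul2l leq_pmull ?orbT.
move=> s1 [f1 g1] [a [b [w [/andP[ha1 ha2] /andP[hb1 hb2] b0 [[hw1 hw2] p1 p2 p3 p4]]]]].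
apply/run_seq/run_post.
  apply: (@fill_dirs_spec _ n d (coordinate X Delta rho) s1 (n * d)) => //.
  - by rewrite f1.
  - by rewrite f1.
  - by move=> i p hi hp; rewrite g1.
move=> s2 [f2 g2] hy.
have n2 : imem s2 0 0 = n by rewrite f2 // f1.
have d2 : imem s2 0 1 = d by rewrite f2 // f1.
apply/run_seq/(run_post (sort_all_spec n2 d2 n_gt0 d_gt0)).
move=> s3 [f3 g3] hord.
have i0 : imem s3 0 = imem s2 0 by rewrite f3.
have i1 : imem s3 1 0 = 0 by rewrite f3 // f2 // f1.
pose ord e := order_dir n e s3.
have ord_perm e : e < 2 * d -> perm_eq (ord e) (iota 0 n).
  by move=> he; case: (hord e he).
have ord_sorted e : e < 2 * d -> sorted (fun p p' => y e p' <= y e p)%R (ord e).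
  move=> he; case: (hord e he) => hp; apply: (sub_in_sorted (P := gtn n)).
    by move=> p p' hp1 hp2; rewrite /lists_dir !hy.
  by apply/allP => p; rewrite (perm_mem hp) mem_iota.
apply/run_seq.
apply: (run_post (Q := fun s => (forall p, p < n -> imem s 24 p = 1) /\ imem s 40 0 = n)).
  apply/run_seq/run_post.
    apply: (@run_for _ (fun k s => forall p, p < k -> imem s 24 p = 1) 11 eN c1 n
      (cost c1)) => //.
      by move=> s [f _]; rewrite /= f // i0.
    move=> p s ltp _ hp hI; apply: run_step => // p'.
    rewrite /= /upd /= hp ltnS leq_eqVlt => /orP[/eqP ->|lt]; first by rewrite eqxx.
    by rewrite ltn_eqF ?hI.
  move=> s [f _] h; apply: run_step => //=.
  by rewrite /upd /= (f 0) // i0 n2.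
move=> s4 [f4 g4] [h24 h40].
have hunc : unc_count n s4 = n.
  rewrite /unc_count -[RHS](size_iota 0 n) -count_predT; apply: cn_eq => p hp.
  by rewrite h24.
have out4 : imem s4 1 0 = 0 by rewrite f4.
have hmi : main_inv rho w Delta n d y ord 0 s4.
  split.
  - have g42 x : x \notin rmods fill_dirs -> rmem s4 x = rmem s1 x.
      by move=> hx; rewrite g4 // g3 // g2.
    split; rewrite ?(f4 0) ?i0 ?(g42 10) ?(g42 11) ?(g42 12) ?(g42 13) //.
    + by move=> e p he hp; rewrite g4 // g3 // hy.
    + by move=> e r he hr; rewrite f4 // /ord /order_dir nth_mkseq.
  - by move=> p hp; rewrite h24.
  - by rewrite h40 hunc.
  - by move=> k; rewrite out4.
  - by move=> p hp; rewrite h24.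
  - by move=> j hj; rewrite /cover_count out4.
  - by rewrite hunc add0r.
apply: run_post.
  exact: (rounds_spec rho_gt0 rho_lt1 hw2 hw1 n_gt0 d_gt0 b0 ha1 hb1
    (fun e p he => dirs_opp X Delta rho p he) ord_perm ord_sorted hmi).
by move=> s _ [r [hr hu]]; exists a, b, w, r, ord; split.
Qed.

End CoverProgram.

Theorem theorem2p3 (R : realType) :
  exists (algo : cmd) (Ct Cs Cb : R),
    [/\ 0 < Ct, 0 < Cs & 0 < Cb] /\
    forall (n d : nat) (X : 'I_n -> 'rV[R]_d) (Delta rho : R),
      (0 < n)%N -> (0 < d)%N -> injective X ->
      0 < Delta -> 0 < rho -> rho < 1 ->
      exists (t : nat) (st : state R),
        [/\ exec algo (input X Delta rho) t st,
            t%:R <= Ct * (n%:R `^ (1 + rho) * rho^-1 * d%:R ^+ 2 * lg n%:R) &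
            let Q := output d st in
            let s := Cs * (n%:R `^ rho * rho^-1 * lg n%:R) in
            let beta := Cb * (rho^-1 * lg (lg d%:R)) in
            [/\ (* Diameter *)
                forall k, width (Q k) <= Delta,
                (* Covering *)
                forall x, range X x ->
                  exists k, closed_ball_ Num.norm x (Delta / beta)
                              `<=` rect_set (Q k),
                (* Sparsity *)
                forall x, range X x ->
                  (#|[pred k | x \in rect_set (Q k)]|)%:R <= s &
                neighborhood_cover (range X) beta s Delta
                  (fun k => range X `&` rect_set (Q k))]].
Proof.
have [C eC C0] : exists2 C : nat, C = (200 * 1000)%N & (0 < C)%N by eexists.
(* In the time, [6 = 3 * 2] comes from [trunc_log_lg] and from
   [round_bound + 1 <= 2 * n ^ rho / rho]. The sparsity constant 3 is that of [trunc_log_lg]. In the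
   radius, [414 = 69 * 6], as [w / 3 = Delta * rho / (69 * b)] and [b <= 6 * lg (lg d)]. *)
exists cover_program, (6 * C%:R), 3, 414; split.
  by split; rewrite ?mulr_gt0 ?ltr0n.
move=> n d X Delta rho n0 d0 _ D0 r0 r1.
have [t [st [hexec ht [a [b [w [r [ord [ha hb b0 [hw hu] hmi]]]]]]]]] :=
  cover_program_spec X n0 d0 D0 r0 r1.
exists t, st; split => //.
  have x1 : 1 <= n%:R `^ rho / rho.
    rewrite ler_pdivlMr // mul1r; apply: le_trans (ltW r1) _.
    have := @ler_powR R n%:R _ 0 rho; rewrite powRr0; apply; last exact: ltW.
    by rewrite ler1n.
  have hK : (round_bound n rho).+1%:R <= 2 * (n%:R `^ rho / rho) :> R.
    have : (round_bound n rho)%:R <= n%:R `^ rho / rho.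
      by rewrite /round_bound truncn_le //; apply: le_trans x1.
    by rewrite -natr1; lra.
  have hm := @trunc_log_lg R n n0.
  have -> : n%:R `^ (1 + rho) = n%:R * n%:R `^ rho.
    rewrite powRD ?powRr1 ?ler0n //.
    by apply/implyP => _; rewrite pnatr_eq0 -lt0n.
  apply: le_trans (_ : (200 * 1000 * (n * d * d * max_boxes n *
    (round_bound n rho).+1))%N%:R <= _); first by rewrite ler_nat.
  rewrite -eC !natrM.
  have -> : 6 * C%:R * (n%:R * n%:R `^ rho / rho * d%:R ^+ 2 * lg n%:R) =
    C%:R * (n%:R * d%:R * d%:R * (3 * lg n%:R) * (2 * (n%:R `^ rho / rho))) by ring.
  rewrite ler_wpM2l // ler_pM ?mulr_ge0 //.
  by rewrite ler_wpM2l ?mulr_ge0.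
case: hmi => henv hunc hnu hout hcov hsparse hpot.
move=> Q s beta.
have lgd : 0 < lg (lg d%:R) :> R by apply: lt_le_trans (lg_ge1 _).
have hfl k : (k < output_size st)%N -> flagged d st k by move=> /hout[].
have hwd (k : 'I_(output_size st)) i : (i < d)%N ->
    rbound d st k i + rbound d st k (d + i)%N <= Delta.
  by move=> hi; have [_ h] := hout k (ltn_ord k); apply: h.
have hdiam k : width (Q k) <= Delta by apply: width_rect; [exact: ltW|exact: hwd].
have hradius : Delta / beta <= w / 3.
  have hbb := @ceil_log_log R d a b d0 ha hb.
  have bR : 0 < b%:R :> R by rewrite ltr0n.
  have -> : w / 3 = Delta * rho / (69 * b%:R).
    by rewrite -hw; field; rewrite gt_eqF.
  have -> : Delta / beta = Delta * rho / (69 * (6 * lg (lg d%:R))).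
    by rewrite /beta; field; rewrite !gt_eqF.
  rewrite ler_pM2l ?mulr_gt0 // lef_pV2 ?posrE ?mulr_gt0 //.
  by rewrite ler_pM2l.
have hcover j : exists k, closed_ball_ Num.norm (X j) (Delta / beta) `<=` rect_set (Q k).
  have u0 : imem st 24 j = 0%N.
    apply/eqP; have := hu; rewrite /unc_count => /eqP; rewrite eqn0Ngt.
    by move=> /cn_gt0P h; apply/negPn/negP => h'; apply: h; exists (j : nat).
  have [k [hk h]] := hcov j (ltn_ord j) u0.
  by exists (Ordinal hk); exact: (closed_ball_sub_rect (k := Ordinal hk) (hfl k hk) hradius h).
have hs j : (#|[pred k | X j \in rect_set (Q k)]|)%:R <= s.
  rewrite (card_rects X Delta rho) //; apply: le_trans (_ : (r * max_boxes n)%N%:R <= _).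
    by rewrite ler_nat; apply: hsparse.
  rewrite natrM /s.
  have -> : 3 * (n%:R `^ rho / rho * lg n%:R) = (n%:R `^ rho / rho) * (3 * lg n%:R) by ring.
  apply: ler_pM => //; last exact: trunc_log_lg.
  (* With no uncovered point left, and [0 ^ rho = 0], the potential bound reads
     [r <= n ^ rho / rho]. *)
  by move: hpot; rewrite hu powR0 ?gt_eqF // mul0r addr0.
split => //; try by move=> _ [j _ <-].
split.
- by move=> k; exact: subIsetl.
- move=> k; apply: (diam_rect (k := k)); [exact: hfl|exact: ltW|exact: subIsetr|exact: hwd].
- move=> _ [j _ <-]; have [k hk] := hcover j; exists k.
  by move=> z [hz1 hz2]; split=> //; apply: hk.
- move=> _ [j _ <-]; apply: le_trans (hs j); rewrite ler_nat; apply: subset_leq_card.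
  by apply/fintype.subsetP => k; rewrite !inE => -[].
Qed.
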